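(* Let $d\in\{1,2\}$, $X_0=(u_0,v_0)^\top\in\mathbb H^1$, $T>0$ and $\|\mathbf Q^{\frac12}\|_{\mathcal L_2(L^2)}<\infty$. Then for any $c>0$ there is a constant $C=C(X_0,\mathbf Q,T,c)>0$, not depending on $N$ and $h$, such that for all $N,M\in\mathbb N^+$ with $Mh=T$, $h\le\bar h_0$, and all $m\in\{0,1,\dots,M\}$, the solution of the splitting averaged vector field scheme satisfies $$\mathbb E\Big[\exp\Big(ch\sum_{i=0}^m\|u^N_i\|_{L^6}^2\Big)\Big]\le C.$$
   Context: Setting. $\mathcal O=(0,1)^d$ with $d\in\{1,2\}$, $L^p=L^p(\mathcal O;\mathbb R)$, and $\Lambda$ is the Laplacian on $\mathcal O$ with homogeneous Dirichlet boundary condition; $0<\lambda_1\le\lambda_2\le\cdots$ are the eigenvalues of $-\Lambda$ with eigenfunctions $\{e_i\}$ forming an orthonormal basis of $L^2$. $\dot{\mathbb H}^r=\mathcal D((-\Lambda)^{r/2})$ with $\|x\|_{\dot{\mathbb H}^r}^2=\sum_i\lambda_i^r\langle x,e_i\rangle_{L^2}^2$, $r\in\mathbb R$; $\mathbb H^r=\dot{\mathbb H}^r\times\dot{\mathbb H}^{r-1}$ with the product norm. $\mathcal L_2(L^2)$ denotes the Hilbert–Schmidt operators on $L^2$. $W$ is an $L^2$-valued $\mathbf Q$-Wiener process on a filtered probability space, where $\mathbf Q$ is a symmetric, positive definite operator of finite trace on $L^2$. $f(u)=c_3u^3+c_2u^2+c_1u+c_0$ with $c_3>0$ is a fixed real polynomial.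 The initial data $u_0,v_0$ are deterministic. Scheme. $P_N$ is the projection $P_N\zeta=\sum_{i=1}^N\langle\zeta,e_i\rangle_{L^2}e_i$ and $\Lambda_N=\Lambda P_N$. With $h=T/M$, $t_m=mh$, $u^N_0=P_Nu_0$, $v^N_0=P_Nv_0$, $\delta W_m=W(t_{m+1})-W(t_m)$, the splitting averaged vector field (AVF) scheme is, for $m=0,\dots,M-1$, $$u^N_{m+1}=u^N_m+h\tfrac{v^N_m+\bar v^N_{m+1}}2,\quad \bar v^N_{m+1}=v^N_m+h\Lambda_N\tfrac{u^N_m+u^N_{m+1}}2-hP_N\int_0^1f(u^N_m+\theta(u^N_{m+1}-u^N_m))d\theta,\quad v^N_{m+1}=\bar v^N_{m+1}+P_N\delta W_m.$$ Standing assumption: there is a sufficiently small $\bar h_0>0$, not depending on $N$, such that for step sizes $h\le\bar h_0$ the solution of this implicit scheme exists and is unique. Constants may depend on the fixed data $d$, $f$. *)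

(* Defs.v *)
From HB Require Import structures.
From mathcomp Require Import all_boot all_order all_algebra.
From mathcomp Require Import all_classical all_reals all_analysis.

Set Implicit Arguments.
Unset Strict Implicit.
Unset Printing Implicit Defensive.

Import Order.TTheory GRing.Theory Num.Theory.
Import numFieldNormedType.Exports.

Local Open Scope classical_set_scope.
Local Open Scope ring_scope.

(* R^d, realised as 'rV[R]_d, carries the product sigma-algebra of the Borel
   sigma-algebra of R (as for tuples in measurable_structure.v). *)
Section measurable_rV.
Context {R : realType}.
Variable d : nat.

Definition rV_coord (i : 'I_d) (x : 'rV[R]_d) : R := x ord0 i.

Let rV_set0 : g_sigma_preimage rV_coord set0.
Proof. exact: sigma_algebra0. Qed.

Let rV_setC A : g_sigma_preimage rV_coord A -> g_sigma_preimage rV_coord (~` A).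
Proof. exact: sigma_algebraC. Qed.

Let rV_bigcup (F : (set 'rV[R]_d)^nat) :
  (forall i, g_sigma_preimage rV_coord (F i)) ->
  g_sigma_preimage rV_coord (\bigcup_i (F i)).
Proof. exact: sigma_algebra_bigcup. Qed.

HB.instance Definition _ := @isMeasurable.Build default_measure_display
  'rV[R]_d (g_sigma_preimage rV_coord) rV_set0 rV_setC rV_bigcup.

End measurable_rV.

Section cube.
Context {R : realType}.

Definition unit_interval_measure : set (measurableTypeR R) -> \bar R :=
  mrestr lebesgue_measure (measurable_itv `]0%R, 1%R[).

HB.instance Definition _ := Measure.on unit_interval_measure.

Let unit_interval_measureT : unit_interval_measure setT = 1%E.
Proof.
rewrite /unit_interval_measure /mrestr setTI lebesgue_measure_itv/= lte_fin.
by rewrite ltr01 -EFinB subr0.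
Qed.

HB.instance Definition _ := Measure_isProbability.Build _ _ _
  unit_interval_measure unit_interval_measureT.

Definition rV_cons d (p : measurableTypeR R * 'rV[R]_d) : 'rV[R]_d.+1 :=
  row_mx (const_mx p.1 : 'rV[R]_1) p.2.

Lemma measurable_rV_coord d (i : 'I_d) :
  measurable_fun [set: 'rV[R]_d] (rV_coord i).
Proof.
move=> _ Y mY; rewrite setTI; apply: sub_sigma_algebra => /=.
rewrite -bigcup_seq/=; exists i => /=; first by rewrite mem_index_enum.
by exists Y => //; rewrite setTI.
Qed.

Lemma measurable_rV_cons d : measurable_fun setT (@rV_cons d).
Proof.
apply: (@measurability _ _ _ _ _ _
  (\big[setU/set0]_(i < d.+1) preimage_set_system setT (rV_coord i) measurable)).
  by [].
move=> _ [B + <-]; rewrite -bigcup_seq => -[i _ [A mA <-]]; rewrite !setTI.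
have -> : @rV_cons d @^-1` (rV_coord i @^-1` A) =
    (rV_coord i \o @rV_cons d) @^-1` A by [].
rewrite -[X in measurable X]setTI.
have [j ->|j ->] := split_ordP (i : 'I_(1 + d)).
  have -> : rV_coord (lshift d j : 'I_d.+1) \o @rV_cons d = fst.
    by apply/funext => -[a x]; rewrite /= /rV_coord (@row_mxEl _ 1 1 d) mxE.
  exact: measurable_fst.
have -> : rV_coord (rshift 1 j : 'I_d.+1) \o @rV_cons d = rV_coord j \o snd.
  by apply/funext => -[a x]; rewrite /= /rV_coord (@row_mxEr _ 1 1 d).
apply: measurableT_comp => //; exact: measurable_rV_coord.
Qed.

HB.instance Definition _ d :=
  isMeasurableFun.Build _ _ _ _ (@rV_cons d) (@measurable_rV_cons d).

(* Lebesgue measure on the open cube O = (0,1)^d, as a (probability) measure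
   on R^d carried by O. *)
Fixpoint cube_measure d : probability 'rV[R]_d R :=
  match d with
  | 0 => \d_(0 : 'rV[R]_0)
  | d'.+1 => distribution (unit_interval_measure \x cube_measure d')%E
               (@rV_cons d')
  end.

Definition open_cube d : set 'rV[R]_d := [set x | forall i, 0 < x ord0 i < 1].

End cube.

Section L2.
Context {R : realType} {d : nat}.
Local Notation X := 'rV[R]_d.
Local Notation mu := (@cube_measure R d).

(* L^p(O) consists of the measurable f : R^d -> R in Lfun mu p, identified when
   equal mu-a.e.; as mu is carried by O, values outside O are irrelevant. *)
Definition inner (f g : X -> R) : R := \int[mu]_x (f x * g x).

Definition norm2 (f : X -> R) : \bar R := 'N[mu]_2%:E[EFin \o f]%E.

Definition norm6 (f : X -> R) : \bar R := 'N[mu]_6%:E[EFin \o f]%E.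

Definition partial (i : 'I_d) (phi : X -> R) : X -> R :=
  fun x => 'D_(delta_mx ord0 i) phi x.

Fixpoint is_Ck (k : nat) (phi : X -> R) : Prop :=
  continuous phi /\
  if k is k'.+1 then forall i : 'I_d,
    (forall x, derivable phi x (delta_mx ord0 i)) /\ is_Ck k' (partial i phi)
  else True.

(* C_c^oo(O) *)
Definition test_function (phi : X -> R) : Prop :=
  (forall k, is_Ck k phi) /\
  closure [set x | phi x != 0] `<=` open_cube (R := R) (d := d).

(* u belongs to H^1_0(O), the H^1-closure of C_c^oo(O), and has gradient g *)
Definition H10_gradient (u : X -> R) (g : 'I_d -> X -> R) : Prop :=
  [/\ u \in Lfun mu 2%:E, forall i, g i \in Lfun mu 2%:E &
    exists phi : nat -> X -> R, [/\ forall n, test_function (phi n),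
      norm2 (phi n \- u) @[n --> \oo] --> 0%E &
      forall i, norm2 (partial i (phi n) \- g i) @[n --> \oo] --> 0%E]].

(* graph of the Dirichlet Laplacian: u in H^1_0(O) and w in L^2(O) is the
   distributional Laplacian of u *)
Definition is_laplacian (u w : X -> R) : Prop :=
  w \in Lfun mu 2%:E /\
  exists2 g, H10_gradient u g &
    forall phi, test_function phi ->
      \sum_(i < d) inner (g i) (partial i phi) = - inner w phi.

(* off the domain of the operator the value is the zero function *)
Definition laplacian (u : X -> R) : X -> R :=
  xget (cst 0) [set w | is_laplacian u w].

Section spectral.
Variables (lam : nat -> R) (e : nat -> X -> R).

Definition proj (N : nat) (z : X -> R) : X -> R :=
  fun x => \sum_(i < N) inner z (e i) * e i x.

(* Eigenvalues and eigenfunctions are indexed from 0: lam i and e i stand for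
   lambda_(i+1) and e_(i+1). *)
Record dirichlet_eigenbasis : Prop := {
  eigen_gt0 : forall i, 0 < lam i;
  eigen_nondecreasing : nondecreasing_seq lam;
  eigen_laplacian : forall i, is_laplacian (e i) (fun x => - lam i * e i x);
  eigen_orthonormal : forall i j, inner (e i) (e j) = (i == j)%:R;
  eigen_complete : forall z, z \in Lfun mu 2%:E ->
    norm2 (z \- proj N z) @[N --> \oo] --> 0%E
}.

(* x \in \dot H^r, for r >= 0 (so that \dot H^r is a subspace of L^2) *)
Definition in_dotH (r : R) (x : X -> R) : Prop :=
  x \in Lfun mu 2%:E /\
  (\sum_(0 <= i <oo) (lam i `^ r * inner x (e i) ^+ 2)%:E < +oo)%E.

(* (x, y) \in H^r = \dot H^r x \dot H^(r-1), for r >= 1 *)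
Definition in_H (r : R) (x y : X -> R) : Prop :=
  in_dotH r x /\ in_dotH (r - 1) y.

Definition laplacianN (N : nat) (z : X -> R) : X -> R := laplacian (proj N z).

(* z is (a representative of) an element of the range of proj N *)
Definition in_range_proj (N : nat) (z : X -> R) : Prop :=
  z \in Lfun mu 2%:E /\ z = proj N z %[ae mu].

Definition trace (A : (X -> R) -> X -> R) : \bar R :=
  (\sum_(0 <= i <oo) (inner (A (e i)) (e i))%:E)%E.

Definition hilbert_schmidt_norm (A : (X -> R) -> X -> R) : \bar R :=
  ((\sum_(0 <= i <oo) norm2 (A (e i)) ^+ 2) `^ 2^-1)%E.

End spectral.

(* Operators on L^2(O) act on representatives; boundedness and linearity a.e.
   make them compatible with equality a.e. *)
Record bounded_operator (A : (X -> R) -> X -> R) : Prop := {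
  op_L2 : forall z, z \in Lfun mu 2%:E -> A z \in Lfun mu 2%:E;
  op_linear : forall (a : R) z z', z \in Lfun mu 2%:E -> z' \in Lfun mu 2%:E ->
    A (fun x => a * z x + z' x) = (fun x => a * A z x + A z' x) %[ae mu];
  op_bounded : exists K : R, forall z, z \in Lfun mu 2%:E ->
    (norm2 (A z) <= K%:E * norm2 z)%E
}.

Definition symmetric_operator (A : (X -> R) -> X -> R) : Prop :=
  forall z z', z \in Lfun mu 2%:E -> z' \in Lfun mu 2%:E ->
    inner (A z) z' = inner z (A z').

Definition nonneg_operator (A : (X -> R) -> X -> R) : Prop :=
  forall z, z \in Lfun mu 2%:E -> 0 <= inner (A z) z.

Definition posdef_operator (A : (X -> R) -> X -> R) : Prop :=
  forall z, z \in Lfun mu 2%:E -> ~ (z = cst 0 %[ae mu]) -> 0 < inner (A z) z.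

(* S = A^(1/2) *)
Definition is_sqrt_operator (S A : (X -> R) -> X -> R) : Prop :=
  [/\ bounded_operator S, symmetric_operator S, nonneg_operator S &
    forall z, z \in Lfun mu 2%:E -> S (S z) = A z %[ae mu]].

End L2.

(* The centered Gaussian law of variance s2; normal_prob is not the Dirac mass
   when its standard deviation is 0. *)
Definition centered_gaussian (R : realType) (s2 : R) : set R -> \bar R :=
  if s2 == 0 then dirac (0 : R) else normal_prob 0 (Num.sqrt s2).

Section wiener.
Context {R : realType} {d : nat} (T : R).
Context {dO : measure_display} {Omega : measurableType dO}.
Variable (P : probability Omega R).
Local Notation X := 'rV[R]_d.
Local Notation mu := (@cube_measure R d).

Definition filtration (F : R -> set_system Omega) : Prop :=
  [/\ forall t : R, 0 <= t <= T -> sigma_algebra setT (F t),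
      forall t : R, 0 <= t <= T -> F t `<=` measurable &
      forall s t : R, 0 <= s -> s <= t -> t <= T -> F s `<=` F t].

(* sigma-algebra generated by an L^2-valued map Y: the Borel sigma-algebra of
   the separable Hilbert space L^2 is generated by the maps <., phi> *)
Definition sigma_L2 (Y : Omega -> X -> R) : set_system Omega :=
  <<s \bigcup_(phi in [set phi : X -> R | phi \in Lfun mu 2%:E])
        preimage_set_system setT (fun w => inner (Y w) phi) measurable >>.

Definition independent_systems (G H : set_system Omega) : Prop :=
  forall A B, G A -> H B -> P (A `&` B) = (P A * P B)%E.

Record wiener_process (F : R -> set_system Omega)
    (Q : (X -> R) -> X -> R) (W : R -> Omega -> X -> R) : Prop := {
  wiener_L2 : forall (t : R) w, 0 <= t <= T -> W t w \in Lfun mu 2%:E;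
  wiener_adapted : forall t : R, 0 <= t <= T -> sigma_L2 (W t) `<=` F t;
  wiener0 : {ae P, forall w, W 0 w = cst 0 %[ae mu]};
  wiener_continuous : {ae P, forall w (t : R), 0 <= t <= T ->
    norm2 (W s w \- W t w) @[s --> within `[0, T] (nbhs t)] --> 0%E};
  (* W t - W s is N(0, (t - s) Q)-distributed *)
  wiener_gaussian : forall s t : R, 0 <= s -> s < t -> t <= T ->
    forall phi, phi \in Lfun mu 2%:E -> forall B : set R, measurable B ->
      P ((fun w => inner (W t w \- W s w) phi) @^-1` B) =
      centered_gaussian ((t - s) * inner (Q phi) phi) B;
  wiener_independent : forall s t : R, 0 <= s -> s < t -> t <= T ->
    independent_systems (F s) (sigma_L2 (fun w => W t w \- W s w))
}.

End wiener.

Section avf_scheme.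
Context {R : realType} {d : nat}.
Variable (e : nat -> 'rV[R]_d -> R) (f : R -> R).
Local Notation X := 'rV[R]_d.
Local Notation mu := (@cube_measure R d).

(* x |-> \int_0^1 f(u(x) + theta (u'(x) - u(x))) dtheta *)
Definition average_field (u u' : X -> R) : X -> R :=
  fun x => \int[lebesgue_measure]_(th in `[0, 1]) f (u x + th * (u' x - u x)).

(* (u', vb) = (u_(m+1), \bar v_(m+1)) solves the implicit AVF equations issued
   from (u, v) = (u_m, v_m) with step size h *)
Definition avf_step (N : nat) (h : R) (u v u' vb : X -> R) : Prop :=
  [/\ u' \in Lfun mu 2%:E, vb \in Lfun mu 2%:E,
      u' = (fun x => u x + h * ((v x + vb x) / 2)) %[ae mu] &
      vb = (fun x => v x + h * laplacianN e N (fun y => (u y + u' y) / 2) x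
                     - h * proj e N (average_field u u') x) %[ae mu]].

(* existence and uniqueness for the implicit equations, for all N and all step
   sizes h = T / M <= hbar0 *)
Definition avf_well_posed (T hbar0 : R) : Prop :=
  forall N M : nat, (0 < N)%N -> (0 < M)%N ->
  forall h : R, M%:R * h = T -> h <= hbar0 ->
  forall u v : X -> R, in_range_proj e N u -> in_range_proj e N v ->
  exists u' vb, avf_step N h u v u' vb /\
    forall u'' vb'', avf_step N h u v u'' vb'' ->
      (u'' = u' %[ae mu]) /\ (vb'' = vb %[ae mu]).

Record splitting_avf_solution (h : R) (u0 v0 : X -> R) (N M : nat)
    {dO : measure_display} {Omega : measurableType dO}
    (P : probability Omega R) (W : R -> Omega -> X -> R)
    (u vb v : nat -> Omega -> X -> R) : Prop := {
  avf_L2 : forall m w, (m <= M)%N ->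
    u m w \in Lfun mu 2%:E /\ v m w \in Lfun mu 2%:E;
  avf_initial : {ae P, forall w,
    (u 0%N w = proj e N u0 %[ae mu]) /\ (v 0%N w = proj e N v0 %[ae mu])};
  avf_iterate : forall m, (m < M)%N -> {ae P, forall w,
    avf_step N h (u m w) (v m w) (u m.+1 w) (vb m.+1 w) /\
    v m.+1 w = (fun x => vb m.+1 w x +
      proj e N (W (m.+1%:R * h) w \- W (m%:R * h) w) x)
      %[ae mu]}
}.

End avf_scheme.

(* Main.v *)
Require Import Defs.
From HB Require Import structures.
From mathcomp Require Import all_boot all_order all_algebra.
From mathcomp Require Import ring lra.
From mathcomp Require Import all_classical all_reals all_analysis.
From mathcomp Require Import measurable_realfun.
Import Order.TTheory GRing.Theory Num.Theory.
Import numFieldNormedType.Exports.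
Local Open Scope classical_set_scope.
Local Open Scope ring_scope.
Set Implicit Arguments.
Unset Strict Implicit.
Unset Printing Implicit Defensive.

(** Let F be the primitive of the cubic f that vanishes at 0.  The averaged
    vector field step conserves the energy

      V(u, v) = |v|^2 / 2 + |grad u|^2 / 2 + \int (F(u) + C)

    exactly, because the averaged nonlinearity is the difference quotient of F
    ([cubic_avg_quartic], [energy_conservation]).  Only the noise changes V, by
    <v, dW> + |dW|^2 / 2 with dW the projected increment, which is Gaussian and
    independent of the past.  Integrating it out with the past frozen
    ([independent_integral], [gaussian_vector_exp]) gives

      E exp(b V_(m+1)) <= exp(b h tau) E exp((b + 2 b^2 h K) V_m),

    where tau bounds the trace of Q and K its quadratic form
    ([exp_energy_step]); neither depends on N.  Along the decreasing exponents
    b_m = beta / (1 + 2 beta h K)^m the quadratic loss is absorbed, and these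
    exponents stay above bst = beta exp(- 2 beta K T) up to time T.  Hence
    E exp(bst V_m) is bounded uniformly in m, N and h ([exp_energy_bound]).

    The energy controls the L^6 norm with a constant as large as desired.  For
    d <= 2 one has \int u^6 <= 81 |u|^2 |grad u|^4 on H^1_0 ([sobolev_H10]), so
    that

      |u|_(L^6)^2 <= eps |grad u|^2 + (27 / eps^2) |u|^2

    for every eps > 0.  The quartic growth of F lets \int (F(u) + C) dominate any
    multiple of |u|^2 once C is large ([quartic_coercive]), so C and eps can be
    chosen after bst such that 2 c T |u|_(L^6)^2 <= bst V ([norm6_le_energy]).
    As c h (m + 1) <= 2 c T, Jensen's inequality over the m + 1 time points
    reduces the claim to the exponential moments of V.

    The probabilistic argument takes place in the coordinates along the first N
    eigenfunctions.  There the Laplacian is diagonal because the weak form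
    determines it up to null sets ([is_laplacian_unique]), and the implicit
    equations become finitely many polynomial equations with exactly one
    solution, which is therefore a measurable function of the data
    ([measurable_implicit_function], [measurable_solver]). *)

(** * Square-integrable functions on the cube *)

Section L2_toolkit.
Context {R : realType} {d : nat}.
Local Notation X := 'rV[R]_d.
Local Notation mu := (@cube_measure R d).
Implicit Types f g h : X -> R.

Lemma Lfun2P f : (f \in Lfun mu 2%:E) <->
  measurable_fun setT f /\ mu.-integrable setT (EFin \o (fun x => f x ^+ 2)).
Proof.
split=> [lf|[mf intf]].
  split; last exact: Lfun2_integrable_sqr.
  by move: lf; rewrite inE => /andP[]; rewrite inE.
rewrite inE; apply/andP; split; rewrite inE //=.
rewrite /finite_norm unlock; apply: poweR_lty.
move/integrableP : intf => [_]; apply: le_lt_trans.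
rewrite le_eqVlt; apply/orP; left; apply/eqP.
apply: eq_integral => x _ /=.
by rewrite normrX powR_mulrn.
Qed.

Lemma Lfun2_measurable f : f \in Lfun mu 2%:E -> measurable_fun setT f.
Proof. by case/Lfun2P. Qed.

Lemma inner_integrable f g : f \in Lfun mu 2%:E -> g \in Lfun mu 2%:E ->
  mu.-integrable setT (EFin \o (fun x => f x * g x)).
Proof. by move=> lf lg; apply/Lfun1_integrable/Lfun2_mul_Lfun1. Qed.

Lemma Lfun2D f g : f \in Lfun mu 2%:E -> g \in Lfun mu 2%:E ->
  (fun x => f x + g x) \in Lfun mu 2%:E.
Proof.
move=> lf lg; have mf := Lfun2_measurable lf; have mg := Lfun2_measurable lg.
apply/Lfun2P; split; first exact: measurable_funD.
have -> : EFin \o (fun x => (f x + g x) ^+ 2) =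
  (((EFin \o (fun x => f x ^+ 2)%R) \+ (EFin \o (fun x => f x * g x)%R)) \+
  ((EFin \o (fun x => f x * g x)%R) \+ (EFin \o (fun x => g x ^+ 2)%R)))%E.
  by apply/funext => x /=; rewrite -!EFinD; congr EFin; ring.
by do ?apply: integrableD => //; try exact: inner_integrable;
  exact: Lfun2_integrable_sqr.
Qed.

Lemma Lfun2Z (a : R) f : f \in Lfun mu 2%:E ->
  (fun x => a * f x) \in Lfun mu 2%:E.
Proof.
move=> lf; have mf := Lfun2_measurable lf.
apply/Lfun2P; split; first exact: measurable_funM.
have -> : EFin \o (fun x => (a * f x) ^+ 2) =
  (fun x => (a ^+ 2)%:E * (EFin \o (fun x => f x ^+ 2)%R) x)%E.
  by apply/funext => x /=; rewrite exprMn EFinM.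
by apply: integrableZl => //; exact: Lfun2_integrable_sqr.
Qed.

Lemma Lfun2_cst (a : R) : (fun _ => a) \in Lfun mu 2%:E.
Proof. exact: (Lfun_cst mu a 2). Qed.

Lemma Lfun2N f : f \in Lfun mu 2%:E -> (fun x => - f x) \in Lfun mu 2%:E.
Proof.
move=> lf; rewrite (_ : (fun x => - f x) = (fun x => -1 * f x)) ?Lfun2Z//.
by apply/funext => x; rewrite mulN1r.
Qed.

Lemma Lfun2B f g : f \in Lfun mu 2%:E -> g \in Lfun mu 2%:E ->
  (fun x => f x - g x) \in Lfun mu 2%:E.
Proof. by move=> lf lg; apply: Lfun2D => //; exact: Lfun2N. Qed.

Lemma Lfun2_sum I (r : seq I) (F : I -> X -> R) :
  (forall i, F i \in Lfun mu 2%:E) ->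
  (fun x => \sum_(i <- r) F i x) \in Lfun mu 2%:E.
Proof.
move=> lF; elim: r => [|i r IH].
  by rewrite (_ : (fun x => _) = cst 0) ?Lfun2_cst//; apply/funext => x; rewrite big_nil.
rewrite (_ : (fun x => _) = (fun x => F i x + \sum_(j <- r) F j x)); first exact: Lfun2D.
by apply/funext => x; rewrite big_cons.
Qed.

Lemma Lfun2_lincomb n (a : 'I_n -> R) (F : 'I_n -> X -> R) :
  (forall i, F i \in Lfun mu 2%:E) ->
  (fun x => \sum_i a i * F i x) \in Lfun mu 2%:E.
Proof. by move=> lF; apply: Lfun2_sum => i; exact: Lfun2Z. Qed.

Lemma bounded_Lfun2 f (M : R) : measurable_fun setT f ->
  (forall x, `|f x| <= M) -> f \in Lfun mu 2%:E.
Proof.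
move=> mf HM; apply/Lfun2P; split => //.
apply: measurable_bounded_integrable => //.
- by apply: (le_lt_trans (probability_le1 mu measurableT)); rewrite ltry.
- exact: measurable_funX.
exists (M ^+ 2); split; first exact: num_real.
move=> y My x _ /=; apply: le_trans (ltW My).
by rewrite normrX lerXn2r ?nnegrE// (le_trans _ (HM x)).
Qed.

Lemma innerC f g : inner f g = inner g f.
Proof. by apply: eq_Rintegral => x _; rewrite mulrC. Qed.

Lemma innerDl f g h : f \in Lfun mu 2%:E -> g \in Lfun mu 2%:E ->
  h \in Lfun mu 2%:E -> inner (fun x => f x + g x) h = inner f h + inner g h.
Proof.
move=> lf lg lh; rewrite /inner -RintegralD//; try exact: inner_integrable.
by apply: eq_Rintegral => x _; rewrite mulrDl.
Qed.

Lemma innerZl (a : R) f h : f \in Lfun mu 2%:E -> h \in Lfun mu 2%:E ->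
  inner (fun x => a * f x) h = a * inner f h.
Proof.
move=> lf lh; rewrite /inner -RintegralZl//; last exact: inner_integrable.
by apply: eq_Rintegral => x _; rewrite mulrA.
Qed.

Lemma innerNl f h : f \in Lfun mu 2%:E -> h \in Lfun mu 2%:E ->
  inner (fun x => - f x) h = - inner f h.
Proof.
move=> lf lh; rewrite -mulN1r -innerZl//; congr inner.
by apply/funext => x; rewrite mulN1r.
Qed.

Lemma innerBl f g h : f \in Lfun mu 2%:E -> g \in Lfun mu 2%:E ->
  h \in Lfun mu 2%:E -> inner (fun x => f x - g x) h = inner f h - inner g h.
Proof.
move=> lf lg lh.
by rewrite (innerDl lf (Lfun2N lg) lh) innerNl.
Qed.

Lemma inner0l h : inner (fun _ => 0) h = 0.
Proof.
transitivity (\int[mu]_(x in [set: X]) (0 : R)).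
  by apply: eq_Rintegral => x _; rewrite mul0r.
by rewrite Rintegral_cst// mul0r.
Qed.

Lemma inner_suml I (r : seq I) (F : I -> X -> R) h :
  (forall i, F i \in Lfun mu 2%:E) -> h \in Lfun mu 2%:E ->
  inner (fun x => \sum_(i <- r) F i x) h = \sum_(i <- r) inner (F i) h.
Proof.
move=> lF lh; elim: r => [|i r IH].
  rewrite big_nil -[RHS](inner0l h).
  by congr inner; apply/funext => x; rewrite big_nil.
rewrite big_cons -IH -innerDl//; last exact: Lfun2_sum.
by congr inner; apply/funext => x; rewrite big_cons.
Qed.

Lemma inner_lincombl n (a : 'I_n -> R) (F : 'I_n -> X -> R) h :
  (forall i, F i \in Lfun mu 2%:E) -> h \in Lfun mu 2%:E ->
  inner (fun x => \sum_i a i * F i x) h = \sum_i a i * inner (F i) h.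
Proof.
move=> lF lh; rewrite inner_suml//; last by move=> i; exact: Lfun2Z.
by apply: eq_bigr => i _; rewrite innerZl.
Qed.

Lemma inner_ge0 f : 0 <= inner f f.
Proof. by apply: Rintegral_ge0 => x _; rewrite -expr2 sqr_ge0. Qed.

Lemma norm2E f : f \in Lfun mu 2%:E -> norm2 f = (Num.sqrt (inner f f))%:E.
Proof.
move=> lf; rewrite /norm2 unlock.
have -> : (\int[mu]_x (`|(EFin \o f) x| `^ 2) = (inner f f)%:E)%E.
  rewrite /inner/= /Rintegral fineK.
    by apply: eq_integral => x _ /=; rewrite -expr2 -real_normK ?num_real// -powR_mulrn.
  by apply: integrable_fin_num => //; exact: inner_integrable.
by rewrite poweR_EFin powR12_sqrt// inner_ge0.
Qed.

(** The quadratic polynomial t |-> |f + t g|^2 is nonnegative: it is evaluated at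
    its minimum, or, when g has norm 0 and it is affine, at the point where it
    would be -1 if <f, g> were not 0. *)
Lemma inner_CS f g : f \in Lfun mu 2%:E -> g \in Lfun mu 2%:E ->
  inner f g ^+ 2 <= inner f f * inner g g.
Proof.
move=> lf lg.
have Hq t : 0 <= inner f f + t * (2 * inner f g) + t ^+ 2 * inner g g.
  have := inner_ge0 (fun x => f x + t * g x).
  have ltg := Lfun2Z t lg.
  rewrite (innerDl lf ltg (Lfun2D lf ltg)) (innerZl _ lg (Lfun2D lf ltg)).
  rewrite (innerC f) (innerC g) (innerDl lf ltg lf) (innerDl lf ltg lg).
  rewrite !(innerZl _ lg)// (innerC g f) => H.
  by apply: le_trans H _; rewrite le_eqVlt; apply/orP; left; apply/eqP; ring.
have g0 := inner_ge0 g; have f0 := inner_ge0 f.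
have [g0'|gn0] := eqVneq (inner g g) 0.
  rewrite g0' mulr0; have [->|fgn0] := eqVneq (inner f g) 0; first by rewrite expr0n.
  exfalso; have := Hq (- (inner f f + 1) / (2 * inner f g)).
  rewrite g0' mulr0 addr0 divfK ?mulf_neq0//.
  by rewrite opprD addNKr ler0N1.
have gp : 0 < inner g g by rewrite lt_neqAle eq_sym gn0.
have := mulr_ge0 g0 (Hq (- inner f g / inner g g)).
have -> : inner g g * (inner f f + - inner f g / inner g g * (2 * inner f g) +
   (- inner f g / inner g g) ^+ 2 * inner g g) = inner f f * inner g g - inner f g ^+ 2.
  by field.
by rewrite subr_ge0.
Qed.

Lemma inner_CS_sqrt f g : f \in Lfun mu 2%:E -> g \in Lfun mu 2%:E ->
  `|inner f g| <= Num.sqrt (inner f f) * Num.sqrt (inner g g).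
Proof.
move=> lf lg; rewrite -sqrtrM ?inner_ge0// -sqrtr_sqr.
by rewrite ler_sqrt ?inner_CS// mulr_ge0 ?inner_ge0.
Qed.

Lemma ae_eq_inner f f' g : f = f' %[ae mu] ->
  measurable_fun setT f -> measurable_fun setT f' -> measurable_fun setT g ->
  inner f g = inner f' g.
Proof.
move=> ff' mf mf' mg; rewrite /inner /Rintegral; congr fine.
apply: ae_eq_integral => //.
- by apply/measurable_EFinP; exact: measurable_funM.
- by apply/measurable_EFinP; exact: measurable_funM.
- by apply: filterS ff' => x /= -> .
Qed.

Lemma inner_eq0 f : f \in Lfun mu 2%:E -> inner f f = 0 -> f = cst 0 %[ae mu].
Proof.
move=> lf f0; have mf := Lfun2_measurable lf.
have /(@ae_eq_integral_abs _ _ _ mu setT measurableT (EFin \o (fun x => f x ^+ 2))) :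
  measurable_fun setT (EFin \o (fun x => f x ^+ 2)).
  by apply/measurable_EFinP; exact: measurable_funX.
move=> [+ _].
have -> : (\int[mu]_x `|(EFin \o (fun x => (f x ^+ 2)%R)) x| = (inner f f)%:E)%E.
  rewrite /inner /Rintegral fineK; last by apply: integrable_fin_num => //; exact: inner_integrable.
  by apply: eq_integral => x _ /=; rewrite normrX real_normK ?num_real// expr2.
rewrite f0 => /(_ erefl); apply: filterS => x /= /(_ I) [] /eqP.
by rewrite sqrf_eq0 => /eqP ->.
Qed.

End L2_toolkit.

(** * Test functions *)

Section test_functions.
Context {R : realType} {d : nat}.
Local Notation X := 'rV[R]_d.
Local Notation mu := (@cube_measure R d).
Implicit Types phi : X -> R.

Let grid (k : nat) (z : 'rV[int]_d) : X := \row_i ((z ord0 i)%:~R / k.+1%:R).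

Let cell (k : nat) (x : X) : 'rV[int]_d := \row_i Num.floor (k.+1%:R * x ord0 i).

Let measurable_cell k z : measurable [set x | cell k x = z].
Proof.
have -> : [set x | cell k x = z] = \bigcap_(i in [set: 'I_d])
    rV_coord i @^-1` [set t | (z ord0 i)%:~R / k.+1%:R <= t < (z ord0 i + 1)%:~R / k.+1%:R].
  have k0 : (0 : R) < k.+1%:R by rewrite ltr0n.
  apply/seteqP; split=> x /=.
    move=> <- i _ /=; rewrite mxE /rV_coord ler_pdivrMr// ltr_pdivlMr//.
    rewrite (mulrC (x ord0 i)) Num.Theory.ge_floor/=.
    by rewrite Num.Theory.floorD1_gt.
  move=> H; apply/rowP => i; rewrite mxE.
  apply/eqP; rewrite Num.Theory.floor_eq.
  move: (H i I) => /=; rewrite /rV_coord ler_pdivrMr// ltr_pdivlMr//.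
  by rewrite (mulrC (x ord0 i)).
apply: fin_bigcap_measurable; first exact: finite_finset.
move=> i _; rewrite -[X in measurable X]setTI.
apply: measurable_rV_coord => //.
exact: (measurable_itv `[_, _[).
Qed.

(** The measurable sets of R^d are generated by the coordinates rather than by the
    open sets.  A continuous function is the limit of its compositions with the
    rounding to a grid of mesh 1 / (k + 1), which take countably many values. *)
Lemma continuous_rV_measurable phi : continuous phi -> measurable_fun setT phi.
Proof.
move=> cphi.
apply: (@measurable_fun_cvg _ _ _ _ (fun k x => phi (grid k (cell k x)))).
  move=> k _ B mB; rewrite setTI.
  have -> : (fun x => phi (grid k (cell k x))) @^-1` B =
      \bigcup_(z in [set: 'rV[int]_d]) ([set x | cell k x = z] `&` [set x | B (phi (grid k z))]).
    apply/seteqP; split => x /=; first by move=> H; exists (cell k x).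
    by move=> [z _ [/= <-]].
  apply: countable_bigcupT_measurable; first exact: countableP.
  move=> z; apply: measurableI; first exact: measurable_cell.
  have [Bz|Bz] := pselect (B (phi (grid k z))).
    by rewrite (_ : [set x | _] = setT)//; apply/seteqP; split.
  by rewrite (_ : [set x | _] = set0)//; apply/seteqP; split.
move=> x _.
suff cv : grid k (cell k x) @[k --> \oo] --> x by exact: (cvg_comp _ _ cv (cphi x)).
apply/cvgrPdist_le => eps eps0.
near=> k; rewrite [leLHS]/Num.norm/= mx_normrE.
apply/bigmax_leP; split; first exact: ltW.
move=> [i j] _ /=; rewrite (ord1 i) !mxE.
have k0 : (0 : R) < k.+1%:R by rewrite ltr0n.
have f1 := Num.Theory.ge_floor (k.+1%:R * x ord0 j).
have f2 := Num.Theory.floorD1_gt (k.+1%:R * x ord0 j).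
rewrite intrD1 in f2.
have keps : k.+1%:R^-1 <= eps.
  apply: ltW; near: k; exact: near_infty_natSinv_lt (PosNum eps0).
apply: le_trans keps.
set fl : R := (Num.floor _)%:~R in f1 f2 *.
have -> : x ord0 j - fl / k.+1%:R = (k.+1%:R * x ord0 j - fl) / k.+1%:R.
  by field; rewrite gt_eqF.
rewrite ger0_norm; last by rewrite divr_ge0 ?subr_ge0// ltW.
rewrite -[leRHS]mul1r ler_pM2r ?invr_gt0// lerBlDr addrC. exact: ltW.
Unshelve. all: by end_near. Qed.

Lemma test_continuous phi : test_function phi -> continuous phi.
Proof. by move=> [/(_ 0%N) []]. Qed.

Lemma test_measurable phi : test_function phi -> measurable_fun setT phi.
Proof. by move/test_continuous/continuous_rV_measurable. Qed.

Lemma test_derivable phi i x : test_function phi ->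
  derivable phi x (delta_mx ord0 i).
Proof. by move=> [/(_ 1%N) [_ /(_ i) [+ _]]] _; apply. Qed.

Lemma test_eq0 phi x : test_function phi -> ~ open_cube x -> phi x = 0.
Proof.
move=> [_ sphi] nx; apply/eqP/negP => /negP px; apply: nx; apply: sphi.
exact: subset_closure.
Qed.

(** A derivative vanishes wherever the function vanishes on a neighbourhood, so
    that the support does not grow. *)
Lemma test_partial phi i : test_function phi -> test_function (partial i phi).
Proof.
move=> [Cphi sphi]; split.
  by move=> k; have [_ /(_ i) []] := Cphi k.+1.
apply: subset_trans sphi.
rewrite [X in X `<=` _]closureE; apply: smallest_sub; first exact: closed_closure.
move=> x /= dx; apply: contrapT => nx.
move/eqP: dx; apply; rewrite /partial.
have oS : open (~` closure [set y | phi y != 0]).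
  by apply: closed_openC; exact: closed_closure.
have /near_eq_derive -> : \forall y \near x, phi y = (cst 0 : X -> R) y.
  apply: filterS (open_nbhs_nbhs (conj oS nx)) => y ny.
  by apply/eqP/negP => /negP py; apply: ny; exact: subset_closure.
by rewrite derive_cst.
Qed.

Lemma test_bounded phi : test_function phi -> exists M, forall x, `|phi x| <= M.
Proof.
move=> tphi.
pose K := [set v : X | forall i, `[(0 : R), 1]%classic (v ord0 i)].
have cK : compact K.
  by apply: (@rV_compact _ _ (fun=> `[0 : R, 1]%classic)) => _; exact: segment_compact.
have K0 : K !=set0 by exists (const_mx 0) => i /=; rewrite mxE in_itv/= lexx ler01.
have cn : {within K, continuous (fun x => `|phi x|)}.
  apply: continuous_subspaceT => x.
  have h1 : {for x, continuous phi} := @test_continuous phi tphi x.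
  exact: (continuous_comp h1 (@norm_continuous _ R (phi x))).
have [c _ Hc] := EVT_max_rV K0 cK cn.
exists `|phi c| => x; have [xc|/test_eq0 ->//] := pselect (open_cube x).
  apply: Hc; rewrite inE => i /=; rewrite in_itv/=.
  by have /andP[h1 h2] := xc i; rewrite !ltW.
by rewrite normr0.
Qed.

Lemma test_Lfun2 phi : test_function phi -> phi \in Lfun mu 2%:E.
Proof.
by move=> tphi; have [M] := test_bounded tphi; apply: bounded_Lfun2; exact: test_measurable.
Qed.

End test_functions.

(** * Test functions along coordinate lines *)

Section sobolev_lines.
Context {R : realType}.
Local Notation nu := (@unit_interval_measure R).

Lemma ge0_integral_unit_interval (f : R -> \bar R) :
  measurable_fun setT f -> (forall x, (0 <= f x)%E) ->
  (\int[nu]_x f x = \int[lebesgue_measure]_(x in `]0%R, 1%R[) f x)%E.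
Proof.
move=> mf f0; have mI : measurable (`]0%R, 1%R[%classic : set R) by exact: measurable_itv.
rewrite (@ge0_negligible_integral _ _ _ nu setT (~` `]0%R, 1%R[%classic)) //=.
- rewrite setTD setCK; apply: eq_measure_integral => A mA AI.
  change (lebesgue_measure (A `&` `]0%R, 1%R[%classic) = lebesgue_measure A).
  by rewrite setIidl.
- exact: measurableC.
change (lebesgue_measure (~` `]0%R, 1%R[%classic `&` `]0%R, 1%R[%classic : set R) = 0%E).
by rewrite setICl measure0.
Qed.

Context {d : nat}.
Local Notation X := 'rV[R]_d.

Variables (phi : X -> R) (tphi : test_function phi) (i : 'I_d) (P : R -> X).
(* P runs along a line parallel to the i-th axis. *)
Hypothesis PD : forall t h : R, P (t + h) = P t + h *: delta_mx ord0 i.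

Lemma line_continuous : continuous P.
Proof.
have PE t : P t = P 0 + t *: delta_mx ord0 i by rewrite -PD add0r.
move=> t; rewrite (_ : P = fun t => P 0 + t *: delta_mx ord0 i); last by apply/funext => s; rewrite PE.
by apply: cvgD; [exact: cvg_cst|apply: cvgZr_tmp; exact: cvg_id].
Qed.

Lemma line_test_continuous (psi : X -> R) : test_function psi -> continuous (psi \o P).
Proof.
move=> tpsi t; have h1 : {for t, continuous P} := @line_continuous t.
have h2 : {for P t, continuous psi} := @test_continuous _ _ psi tpsi (P t).
exact: (continuous_comp h1 h2).
Qed.

Lemma line_is_derive (t : R) : is_derive t (1 : R) (phi \o P) (partial i phi (P t)).
Proof.
have E : (fun h : R => h^-1 *: (((phi \o P) \o shift t) (h *: (1 : R)) - (phi \o P) t)) =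
  (fun h : R => h^-1 *: ((phi \o shift (P t)) (h *: delta_mx ord0 i) - phi (P t))).
  apply/funext => h /=; congr (_ *: (phi _ - _)).
  by rewrite [h *: 1](mulr1) addrC PD addrC.
split; first by rewrite /derivable E; exact: (@test_derivable _ _ phi i (P t) tphi).
by rewrite /derive E.
Qed.

Hypothesis P0 : ~ open_cube (P 0).

(** The fundamental theorem of calculus for phi^3 along the line, which starts
    outside of the open cube, where phi vanishes. *)
Lemma line_cube_le (x : R) : 0 < x < 1 ->
  ((`|phi (P x)| ^+ 3)%:E <=
   \int[nu]_t (3 * phi (P t) ^+ 2 * `|partial i phi (P t)|)%:E)%E.
Proof.
move=> /andP[x0 x1].
pose F := (phi \o P) ^+ 3.
pose f := fun t => 3 * phi (P t) ^+ 2 * partial i phi (P t).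
have absf t : `|f t| = 3 * phi (P t) ^+ 2 * `|partial i phi (P t)|.
  by rewrite /f normrM (ger0_norm (_ : 0 <= 3 * _))// mulr_ge0 ?sqr_ge0.
have dF t : is_derive t (1 : R) F (f t).
  have := line_is_derive t => H.
  apply: is_derive_eq; rewrite /f /=.
  by rewrite /GRing.scale/=; ring.
have cf : continuous f.
  move=> t; have h1 := @line_test_continuous _ tphi t.
  have h2 := @line_test_continuous _ (test_partial i tphi) t.
  exact: (cvgM (cvgM (cvg_cst (3 : R)) (cvgM h1 h1)) h2).
have cF : continuous F.
  move=> t; apply: differentiable_continuous; apply/derivable1_diffP.
  exact: (@ex_derive _ _ _ _ _ _ _ (dF t)).
have FTC : (\int[lebesgue_measure]_(t in `[0%R, x]) (f t)%:E = (F x)%:E - (F 0%R)%:E)%E.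
  apply: continuous_FTC2 => //.
  - exact: continuous_subspaceT.
  - split.
    + by move=> t _; exact: (@ex_derive _ _ _ _ _ _ _ (dF t)).
    + by apply: cvg_at_right_filter; exact: cF.
    + by apply: cvg_at_left_filter; exact: cF.
  - by move=> t _; rewrite derive1E; exact: (@derive_val _ _ _ _ _ _ _ (dF t)).
have F0 : F 0 = 0 by rewrite /F fctE/= (test_eq0 tphi P0) expr0n.
have mf : measurable_fun setT f by exact: continuous_measurable_fun.
have -> : (`|phi (P x)| ^+ 3)%:E = (`|\int[lebesgue_measure]_(t in `[0%R, x]) (f t)%:E|)%E.
  by rewrite FTC F0 sube0 /= /F fctE normrX.
apply: (le_trans (le_abse_integral _ _ _)) => //.
  by apply/measurable_EFinP; exact: measurable_funTS.
rewrite ge0_integral_unit_interval; last 2 first.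
- apply/measurable_EFinP.
  rewrite (_ : (fun t => _) = fun t => `|f t|); first exact: measurableT_comp.
  by apply/funext => t; rewrite absf.
- by move=> t; rewrite lee_fin -absf.
rewrite [leRHS](_ : _ = \int[lebesgue_measure]_(t in `]0%R, 1%R[) `|(f t)%:E|)%E; last first.
  by apply: eq_integral => t _ /=; rewrite absf.
have -> : (\int[lebesgue_measure]_(t in `[0%R, x]) `|(f t)%:E| =
  \int[lebesgue_measure]_(t in `]0%R, x]) `|(f t)%:E|)%E.
  by rewrite integral_itv_obnd_cbnd//; apply/measurable_EFinP; apply: measurable_funTS; exact: measurableT_comp.
apply: ge0_subset_integral => //.
  by apply/measurable_EFinP; apply: measurable_funTS; exact: measurableT_comp.
by apply: subset_itvl; rewrite bnd_simp.
Qed.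

End sobolev_lines.

(** * A product inequality for sixth powers of test functions *)

Section sobolev_test.
Context {R : realType}.
Local Notation nu := (@unit_interval_measure R).
Local Notation mu d := (@cube_measure R d).

Lemma ge0_integral_cube0 (g : 'rV[R]_0 -> \bar R) :
  measurable_fun setT g -> (\int[mu 0]_x g x = g 0%R)%E.
Proof.
move=> mg.
change (\int[\d_(0%R : 'rV[R]_0)]_x g x = g 0%R)%E.
by rewrite integral_dirac// diracT mul1e.
Qed.

Lemma ge0_integral_cubeS d (g : 'rV[R]_d.+1 -> \bar R) :
  measurable_fun setT g -> (forall x, (0 <= g x)%E) ->
  (\int[mu d.+1]_x g x = \int[nu]_x \int[mu d]_y g (rV_cons (x, y)))%E.
Proof.
move=> mg g0.
change (\int[distribution (nu \x mu d)%E (@rV_cons R d)]_x g x =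
  \int[nu]_x \int[mu d]_y g (rV_cons (x, y)))%E.
rewrite ge0_integral_distribution// (fubini_tonelli1 (g \o @rV_cons R d))//=.
exact: measurableT_comp.
Qed.

Lemma ge0_integral_cubeS_swap d (g : 'rV[R]_d.+1 -> \bar R) :
  measurable_fun setT g -> (forall x, (0 <= g x)%E) ->
  (\int[mu d.+1]_x g x = \int[mu d]_y \int[nu]_x g (rV_cons (x, y)))%E.
Proof.
move=> mg g0.
change (\int[distribution (nu \x mu d)%E (@rV_cons R d)]_x g x =
  \int[mu d]_y \int[nu]_x g (rV_cons (x, y)))%E.
rewrite ge0_integral_distribution// (fubini_tonelli2 (g \o @rV_cons R d))//=.
exact: measurableT_comp.
Qed.

Lemma rV_consDl d (t h : R) (y : 'rV[R]_d) :
  rV_cons (t + h, y) = rV_cons (t, y) + h *: delta_mx ord0 ord0.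
Proof.
apply/rowP => j; rewrite /rV_cons !mxE /=.
case: splitP => k; rewrite ?mxE/=.
  by rewrite (ord1 k) => jk; rewrite (_ : j == 0) ?mulr1//; apply/eqP/val_inj.
by move=> jk; rewrite (_ : (j == 0) = false) ?mulr0 ?addr0//; apply/eqP => j0; move: jk; rewrite j0.
Qed.

Lemma rV_consDr d (a h : R) (y : 'rV[R]_d) (i : 'I_d) :
  rV_cons (a, y + h *: delta_mx ord0 i) =
  rV_cons (a, y) + h *: delta_mx ord0 (lift ord0 i).
Proof.
apply/rowP => j; rewrite /rV_cons !mxE /=.
case: splitP => k; rewrite ?mxE/=.
  move=> jk; rewrite (_ : (j == lift ord0 i) = false) ?mulr0 ?addr0//.
  by apply/eqP => j0; move: jk; rewrite j0 (ord1 k).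
move=> jk; congr (_ + _ * _%:R).
congr nat_of_bool; apply/eqP/eqP => [kE|jE].
  by apply/ord_inj; rewrite jk kE.
by apply/val_inj; move: jk; rewrite jE/= => -[].
Qed.

Lemma not_open_cubeE d (x : 'rV[R]_d) i : x ord0 i = 0 -> ~ open_cube x.
Proof. by move=> x0 /(_ i); rewrite x0 ltxx. Qed.

Lemma rV_cons_0 d (a : R) (y : 'rV[R]_d) : rV_cons (a, y) ord0 ord0 = a.
Proof.
by rewrite /rV_cons mxE; case: splitP => k; rewrite ?mxE//.
Qed.

Lemma rV_cons_lift d (a : R) (y : 'rV[R]_d) i :
  rV_cons (a, y) ord0 (lift ord0 i) = y ord0 i.
Proof.
rewrite /rV_cons mxE; case: splitP => k; first by rewrite (ord1 k).
by move=> [] /val_inj ->.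
Qed.

(** This is the absolute value of the i-th partial derivative of phi^3. *)
Definition sobolev_weight d (phi : 'rV[R]_d -> R) (i : 'I_d) (x : 'rV[R]_d) : R :=
  3 * phi x ^+ 2 * `|partial i phi x|.

Lemma sobolev_weight_ge0 d (phi : 'rV[R]_d -> R) i x : 0 <= sobolev_weight phi i x.
Proof. by rewrite /sobolev_weight mulr_ge0// mulr_ge0// sqr_ge0. Qed.

Lemma measurable_sobolev_weight d (phi : 'rV[R]_d -> R) i : test_function phi ->
  measurable_fun setT (sobolev_weight phi i).
Proof.
move=> tphi; apply: measurable_funM.
  by apply: measurable_funM => //; apply: measurable_funX; exact: test_measurable.
by apply: measurableT_comp => //; apply: test_measurable; exact: test_partial.
Qed.

Lemma ge0_le_integral_unit_interval (f g : R -> \bar R) :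
  measurable_fun setT f -> measurable_fun setT g ->
  (forall x, (0 <= f x)%E) -> (forall x, (0 <= g x)%E) ->
  (forall x, 0 < x < 1 -> (f x <= g x)%E) ->
  (\int[nu]_x f x <= \int[nu]_x g x)%E.
Proof.
move=> mf mg f0 g0 fg; rewrite !ge0_integral_unit_interval//.
by apply: ge0_le_integral => //; exact: measurable_funTS.
Qed.

Let pt1 (t : R) : 'rV[R]_1 := rV_cons (t, 0 : 'rV[R]_0).

Let pt2 (a b : R) : 'rV[R]_2 := rV_cons (a, pt1 b).

Let measurable_pt1 : measurable_fun setT (pt1 : measurableTypeR R -> 'rV[R]_1).
Proof.
apply: (measurableT_comp (@measurable_rV_cons R 0)); exact: pair2_measurable.
Qed.

Let measurable_pt2r a : measurable_fun setT (pt2 a : measurableTypeR R -> 'rV[R]_2).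
Proof.
apply: (measurableT_comp (@measurable_rV_cons R 1)).
exact: (measurableT_comp (pair1_measurable a) measurable_pt1).
Qed.

Let integral_cube1 (g : 'rV[R]_1 -> \bar R) :
  measurable_fun setT g -> (forall x, (0 <= g x)%E) ->
  (\int[mu 1]_x g x = \int[nu]_t g (pt1 t))%E.
Proof.
move=> mg g0; rewrite ge0_integral_cubeS//; apply: eq_integral => t _.
rewrite ge0_integral_cube0//.
apply: (measurableT_comp mg); apply: (measurableT_comp (@measurable_rV_cons R 0)).
exact: pair1_measurable.
Qed.

Let sixth_le (s : R) (a b : \bar R) :
  ((`|s| ^+ 3)%:E <= a)%E -> ((`|s| ^+ 3)%:E <= b)%E -> ((s ^+ 6)%:E <= a * b)%E.
Proof.
move=> sa sb.
have -> : s ^+ 6 = `|s| ^+ 3 * `|s| ^+ 3.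
  by rewrite -exprD -[6%N]/(2 * 3)%N exprM -(real_normK (num_real s)) -exprM.
by rewrite EFinM lee_pmul// lee_fin exprn_ge0.
Qed.

(** The planar case of the Loomis-Whitney inequality: Tonelli's theorem splits the
    integral of a product of functions of the separate variables. *)
Lemma loomis_whitney (A0 A1 : R -> \bar R) (f : R -> R -> \bar R) :
  measurable_fun setT (A0 : measurableTypeR R -> \bar R) ->
  measurable_fun setT (A1 : measurableTypeR R -> \bar R) ->
  (forall b, (0 <= A0 b)%E) -> (forall a, (0 <= A1 a)%E) ->
  (forall a, measurable_fun setT (f a : measurableTypeR R -> \bar R)) ->
  measurable_fun setT ((fun a => \int[nu]_b f a b)%E : measurableTypeR R -> \bar R) ->
  (forall a b, (0 <= f a b)%E) ->
  (forall a b, 0 < a < 1 -> 0 < b < 1 -> (f a b <= A0 b * A1 a)%E) ->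
  (\int[nu]_a \int[nu]_b f a b <= (\int[nu]_b A0 b) * \int[nu]_a A1 a)%E.
Proof.
move=> mA0 mA1 A00 A10 mf mF f0 fA.
have J00 : (0 <= \int[nu]_b A0 b)%E by apply: integral_ge0.
rewrite -(ge0_integralZl nu measurableT mA1 (fun x _ => A10 x) J00).
apply: ge0_le_integral_unit_interval => //.
- by apply: emeasurable_funM; [exact: measurable_cst|exact: mA1].
- by move=> a; apply: integral_ge0.
- by move=> a; rewrite mule_ge0.
move=> a a01.
rewrite -(ge0_integralZr nu measurableT mA0 (fun x _ => A00 x) (A10 a)).
apply: ge0_le_integral_unit_interval => //.
- exact: mf.
- by apply: emeasurable_funM; [exact: mA0|exact: measurable_cst].
- by move=> b; rewrite mule_ge0.
by move=> b b01; exact: fA.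
Qed.

(** In dimension one, [line_cube_le] along the only line is used for both factors
    of phi^6 = |phi|^3 |phi|^3. *)
Lemma sobolev_product1 (phi : 'rV[R]_1 -> R) : test_function phi ->
  (\int[mu 1]_x (phi x ^+ 6)%:E <=
   (\int[mu 1]_x (sobolev_weight phi ord0 x)%:E) * \int[mu 1]_x (sobolev_weight phi ord0 x)%:E)%E.
Proof.
move=> tphi.
have mphi := test_measurable tphi.
have mw := measurable_sobolev_weight ord0 tphi.
have w0 x : (0 <= (sobolev_weight phi ord0 x)%:E)%E by rewrite lee_fin sobolev_weight_ge0.
have m6 : measurable_fun setT (fun x => (phi x ^+ 6)%:E).
  by apply/measurable_EFinP; exact: measurable_funX.
rewrite !integral_cube1//; last 2 first.
- exact/measurable_EFinP.
- by move=> x; rewrite lee_fin exprn_even_ge0.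
set I := (\int[nu]_t (sobolev_weight _ _ _)%:E)%E.
have I0 : (0 <= I)%E by apply: integral_ge0.
rewrite -[leRHS]mule1 -(probability_setT nu) -integral_cst//.
apply: ge0_le_integral_unit_interval => //.
- exact: (measurableT_comp m6 measurable_pt1).
- by move=> x; rewrite lee_fin exprn_even_ge0.
- by move=> x /=; rewrite mule_ge0.
move=> t t01.
have H : ((`|phi (pt1 t)| ^+ 3)%:E <= I)%E.
  apply: (line_cube_le tphi _ _ t01).
  - by move=> s h; rewrite /pt1 rV_consDl.
  - by apply: (@not_open_cubeE _ _ ord0); rewrite rV_cons_0.
exact: sixth_le.
Qed.

(** By [line_cube_le], |phi (a, b)|^3 is bounded by a function A0 of b alone along
    the first axis and by a function A1 of a alone along the second one; phi^6 is
    at most the product of the two. *)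
Lemma sobolev_product2 (phi : 'rV[R]_2 -> R) : test_function phi ->
  (\int[mu 2]_x (phi x ^+ 6)%:E <=
   (\int[mu 2]_x (sobolev_weight phi ord0 x)%:E) *
    \int[mu 2]_x (sobolev_weight phi (lift ord0 ord0) x)%:E)%E.
Proof.
move=> tphi.
have mphi := test_measurable tphi.
have mw i := measurable_sobolev_weight i tphi.
have w0 i x : (0 <= (sobolev_weight phi i x)%:E)%E by rewrite lee_fin sobolev_weight_ge0.
have m6 : measurable_fun setT (fun x => (phi x ^+ 6)%:E).
  by apply/measurable_EFinP; exact: measurable_funX.
have p6 x : (0 <= (phi x ^+ 6)%:E)%E by rewrite lee_fin exprn_even_ge0.
have mrc (g : 'rV[R]_2 -> \bar R) : measurable_fun setT g ->
   measurable_fun setT (g \o @rV_cons R 1).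
  by move=> mg; apply: measurableT_comp => //; exact: measurable_rV_cons.
have mwE i : measurable_fun setT (fun x => (sobolev_weight phi i x)%:E).
  exact/measurable_EFinP.
pose A0 b : \bar R := (\int[nu]_t (sobolev_weight phi ord0 (pt2 t b))%:E)%E.
pose A1 a : \bar R := (\int[nu]_t (sobolev_weight phi (lift ord0 ord0) (pt2 a t))%:E)%E.
have A00 b : (0 <= A0 b)%E by apply: integral_ge0.
have A10 b : (0 <= A1 b)%E by apply: integral_ge0.
have inner1 (g : 'rV[R]_2 -> \bar R) a : measurable_fun setT g -> (forall x, (0 <= g x)%E) ->
   (\int[mu 1]_y g (rV_cons (a, y)) = \int[nu]_b g (pt2 a b))%E.
  move=> mg g0; rewrite integral_cube1//.
  apply: (measurableT_comp mg); apply: (measurableT_comp (@measurable_rV_cons R 1)).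
  exact: pair1_measurable.
have mA1 : measurable_fun setT (A1 : measurableTypeR R -> \bar R).
  rewrite (_ : A1 = fubini_F (mu 1) ((fun x => (sobolev_weight phi (lift ord0 ord0) x)%:E) \o @rV_cons R 1)).
    by apply: measurable_fun_fubini_tonelli_F => //=; exact: (mrc _ (mwE _)).
  by apply/funext => a; exact/esym/(inner1 (fun x => (sobolev_weight phi (lift ord0 ord0) x)%:E) a (mwE _) (w0 _)).
have mG : measurable_fun setT (fubini_G nu ((fun x => (sobolev_weight phi ord0 x)%:E) \o @rV_cons R 1)).
  by apply: measurable_fun_fubini_tonelli_G => //=; exact: (mrc _ (mwE _)).
have mA0 : measurable_fun setT (A0 : measurableTypeR R -> \bar R).
  exact: (measurableT_comp mG measurable_pt1).
have IA1 : (\int[mu 2]_x (sobolev_weight phi (lift ord0 ord0) x)%:E = \int[nu]_a A1 a)%E.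
  rewrite ge0_integral_cubeS//; apply: eq_integral => a _.
  exact: (inner1 (fun x => (sobolev_weight phi (lift ord0 ord0) x)%:E) a (mwE _) (w0 _)).
have IA0 : (\int[mu 2]_x (sobolev_weight phi ord0 x)%:E = \int[nu]_a A0 a)%E.
  rewrite (ge0_integral_cubeS_swap (mwE ord0) (w0 ord0)).
  apply: (integral_cube1 mG) => y.
  by apply: integral_ge0 => x _; exact: w0.
pose K a : \bar R := (\int[nu]_b (phi (pt2 a b) ^+ 6)%:E)%E.
have KE a : (\int[mu 1]_y (phi (rV_cons (a, y)) ^+ 6)%:E = K a)%E.
  exact: (inner1 (fun x => (phi x ^+ 6)%:E) a m6 p6).
have mK : measurable_fun setT (K : measurableTypeR R -> \bar R).
  rewrite (_ : K = fubini_F (mu 1) ((fun x => (phi x ^+ 6)%:E) \o @rV_cons R 1)).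
    by apply: measurable_fun_fubini_tonelli_F => //=; exact: mrc.
  by apply/funext => a; exact/esym/KE.
have L : (\int[mu 2]_x (phi x ^+ 6)%:E = \int[nu]_a K a)%E.
  rewrite (ge0_integral_cubeS m6 p6).
  by apply: eq_integral => a _; exact: KE.
have subst3 (a b c a' b' c' : \bar R) : a = a' -> b = b' -> c = c' ->
  (a' <= b' * c')%E -> (a <= b * c)%E by move=> -> -> ->.
refine (subst3 _ _ _ _ _ _ L IA0 IA1 _).
have mf a : measurable_fun setT ((fun b => (phi (pt2 a b) ^+ 6)%:E) : measurableTypeR R -> \bar R).
  exact: (measurableT_comp m6 (measurable_pt2r a)).
refine (@loomis_whitney A0 A1 (fun a b => (phi (pt2 a b) ^+ 6)%:E)
  mA0 mA1 A00 A10 mf mK (fun a b => p6 (pt2 a b)) _).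
move=> a b a01 b01; apply: sixth_le.
- apply: (line_cube_le tphi (P := fun t => pt2 t b) _ _ a01).
  + by move=> s h; rewrite /pt2 rV_consDl.
  + by apply: (@not_open_cubeE _ _ ord0); rewrite rV_cons_0.
- apply: (line_cube_le tphi (P := fun t => pt2 a t) _ _ b01).
  + by move=> s h; rewrite /pt2 /pt1 rV_consDl rV_consDr.
  + by apply: (@not_open_cubeE _ _ (lift ord0 ord0)); rewrite rV_cons_lift rV_cons_0.
Qed.

End sobolev_test.

(** * The Sobolev inequality on H^1_0 *)

Lemma cvg_fin_sum {R : realType} (I : Type) (r : seq I) (F : I -> nat -> R) (l : I -> R) :
  (forall i, F i n @[n --> \oo] --> l i) ->
  \sum_(i <- r) F i n @[n --> \oo] --> \sum_(i <- r) l i.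
Proof.
move=> cF; elim: r => [|i r IH].
  by under eq_fun do rewrite big_nil; rewrite big_nil; exact: cvg_cst.
by under eq_fun do rewrite big_cons; rewrite big_cons; apply: cvgD.
Qed.

Section sobolev_H10.
Context {R : realType} {d : nat}.
Local Notation X := 'rV[R]_d.
Local Notation mu := (@cube_measure R d).
Implicit Types (u f : X -> R).

Lemma EFin_inner f g : f \in Lfun mu 2%:E -> g \in Lfun mu 2%:E ->
  (\int[mu]_x (f x * g x)%:E = (inner f g)%:E)%E.
Proof.
move=> lf lg; rewrite /inner /Rintegral fineK//.
by apply: integrable_fin_num => //; exact: inner_integrable.
Qed.

Lemma test_powers phi n : test_function phi -> (fun x => phi x ^+ n) \in Lfun mu 2%:E.
Proof.
move=> tphi; have [M HM] := test_bounded tphi.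
apply: (@bounded_Lfun2 _ _ _ (M ^+ n)); first by apply: measurable_funX; exact: test_measurable.
by move=> x; rewrite normrX lerXn2r ?nnegrE// (le_trans _ (HM x)).
Qed.

Lemma Lfun2_norm f : f \in Lfun mu 2%:E -> (fun x => `|f x|) \in Lfun mu 2%:E.
Proof.
move=> /Lfun2P[mf intf]; apply/Lfun2P; split; first exact: measurableT_comp.
rewrite (_ : EFin \o _ = EFin \o (fun x => f x ^+ 2))//.
by apply/funext => x /=; rewrite real_normK ?num_real.
Qed.

Lemma inner_norm_norm f : inner (fun x => `|f x|) (fun x => `|f x|) = inner f f.
Proof.
by apply: eq_Rintegral => x _; rewrite -!expr2 real_normK ?num_real.
Qed.

Hypothesis hd : d = 1%N \/ d = 2%N.

(** Write A and B for the square norms of phi and of its gradient, I4 and I6 for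
    the integrals of phi^4 and phi^6.  The product inequality and Cauchy-Schwarz
    give I6 <= 9 I4 B, and I4^2 <= A I6 by Cauchy-Schwarz again; so
    I6^2 <= 81 B^2 I4^2 <= 81 A B^2 I6. *)
Lemma sobolev_test phi : test_function phi ->
  (\int[mu]_x (phi x ^+ 6)%:E <=
   (81 * inner phi phi * (\sum_i inner (partial i phi) (partial i phi)) ^+ 2)%:E)%E.
Proof.
move=> tphi.
set A := inner phi phi; set B := \sum_i _.
have l1 := test_Lfun2 tphi.
have l2 := test_powers 2 tphi.
have l3 := test_powers 3 tphi.
have ld i : (fun x => `|partial i phi x|) \in Lfun mu 2%:E.
  by apply: Lfun2_norm; apply: test_Lfun2; exact: test_partial.
have A0 : 0 <= A by exact: inner_ge0.
have B0 : 0 <= B by apply: sumr_ge0 => i _; exact: inner_ge0.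
pose I4 := inner (fun x => phi x ^+ 2) (fun x => phi x ^+ 2).
pose I6 := inner (fun x => phi x ^+ 3) (fun x => phi x ^+ 3).
have I40 : 0 <= I4 by exact: inner_ge0.
have I60 : 0 <= I6 by exact: inner_ge0.
have wE i : (\int[mu]_x (sobolev_weight phi i x)%:E <=
    (3 * (Num.sqrt I4 * Num.sqrt B))%:E)%E.
  rewrite (_ : (fun x => _) = (fun x => ((3 * phi x ^+ 2) * `|partial i phi x|)%:E))//.
  rewrite (EFin_inner (Lfun2Z 3 l2) (ld i)) lee_fin innerZl// ler_pM2l//.
  apply: le_trans (ler_norm _) _; apply: le_trans (inner_CS_sqrt l2 (ld i)) _.
  rewrite ler_wpM2l ?sqrtr_ge0// ler_sqrt// inner_norm_norm.
  rewrite /B (bigD1 i)//= lerDl sumr_ge0// => j _; exact: inner_ge0.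
have I6E : (\int[mu]_x (phi x ^+ 6)%:E = I6%:E)%E.
  by rewrite -EFin_inner//; apply: eq_integral => x _; rewrite -exprD.
have w0 i : (0 <= \int[mu]_x (sobolev_weight phi i x)%:E)%E.
  by apply: integral_ge0 => x _; rewrite lee_fin sobolev_weight_ge0.
have H : I6 <= 9 * I4 * B.
  have -> : 9 * I4 * B = (3 * (Num.sqrt I4 * Num.sqrt B)) * (3 * (Num.sqrt I4 * Num.sqrt B)).
    rewrite -[in LHS](sqr_sqrtr I40) -[in LHS](sqr_sqrtr B0); ring.
  rewrite -lee_fin -I6E EFinM.
  have [i [j Hij]] : exists i j, (\int[mu]_x (phi x ^+ 6)%:E <=
     (\int[mu]_x (sobolev_weight phi i x)%:E) * \int[mu]_x (sobolev_weight phi j x)%:E)%E.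
    move: (phi) tphi => {wE w0 I6E I40 I60 I4 I6 l1 l2 l3 ld A0 B0 A B}.
    by case: hd => -> p tp; do 2 eexists; [exact: sobolev_product1|exact: sobolev_product2].
  by apply: (le_trans Hij); rewrite lee_pmul.
have CS : I4 ^+ 2 <= A * I6.
  have := inner_CS l1 l3; rewrite (_ : inner phi _ = I4)//.
  by apply: eq_Rintegral => x _; ring.
rewrite I6E lee_fin.
have [I6p|] := ltP 0 I6; last first.
  by move=> /le_trans -> //; rewrite !mulr_ge0// exprn_ge0.
rewrite -(ler_pM2r I6p).
have := ler_pM I60 I60 H H => /le_trans -> //.
have -> : 9 * I4 * B * (9 * I4 * B) = 81 * B ^+ 2 * I4 ^+ 2 by ring.
have -> : 81 * A * B ^+ 2 * I6 = 81 * B ^+ 2 * (A * I6) by ring.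
by rewrite ler_wpM2l// mulr_ge0// sqr_ge0.
Qed.

Lemma norm2_cvg0 (f : nat -> X -> R) g : (forall n, f n \in Lfun mu 2%:E) ->
  g \in Lfun mu 2%:E -> norm2 (f n \- g) @[n --> \oo] --> 0%E ->
  Num.sqrt (inner (f n \- g) (f n \- g)) @[n --> \oo] --> (0 : R).
Proof.
move=> lf lg; under eq_fun do rewrite norm2E ?Lfun2B//.
by move/fine_cvg.
Qed.

Lemma norm2_cvg_inner (f : nat -> X -> R) g h : (forall n, f n \in Lfun mu 2%:E) ->
  g \in Lfun mu 2%:E -> h \in Lfun mu 2%:E ->
  norm2 (f n \- g) @[n --> \oo] --> 0%E ->
  inner (f n) h @[n --> \oo] --> inner g h.
Proof.
move=> lf lg lh /(norm2_cvg0 lf lg) c0.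
apply/subr_cvg0.
apply: norm_cvg0.
have c1 : Num.sqrt (inner (f n \- g) (f n \- g)) * Num.sqrt (inner h h) @[n --> \oo] --> (0 : R).
  rewrite [X in _ --> X](_ : _ = 0 * Num.sqrt (inner h h)); last by rewrite mul0r.
  exact: cvgMr_tmp.
apply: (squeeze_cvgr _ (cvg_cst 0) c1); apply: nearW => n.
by rewrite normr_ge0/= -innerBl// inner_CS_sqrt// Lfun2B.
Qed.

Lemma norm2_cvg_inner2 (f : nat -> X -> R) g : (forall n, f n \in Lfun mu 2%:E) ->
  g \in Lfun mu 2%:E -> norm2 (f n \- g) @[n --> \oo] --> 0%E ->
  inner (f n) (f n) @[n --> \oo] --> inner g g.
Proof.
move=> lf lg c0.
have c1 := norm2_cvg_inner lf lg lg c0.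
have c2 := norm2_cvg0 lf lg c0.
rewrite (_ : (fun n => inner (f n) (f n)) = (fun n => Num.sqrt (inner (f n \- g) (f n \- g)) *
   Num.sqrt (inner (f n \- g) (f n \- g)) + 2 * inner (f n) g - inner g g)).
  rewrite [X in _ --> X](_ : _ = 0 * 0 + 2 * inner g g - inner g g); last by ring.
  apply: cvgB; last exact: cvg_cst.
  by apply: cvgD; [exact: (cvgM c2 c2)|apply: cvgMl_tmp].
apply/funext => n; rewrite -expr2 sqr_sqrtr ?inner_ge0//.
have lB := Lfun2B (lf n) lg.
rewrite (innerBl (lf n) lg lB) (innerC (f n)) (innerC g) !innerBl//.
by rewrite (innerC g (f n)); ring.
Qed.

(** Truncation turns the sixth power into a Lipschitz function, of constant 6 k^5,
    along which L^2 limits can be taken. *)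
Let trunc (k : nat) (s : R) : R := Num.min `|s| k%:R.

Let trunc_lip k s t : trunc k s ^+ 6 <= t ^+ 6 + 6 * k%:R ^+ 5 * `|s - t|.
Proof.
have k0 : (0 : R) <= k%:R by [].
have x0 : 0 <= trunc k s by rewrite /trunc le_min normr_ge0.
have xk : trunc k s <= k%:R by rewrite /trunc ge_min lexx orbT.
have xs : trunc k s <= `|s| by rewrite /trunc ge_min lexx.
have -> : t ^+ 6 = `|t| ^+ 6 by rewrite -[6%N]/(2 * 3)%N !exprM real_normK ?num_real.
have [xt|tx] := leP (trunc k s) `|t|.
  apply: (@le_trans _ _ (`|t| ^+ 6)); first by rewrite lerXn2r ?nnegrE.
  by rewrite lerDl !mulr_ge0// exprn_ge0.
rewrite -lerBlDl.
set x := trunc k s in x0 xk xs tx *; set y := `|t| in tx *.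
have y0 : 0 <= y by exact: normr_ge0.
have yk : y <= k%:R by apply: le_trans xk; exact: ltW.
have -> : x ^+ 6 - y ^+ 6 = (x ^+ 5 + x ^+ 4 * y + x ^+ 3 * y ^+ 2 + x ^+ 2 * y ^+ 3 + x * y ^+ 4 + y ^+ 5) * (x - y) by ring.
apply: ler_pM.
- by rewrite !addr_ge0// ?mulr_ge0 ?exprn_ge0.
- by rewrite subr_ge0 ltW.
- have P a b : x ^+ a * y ^+ b <= k%:R ^+ (a + b)%N.
    by rewrite exprD ler_pM ?exprn_ge0// lerXn2r ?nnegrE.
  have := P 5%N 0%N; have := P 4%N 1%N; have := P 3%N 2%N; have := P 2%N 3%N;
  have := P 1%N 4%N; have := P 0%N 5%N.
  rewrite !addn0 !add0n !expr0 !expr1 !mulr1 !mul1r.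
  rewrite -[(1 + 4)%N]/5%N -[(2 + 3)%N]/5%N -[(3 + 2)%N]/5%N -[(4 + 1)%N]/5%N.
  move: (k%:R ^+ 5) (x ^+ 5) (x ^+ 4 * y) (x ^+ 3 * y ^+ 2) (x ^+ 2 * y ^+ 3) (x * y ^+ 4) (y ^+ 5).
  by move=> *; lra.
- apply: (@le_trans _ _ (`|s| - `|t|)); first by rewrite lerD2r.
  exact: lerB_dist.
Qed.

(** The inequality for the approximating test functions passes to the limit in the
    truncated sixth powers; the truncation is then removed by monotone
    convergence. *)
Lemma sobolev_H10 u g : H10_gradient u g ->
  (\int[mu]_x (u x ^+ 6)%:E <=
   (81 * inner u u * (\sum_i inner (g i) (g i)) ^+ 2)%:E)%E.
Proof.
move=> [lu lg [phi [tphi cphi cdphi]]].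
have mu' := Lfun2_measurable lu.
have lphi n := test_Lfun2 (tphi n).
set C := 81 * _ * _.
have mtr k : measurable_fun setT (fun x => trunc k (u x)).
  by apply: measurable_minr => //; exact: measurableT_comp.
have tr0 k x : 0 <= trunc k (u x) by rewrite /trunc le_min normr_ge0/=.
have step k : (\int[mu]_x (trunc k (u x) ^+ 6)%:E <= C%:E)%E.
  have ltr : (fun x => trunc k (u x) ^+ 3) \in Lfun mu 2%:E.
    apply: (@bounded_Lfun2 _ _ _ (k%:R ^+ 3)); first exact: measurable_funX.
    by move=> x; rewrite normrX lerXn2r ?nnegrE// ger0_norm// /trunc ge_min lexx orbT.
  have IE : (\int[mu]_x (trunc k (u x) ^+ 6)%:E =
     (inner (fun x => trunc k (u x) ^+ 3) (fun x => trunc k (u x) ^+ 3))%:E)%E.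
    by rewrite -EFin_inner//; apply: eq_integral => x _; rewrite -exprD.
  pose D n := Num.sqrt (inner (phi n \- u) (phi n \- u)) * Num.sqrt (inner (fun _ : X => 1) (fun _ : X => 1)).
  pose bound n := 81 * inner (phi n) (phi n) * (\sum_i inner (partial i (phi n)) (partial i (phi n))) ^+ 2
     + 6 * k%:R ^+ 5 * D n.
  have cb : bound n @[n --> \oo] --> C.
    rewrite [X in _ --> X](_ : _ = C + 6 * k%:R ^+ 5 *
      (0 * Num.sqrt (inner (fun _ : X => 1) (fun _ : X => 1)))); last by rewrite mul0r mulr0 addr0.
    apply: cvgD; last first.
      by apply: cvgMl_tmp; apply: cvgMr_tmp; exact: norm2_cvg0.
    have cS : \sum_i inner (partial i (phi n)) (partial i (phi n)) @[n --> \oo] --> \sum_i inner (g i) (g i).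
      apply: cvg_fin_sum => i; apply: norm2_cvg_inner2 => //.
      by move=> n; apply: test_Lfun2; exact: test_partial.
    apply: cvgM; last by rewrite expr2; apply: cvgM.
    by apply: cvgMl_tmp; exact: norm2_cvg_inner2.
  rewrite IE lee_fin.
  apply: (@ler_cvg_to _ _ _ _ (fun=> _) bound _ _ (cvg_cst _) cb).
  apply: nearW => n; rewrite -lee_fin -IE /bound.
  have ldiff : (fun x => `|u x - phi n x|) \in Lfun mu 2%:E by apply: Lfun2_norm; exact: Lfun2B.
  have mphi := test_measurable (tphi n).
  apply: (@le_trans _ _ (\int[mu]_x ((phi n x ^+ 6)%:E + (6 * k%:R ^+ 5 * `|u x - phi n x|)%:E))%E).
    apply: ge0_le_integral => //.
    - by move=> x _; rewrite lee_fin exprn_ge0.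
    - by apply/measurable_EFinP; exact: measurable_funX.
    - apply: emeasurable_funD; apply/measurable_EFinP; first exact: measurable_funX.
      by apply: measurable_funM => //; exact: Lfun2_measurable ldiff.
    - by move=> x _; rewrite -EFinD lee_fin trunc_lip.
  have m6 : measurable_fun setT (fun x => (phi n x ^+ 6)%:E).
    by apply/measurable_EFinP; exact: measurable_funX.
  have md : measurable_fun setT (fun x => (6 * k%:R ^+ 5 * `|u x - phi n x|)%:E).
    by apply/measurable_EFinP; apply: measurable_funM => //; exact: Lfun2_measurable ldiff.
  have p6 x : (0 <= (phi n x ^+ 6)%:E)%E by rewrite lee_fin exprn_even_ge0.
  have pd x : (0 <= (6 * k%:R ^+ 5 * `|u x - phi n x|)%:E)%E.
    by rewrite lee_fin mulr_ge0// mulr_ge0// exprn_ge0.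
  rewrite (ge0_integralD mu measurableT (fun x _ => p6 x) m6 (fun x _ => pd x) md).
  rewrite EFinD leeD ?sobolev_test//.
  have -> : (\int[mu]_x (6 * k%:R ^+ 5 * `|u x - phi n x|)%:E =
     (6 * k%:R ^+ 5 * inner (fun x => `|u x - phi n x|) (fun=> 1))%:E)%E.
    rewrite -innerZl// ?Lfun2_cst// -EFin_inner ?Lfun2_cst//; last exact: Lfun2Z.
    by apply: eq_integral => x _; rewrite mulr1.
  rewrite lee_fin ler_wpM2l ?mulr_ge0 ?exprn_ge0//.
  apply: le_trans (ler_norm _) _; apply: le_trans (inner_CS_sqrt ldiff (Lfun2_cst _)) _.
  rewrite inner_norm_norm ler_wpM2r ?sqrtr_ge0// le_eqVlt; apply/orP; left; apply/eqP; congr Num.sqrt.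
  by apply: eq_Rintegral => x _ /=; ring.
have mono : (\int[mu]_x (trunc k (u x) ^+ 6)%:E)%E @[k --> \oo] --> (\int[mu]_x (u x ^+ 6)%:E)%E.
  have -> : (\int[mu]_x (u x ^+ 6)%:E = \int[mu]_x limn (fun k => (trunc k (u x) ^+ 6)%:E))%E.
    apply: eq_integral => y _; apply/esym/cvg_lim => //.
    apply: cvg_near_cst; near=> k.
    have uk : `|u y| <= k%:R by near: k; exact: nbhs_infty_ger.
    by rewrite /trunc min_l// -[6%N]/(2 * 3)%N !exprM real_normK ?num_real.
  apply: cvg_monotone_convergence => //.
  - by move=> k; apply/measurable_EFinP; exact: measurable_funX.
  - by move=> k y _; rewrite lee_fin exprn_ge0.
  - move=> y _ k l kl; rewrite lee_fin lerXn2r ?nnegrE// /trunc.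
    by rewrite le_min !ge_min lexx/= ler_nat kl orbT.
by apply: (cvge_to_le mono); apply: nearW => k; exact: step.
Unshelve. all: by end_near. Qed.

End sobolev_H10.

(** * The L^6 norm *)

Section L6.
Context {R : realType} {d : nat}.
Local Notation X := 'rV[R]_d.
Local Notation mu := (@cube_measure R d).
Implicit Types (u f g h : X -> R).

(** The cube of the right-hand side contains the term
    3 (eps B)^2 (27 / eps^2 A) = 81 A B^2. *)
Lemma ler_AMGM_cube (s A B eps : R) : 0 <= s -> 0 <= A -> 0 <= B -> 0 < eps ->
  s ^+ 3 <= 81 * A * B ^+ 2 -> s <= eps * B + 27 / eps ^+ 2 * A.
Proof.
move=> s0 A0 B0 e0 H.
have e1 : 0 <= eps * B by rewrite mulr_ge0// ltW.
have e2 : 0 <= 27 / eps ^+ 2 * A.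
  by rewrite mulr_ge0// divr_ge0// exprn_ge0// ltW.
rewrite -(@ler_pXn2r _ 3)// ?nnegrE ?addr_ge0//; apply: (le_trans H).
have -> : 81 * A * B ^+ 2 = 3 * (eps * B) ^+ 2 * (27 / eps ^+ 2 * A).
  by field; rewrite gt_eqF.
move: (eps * B) (27 / eps ^+ 2 * A) e1 e2 => x y x0 y0.
have -> : (x + y) ^+ 3 = 3 * x ^+ 2 * y + (x ^+ 3 + 3 * x * y ^+ 2 + y ^+ 3) by ring.
by rewrite lerDl !addr_ge0 ?mulr_ge0 ?exprn_ge0.
Qed.

Lemma norm6_sqr_le u (A B eps : R) : 0 <= A -> 0 <= B -> 0 < eps ->
  (\int[mu]_x (u x ^+ 6)%:E <= (81 * A * B ^+ 2)%:E)%E ->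
  (norm6 u ^+ 2 <= (eps * B + 27 / eps ^+ 2 * A)%:E)%E.
Proof.
move=> A0 B0 e0 H.
have I0 : (0 <= \int[mu]_x (u x ^+ 6)%:E)%E.
  by apply: integral_ge0 => x _; rewrite lee_fin exprn_even_ge0.
rewrite /norm6 unlock.
have -> : (\int[mu]_x (`|(EFin \o u) x| `^ 6) = \int[mu]_x (u x ^+ 6)%:E)%E.
  apply: eq_integral => x _ /=; congr EFin.
  rewrite -[6%N]/(2 * 3)%N exprM -(real_normK (num_real (u x))) -exprM.
  by rewrite -powR_mulrn.
move: I0 H; case: (\int[mu]_x _)%E => [r| |]//=; rewrite ?lee_fin// => r0 H.
rewrite -expr2; apply: ler_AMGM_cube => //; first exact: sqr_ge0.
rewrite -exprM -powR_mulrn ?powR_ge0// -powRrM.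
by rewrite mulVf// powRr1.
Qed.

(** By the inequality of arithmetic and geometric means, the square of the product
    is dominated by f^6 + g^6 + h^6. *)
Lemma L6_mul_Lfun2 f g h :
  measurable_fun setT f -> measurable_fun setT g -> measurable_fun setT h ->
  (\int[mu]_x (f x ^+ 6)%:E < +oo)%E -> (\int[mu]_x (g x ^+ 6)%:E < +oo)%E ->
  (\int[mu]_x (h x ^+ 6)%:E < +oo)%E ->
  (fun x => f x * g x * h x) \in Lfun mu 2%:E.
Proof.
have int6 (w : X -> R) : measurable_fun setT w -> (\int[mu]_x (w x ^+ 6)%:E < +oo)%E ->
    mu.-integrable setT (EFin \o (fun x => w x ^+ 6)).
  move=> mw fw; apply/integrableP; split.
    by apply/measurable_EFinP; exact: measurable_funX.
  apply: le_lt_trans fw; rewrite le_eqVlt; apply/orP; left; apply/eqP.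
  by apply: eq_integral => x _ /=; rewrite ger0_norm// exprn_even_ge0.
move=> mf mg mh ff fg fh; apply/Lfun2P; split.
  by apply: measurable_funM => //; exact: measurable_funM.
have I := integrableD measurableT (integrableD measurableT (int6 f mf ff) (int6 g mg fg)) (int6 h mh fh).
apply: (le_integrable _ _ _ I) => //.
  by apply/measurable_EFinP; apply: measurable_funX; apply: measurable_funM => //; exact: measurable_funM.
move=> x _ /=; rewrite lee_fin.
rewrite !ger0_norm ?sqr_ge0//; last by rewrite !addr_ge0 ?exprn_even_ge0.
rewrite !exprMn -[6%N]/(2 * 3)%N !exprM.
have := sqr_ge0 (f x); have := sqr_ge0 (g x); have := sqr_ge0 (h x).
move: (f x ^+ 2) (g x ^+ 2) (h x ^+ 2) => a b c c0 b0 a0.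
have K : 0 <= (a + b + c) * ((a - b) ^+ 2 + (b - c) ^+ 2 + (a - c) ^+ 2).
  by rewrite mulr_ge0 ?addr_ge0 ?sqr_ge0.
have K3 : 0 <= a ^+ 3 + b ^+ 3 + c ^+ 3 by rewrite !addr_ge0 ?exprn_ge0.
have : a ^+ 3 + b ^+ 3 + c ^+ 3 - 3 * (a * b * c) = 
  (a + b + c) * ((a - b) ^+ 2 + (b - c) ^+ 2 + (a - c) ^+ 2) / 2 by field.
have : 0 <= a * b * c by rewrite !mulr_ge0.
move: K K3; set z := (_ * (_ + _)); set y := _ + _ + _; set w := a * b * c.
by move=> *; lra.
Qed.

End L6.

(** * Weak gradients and the Dirichlet Laplacian *)

Section H10.
Context {R : realType} {d : nat}.
Local Notation X := 'rV[R]_d.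
Local Notation mu := (@cube_measure R d).

Let continuous_lin (a : R) (f g : X -> R) : continuous f -> continuous g ->
  continuous (fun x => a * f x + g x).
Proof.
move=> cf cg x.
have h1 : f y @[y --> x] --> f x by apply: cf.
have h2 : g y @[y --> x] --> g x by apply: cg.
have h3 : a * f y @[y --> x] --> a * f x by exact: (cvgMl_tmp h1).
exact: (cvgD h3 h2).
Qed.

Lemma is_Ck_lin k (a : R) (f g : X -> R) : is_Ck k f -> is_Ck k g ->
  is_Ck k (fun x => a * f x + g x).
Proof.
elim: k f g => [|k IH] f g /= [cf Hf] [cg Hg].
  by split; [exact: (@continuous_lin a f g cf cg)|].
split; first exact: (@continuous_lin a f g cf cg).
move=> i; have [df Cf] := Hf i; have [dg Cg] := Hg i.
have daf x : derivable (a *: f) x (delta_mx ord0 i) by exact: derivableZ.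
split; first by move=> x; exact: (derivableD (daf x) (dg x)).
rewrite (_ : partial i _ = fun x => a * partial i f x + partial i g x); first exact: IH.
apply/funext => x; rewrite /partial.
rewrite -[a * _]/(a *: 'D_(delta_mx ord0 i) f x) -(deriveZ _ (df x)) -(deriveD (daf x) (dg x)).
by [].
Qed.

Lemma partial_lin (a : R) (f g : X -> R) i : test_function f -> test_function g ->
  partial i (fun x => a * f x + g x) = fun x => a * partial i f x + partial i g x.
Proof.
move=> tf tg; have df x := @test_derivable _ _ f i x tf.
have dg x := @test_derivable _ _ g i x tg.
have daf x : derivable (a *: f) x (delta_mx ord0 i) by exact: derivableZ.
apply/funext => x; rewrite /partial.
rewrite -[a * _]/(a *: 'D_(delta_mx ord0 i) f x) -(deriveZ _ (df x)) -(deriveD (daf x) (dg x)).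
by [].
Qed.

Lemma test_lin (a : R) (f g : X -> R) : test_function f -> test_function g ->
  test_function (fun x => a * f x + g x).
Proof.
move=> [Cf sf] [Cg sg]; split; first by move=> k; exact: is_Ck_lin.
have : closure [set x | a * f x + g x != 0] `<=`
    closure [set x | f x != 0] `|` closure [set x | g x != 0].
  rewrite closureE; apply: smallest_sub; first by apply: closedU; exact: closed_closure.
  move=> x /= H; have [fx|fx] := eqVneq (f x) 0; last by left; exact: subset_closure.
  right; apply: subset_closure => /=; move: H; rewrite fx mulr0 add0r; exact.
by move=> H x /H [/sf|/sg].
Qed.

Lemma norm2_cvg0P (f : nat -> X -> R) g : (forall n, f n \in Lfun mu 2%:E) ->
  g \in Lfun mu 2%:E -> norm2 (f n \- g) @[n --> \oo] --> 0%E <->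
  inner (f n \- g) (f n \- g) @[n --> \oo] --> (0 : R).
Proof.
move=> lf lg; split=> [/(norm2_cvg0 lf lg) c0|c0].
  rewrite (_ : (fun n => inner _ _) = (fun n => Num.sqrt (inner (f n \- g) (f n \- g)) *
     Num.sqrt (inner (f n \- g) (f n \- g)))); last first.
    by apply/funext => n; rewrite -expr2 sqr_sqrtr ?inner_ge0.
  rewrite [X in _ --> X](_ : _ = 0 * 0); last by rewrite mulr0.
  exact: (cvgM c0 c0).
under eq_fun do rewrite norm2E ?Lfun2B//.
apply: cvg_EFin; first exact: nearW.
have := cvg_comp _ _ c0 (@sqrt_continuous R 0).
by rewrite sqrtr0.
Qed.

Lemma inner_lin_sqr (a : R) (F G : X -> R) : F \in Lfun mu 2%:E -> G \in Lfun mu 2%:E ->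
  inner (fun x => a * F x + G x) (fun x => a * F x + G x) =
  a ^+ 2 * inner F F + 2 * a * inner F G + inner G G.
Proof.
move=> lF lG; have laF := Lfun2Z a lF; have ls := Lfun2D laF lG.
rewrite (innerDl laF lG ls) (innerZl _ lF ls) (innerC F) (innerC G).
rewrite (innerDl laF lG lF) (innerDl laF lG lG) !(innerZl _ lF)// (innerC G F); ring.
Qed.

Lemma inner_lin_le (a : R) (F G : X -> R) : F \in Lfun mu 2%:E -> G \in Lfun mu 2%:E ->
  inner (fun x => a * F x + G x) (fun x => a * F x + G x) <=
  2 * a ^+ 2 * inner F F + 2 * inner G G.
Proof.
move=> lF lG; have := inner_ge0 (fun x => - a * F x + G x).
by rewrite !inner_lin_sqr// sqrrN; move=> H; lra.
Qed.

Lemma norm2_cvg_lin (a : R) (f1 f2 : nat -> X -> R) g1 g2 :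
  (forall n, f1 n \in Lfun mu 2%:E) -> (forall n, f2 n \in Lfun mu 2%:E) ->
  g1 \in Lfun mu 2%:E -> g2 \in Lfun mu 2%:E ->
  norm2 (f1 n \- g1) @[n --> \oo] --> 0%E ->
  norm2 (f2 n \- g2) @[n --> \oo] --> 0%E ->
  norm2 ((fun x => a * f1 n x + f2 n x) \- (fun x => a * g1 x + g2 x)) @[n --> \oo] --> 0%E.
Proof.
move=> l1 l2 lg1 lg2 /(norm2_cvg0P l1 lg1) c1 /(norm2_cvg0P l2 lg2) c2.
apply/norm2_cvg0P; first by move=> n; apply: Lfun2D => //; exact: Lfun2Z.
  by apply: Lfun2D => //; exact: Lfun2Z.
have c : 2 * a ^+ 2 * inner (f1 n \- g1) (f1 n \- g1) + 2 * inner (f2 n \- g2) (f2 n \- g2)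
   @[n --> \oo] --> (0 : R).
  rewrite [X in _ --> X](_ : _ = 2 * a ^+ 2 * 0 + 2 * 0); last by rewrite !mulr0 addr0.
  by apply: cvgD; apply: cvgMl_tmp.
apply: (squeeze_cvgr _ (cvg_cst 0) c); apply: nearW => n.
rewrite inner_ge0/=.
have -> : ((fun x => a * f1 n x + f2 n x) \- (fun x => a * g1 x + g2 x)) =
   (fun x => a * (f1 n \- g1) x + (f2 n \- g2) x).
  by apply/funext => x /=; ring.
by apply: inner_lin_le; exact: Lfun2B.
Qed.

Lemma H10_gradient_lin (a : R) (u1 u2 : X -> R) g1 g2 :
  H10_gradient u1 g1 -> H10_gradient u2 g2 ->
  H10_gradient (fun x => a * u1 x + u2 x) (fun k x => a * g1 k x + g2 k x).
Proof.
move=> [lu1 lg1 [p1 [t1 c1 d1]]] [lu2 lg2 [p2 [t2 c2 d2]]]; split.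
- by apply: Lfun2D => //; exact: Lfun2Z.
- by move=> i; apply: Lfun2D => //; exact: Lfun2Z.
exists (fun n x => a * p1 n x + p2 n x); split.
- by move=> n; exact: test_lin.
- by apply: norm2_cvg_lin => // n; exact: test_Lfun2.
move=> i; under eq_fun do rewrite partial_lin//.
by apply: norm2_cvg_lin => // n; apply: test_Lfun2; exact: test_partial.
Qed.

Lemma test_function0 : test_function (fun _ : X => 0 : R).
Proof.
split.
  elim=> [|k IH]; first by split => //; exact: cst_continuous.
  split; first exact: cst_continuous.
  move=> i; split; first by move=> x; exact: derivable_cst.
  by rewrite (_ : partial i _ = fun=> 0)//; apply/funext => x; rewrite /partial derive_cst.
rewrite (_ : [set x | _] = set0) ?closure0//.
by apply/seteqP; split => // x /=; rewrite eqxx.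
Qed.

Lemma H10_gradient0 : H10_gradient (fun _ : X => 0 : R) (fun _ _ => 0).
Proof.
split; [exact: Lfun2_cst|by move=> i; exact: Lfun2_cst|].
exists (fun _ _ => 0).
have n0 : norm2 ((fun _ : X => 0 : R) \- (fun _ : X => 0 : R)) @[n --> \oo] --> 0%E.
  rewrite norm2E; last by apply: Lfun2B; exact: Lfun2_cst.
  rewrite (_ : _ \- _ = fun=> 0); last by apply/funext => x /=; rewrite subr0.
  by rewrite inner0l sqrtr0; exact: cvg_cst.
split => //; first by move=> n; exact: test_function0.
move=> i; rewrite (_ : partial i _ = fun=> 0)//.
by apply/funext => x; rewrite /partial derive_cst.
Qed.

Lemma H10_gradient_lincomb n (a : 'I_n -> R) (u : 'I_n -> X -> R) (g : 'I_n -> 'I_d -> X -> R) :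
  (forall i, H10_gradient (u i) (g i)) ->
  H10_gradient (fun x => \sum_i a i * u i x) (fun k x => \sum_i a i * g i k x).
Proof.
move=> H.
suff S (r : seq 'I_n) : H10_gradient (fun x => \sum_(i <- r) a i * u i x)
    (fun k x => \sum_(i <- r) a i * g i k x) by exact: S.
elim: r => [|i r IH].
  have E1 : (fun x => \sum_(j <- [::]) a j * u j x) = (fun=> 0).
    by apply/funext => x; rewrite big_nil.
  have E2 : (fun k x => \sum_(j <- [::]) a j * g j k x) = (fun _ _ => 0).
    by apply/funext => k; apply/funext => x; rewrite big_nil.
  by rewrite E1 E2; exact: H10_gradient0.
have E1 : (fun x => \sum_(j <- i :: r) a j * u j x) =
    (fun x => a i * u i x + \sum_(j <- r) a j * u j x).
  by apply/funext => x; rewrite big_cons.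
have E2 : (fun k x => \sum_(j <- i :: r) a j * g j k x) =
    (fun k x => a i * g i k x + \sum_(j <- r) a j * g j k x).
  by apply/funext => k; apply/funext => x; rewrite big_cons.
by rewrite E1 E2; exact: H10_gradient_lin.
Qed.

(** Both sides are continuous in z for the H^1 norm, in which test functions are
    dense in H^1_0. *)
Lemma weak_form_H10 (gam : 'I_d -> X -> R) (w z : X -> R) (g : 'I_d -> X -> R) :
  (forall i, gam i \in Lfun mu 2%:E) -> w \in Lfun mu 2%:E ->
  (forall phi, test_function phi ->
    \sum_i inner (gam i) (partial i phi) = - inner w phi) ->
  H10_gradient z g -> \sum_i inner (gam i) (g i) = - inner w z.
Proof.
move=> lgam lw H [lz lg [phi [tphi cphi cd]]].
have lphi n := test_Lfun2 (tphi n).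
have c1 : \sum_i inner (gam i) (partial i (phi n)) @[n --> \oo] --> \sum_i inner (gam i) (g i).
  apply: cvg_fin_sum => i; under eq_fun do rewrite innerC; rewrite innerC.
  by apply: norm2_cvg_inner => // n; apply: test_Lfun2; exact: test_partial.
have c2 : - inner w (phi n) @[n --> \oo] --> - inner w z.
  apply: cvgN; under eq_fun do rewrite innerC; rewrite innerC.
  exact: norm2_cvg_inner.
move: c1; under eq_fun do rewrite H//.
by move=> c1; exact: (cvg_unique _ c1 c2).
Qed.

End H10.

Section eigenbasis.
Context {R : realType} {d : nat}.
Local Notation X := 'rV[R]_d.
Local Notation mu := (@cube_measure R d).
Variables (lam : nat -> R) (e : nat -> X -> R).
Hypothesis he : dirichlet_eigenbasis lam e.

Definition eigen_comb n (a : 'I_n -> R) : X -> R := fun x => \sum_i a i * e i x.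

Lemma eigen_Lfun2 i : e i \in Lfun mu 2%:E.
Proof. by have [_ [g []]] := eigen_laplacian he i. Qed.

Lemma eigen_comb_Lfun2 n (a : 'I_n -> R) : eigen_comb a \in Lfun mu 2%:E.
Proof. by apply: Lfun2_lincomb => i; exact: eigen_Lfun2. Qed.

Lemma inner_eigen_combl n (a : 'I_n -> R) h : h \in Lfun mu 2%:E ->
  inner (eigen_comb a) h = \sum_(i < n) a i * inner (e i) h.
Proof. by move=> lh; apply: inner_lincombl => // i; exact: eigen_Lfun2. Qed.

Lemma inner_eigen_comb n (a : 'I_n -> R) (i : 'I_n) : inner (eigen_comb a) (e i) = a i.
Proof.
rewrite inner_eigen_combl; last exact: eigen_Lfun2.
rewrite (bigD1 i)//= (eigen_orthonormal he) eqxx mulr1 big1 ?addr0// => j ji.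
by rewrite (eigen_orthonormal he) -[_ == _ :> nat]/(j == i) (negbTE ji) mulr0.
Qed.

Lemma inner_eigen_comb2 n (a b : 'I_n -> R) :
  inner (eigen_comb a) (eigen_comb b) = \sum_i a i * b i.
Proof.
rewrite inner_eigen_combl; last exact: eigen_comb_Lfun2.
by apply: eq_bigr => i _; rewrite innerC inner_eigen_comb.
Qed.

Lemma eigen_gradients : exists G : nat -> 'I_d -> X -> R,
  forall i, H10_gradient (e i) (G i) /\
    forall phi, test_function phi ->
      \sum_k inner (G i k) (partial k phi) = lam i * inner (e i) phi.
Proof.
suff /choice[G HG] : forall i, exists g : 'I_d -> X -> R, H10_gradient (e i) g /\
    forall phi, test_function phi ->
      \sum_k inner (g k) (partial k phi) = lam i * inner (e i) phi.
  by exists G.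
move=> i; have [lw [g Hg weak]] := eigen_laplacian he i.
exists g; split => // phi tphi; rewrite weak// innerZl ?mulNr ?opprK//.
  exact: eigen_Lfun2.
exact: test_Lfun2.
Qed.

(** The weak forms of the eigenfunctions add up to the one of the combination;
    extended to H^1_0 and tested against the combination itself, it yields the
    norm of the gradient. *)
Lemma eigen_comb_gradient n (a : 'I_n -> R) : exists2 g : 'I_d -> X -> R,
  H10_gradient (eigen_comb a) g &
  (forall phi, test_function phi ->
      \sum_k inner (g k) (partial k phi) = - inner (eigen_comb (fun i : 'I_n => - (lam i * a i))) phi)
  /\ \sum_k inner (g k) (g k) = \sum_(i < n) lam i * a i ^+ 2.
Proof.
have [G HG] := eigen_gradients.
pose g k x := \sum_(i < n) a i * G i k x.
have Hg : H10_gradient (eigen_comb a) g.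
  by apply: H10_gradient_lincomb => i; have [] := HG i.
have lG i k : G i k \in Lfun mu 2%:E by have [[]] := HG i.
have lw := eigen_comb_Lfun2 (fun i : 'I_n => - (lam i * a i)).
have weak phi : test_function phi ->
      \sum_k inner (g k) (partial k phi) = - inner (eigen_comb (fun i : 'I_n => - (lam i * a i))) phi.
  move=> tphi; have lphi := test_Lfun2 tphi.
  rewrite inner_eigen_combl//.
  transitivity (\sum_k \sum_(i < n) a i * inner (G i k) (partial k phi)).
    by apply: eq_bigr => k _; rewrite inner_lincombl//; apply: test_Lfun2; exact: test_partial.
  rewrite exchange_big/= -sumrN; apply: eq_bigr => i _.
  by rewrite -mulr_sumr (HG i).2//; ring.
exists g => //; split => //.
have [_ lg _] := Hg.
rewrite (weak_form_H10 lg lw weak Hg) inner_eigen_comb2 -sumrN.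
by apply: eq_bigr => i _; ring.
Qed.

(** Let om = w - w'.  The gradients used for w and w' differ by a gradient gam of
    the zero function whose divergence is om.  The weak form on H^1_0, tested
    against zero with this gradient, gives |gam|^2 = - <om, 0> = 0; tested against
    an eigenfunction it then gives <om, e i> = 0, and completeness yields
    om = 0. *)
Lemma is_laplacian_unique (u w w' : X -> R) : is_laplacian u w -> is_laplacian u w' ->
  w = w' %[ae mu].
Proof.
move=> [lw [g Hg weak]] [lw' [g' Hg' weak']].
pose om x := -1 * w' x + w x.
pose gam k x := -1 * g' k x + g k x.
have lom : om \in Lfun mu 2%:E by apply: Lfun2D => //; exact: Lfun2Z.
have Hgam : H10_gradient (fun _ : X => 0) gam.
  have E : (fun _ : X => 0) = (fun x => -1 * u x + u x) by apply/funext => x; ring.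
  by rewrite E; exact: H10_gradient_lin.
have [_ lgam _] := Hgam; have [_ lg _] := Hg; have [_ lg' _] := Hg'.
have weakd phi : test_function phi -> \sum_k inner (gam k) (partial k phi) = - inner om phi.
  move=> tphi; have lphi := test_Lfun2 tphi.
  have lp k : partial k phi \in Lfun mu 2%:E by apply: test_Lfun2; exact: test_partial.
  rewrite (innerDl (Lfun2Z (-1) lw') lw lphi) innerZl//.
  rewrite (eq_bigr (fun k => -1 * inner (g' k) (partial k phi) + inner (g k) (partial k phi))).
    by rewrite big_split/= -mulr_sumr weak// weak'//; ring.
  by move=> k _; rewrite (innerDl (Lfun2Z (-1) (lg' k)) (lg k) (lp k)) innerZl.
have S0 : \sum_k inner (gam k) (gam k) = 0.
  rewrite (weak_form_H10 lgam lom weakd Hgam).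
  by rewrite innerC inner0l oppr0.
have gam0 k : inner (gam k) (gam k) = 0.
  by move/psumr_eq0P : S0 => -> // i _; exact: inner_ge0.
have om0 i : inner om (e i) = 0.
  have [_ [gi Hgi _]] := eigen_laplacian he i.
  have [_ lgi _] := Hgi.
  have := weak_form_H10 lgam lom weakd Hgi.
  rewrite big1; first by move/eqP; rewrite eq_sym oppr_eq0 => /eqP.
  move=> k _; have := inner_CS (lgam k) (lgi k).
  by rewrite gam0 mul0r real_exprn_even_le0 ?num_real//= => /eqP.
have : inner om om = 0.
  have := eigen_complete he lom.
  have -> : (fun N => norm2 (om \- Defs.proj e N om)) = fun=> norm2 om.
    apply/funext => N; congr norm2; apply/funext => x /=.
    by rewrite /Defs.proj big1 ?subr0// => i _; rewrite om0 mul0r.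
  move=> /(cvg_unique (@ereal_hausdorff R) (cvg_cst _)).
  rewrite norm2E// => -[] /eqP; rewrite sqrtr_eq0 => H.
  by apply/eqP; rewrite eq_le H inner_ge0.
move/(inner_eq0 lom); apply: filterS => x; rewrite /om/= => H.
by move=> /H; rewrite mulN1r => /eqP; rewrite addrC subr_eq0 => /eqP.
Qed.

Lemma laplacian_eigen_comb n (a : 'I_n -> R) :
  laplacian (eigen_comb a) \in Lfun mu 2%:E /\
  laplacian (eigen_comb a) = eigen_comb (fun i : 'I_n => - (lam i * a i)) %[ae mu].
Proof.
have [g Hg [weak _]] := eigen_comb_gradient a.
have L : is_laplacian (eigen_comb a) (eigen_comb (fun i : 'I_n => - (lam i * a i))).
  by split; [exact: eigen_comb_Lfun2|exists g].
have L' : is_laplacian (eigen_comb a) (laplacian (eigen_comb a)).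
  by apply: (xgetPex (cst 0)); exists (eigen_comb (fun i : 'I_n => - (lam i * a i))).
by split; [case: L'|exact: is_laplacian_unique L' L].
Qed.

Hypothesis hd : d = 1%N \/ d = 2%N.

Lemma sobolev_eigen_comb n (a : 'I_n -> R) :
  (\int[mu]_x (eigen_comb a x ^+ 6)%:E <=
  (81 * (\sum_i a i ^+ 2) * (\sum_(i < n) lam i * a i ^+ 2) ^+ 2)%:E)%E.
Proof.
have [g Hg [_ Eg]] := eigen_comb_gradient a.
have := sobolev_H10 hd Hg; rewrite Eg inner_eigen_comb2.
by under eq_bigr do rewrite -expr2.
Qed.

Lemma norm6_eigen_comb n (a : 'I_n -> R) (eps : R) : 0 < eps ->
  (norm6 (eigen_comb a) ^+ 2 <=
   (eps * (\sum_(i < n) lam i * a i ^+ 2) + 27 / eps ^+ 2 * (\sum_i a i ^+ 2))%:E)%E.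
Proof.
move=> eps0; apply: norm6_sqr_le => //; last exact: sobolev_eigen_comb.
  by apply: sumr_ge0 => i _; exact: sqr_ge0.
by apply: sumr_ge0 => i _; rewrite mulr_ge0 ?sqr_ge0// ltW// (eigen_gt0 he).
Qed.

End eigenbasis.

(** * The cubic nonlinearity and its primitive *)

Section cubic.
Context {R : realType}.
Variables c3 c2 c1 c0 : R.

Definition cubic (x : R) : R := c3 * x ^+ 3 + c2 * x ^+ 2 + c1 * x + c0.

Definition quartic (x : R) : R :=
  c3 / 4 * x ^+ 4 + c2 / 3 * x ^+ 3 + c1 / 2 * x ^+ 2 + c0 * x.

(** The average of the cubic over the segment from s to t, expanded so as to show
    that it is polynomial in s and t. *)
Definition cubic_avg (s t : R) : R :=
  c3 / 4 * (s * s * s + s * s * t + s * t * t + t * t * t) +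
  c2 / 3 * (s * s + s * t + t * t) + c1 / 2 * (s + t) + c0.

Lemma cubic_avgE (s t : R) :
  \int[lebesgue_measure]_(th in `[0, 1]) cubic (s + th * (t - s)) = cubic_avg s t.
Proof.
set del := t - s.
pose f := fun th => cubic (s + th * del).
pose G := fun th => c3 / 4 * del ^+ 3 * th ^+ 4 +
  (3 * c3 * s * del ^+ 2 + c2 * del ^+ 2) / 3 * th ^+ 3 +
  (3 * c3 * s ^+ 2 * del + 2 * c2 * s * del + c1 * del) / 2 * th ^+ 2 + cubic s * th.
have dG (th : R) : is_derive th (1 : R) G (f th).
  apply: is_derive_eq; rewrite /f /cubic /GRing.scale/=.
  by field.
have cG : continuous G.
  move=> th; apply: differentiable_continuous; apply/derivable1_diffP.
  exact: (@ex_derive _ _ _ _ _ _ _ (dG th)).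
have df (th : R) : derivable f th 1 by rewrite /f /cubic; exact: ex_derive.
have cf : continuous f.
  by move=> th; apply: differentiable_continuous; apply/derivable1_diffP.
rewrite /Rintegral (@continuous_FTC2 _ f G)//.
- by rewrite -EFinB/= /G /cubic_avg /cubic /del; field.
- exact: continuous_subspaceT.
- split.
  + by move=> th _; exact: (@ex_derive _ _ _ _ _ _ _ (dG th)).
  + by apply: cvg_at_right_filter; exact: cG.
  + by apply: cvg_at_left_filter; exact: cG.
- by move=> th _; rewrite derive1E; exact: (@derive_val _ _ _ _ _ _ _ (dG th)).
Qed.

(** The discrete gradient identity behind the conservation of energy. *)
Lemma cubic_avg_quartic (s t : R) : cubic_avg s t * (t - s) = quartic t - quartic s.
Proof. by rewrite /cubic_avg /quartic; field. Qed.

Lemma quartic_factor (t : R) : quartic t = cubic_avg 0 t * t.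
Proof. by rewrite -[X in _ * X]subr0 cubic_avg_quartic /quartic; ring. Qed.

(** The positive leading coefficient beats any quadratic term; the constant comes
    from completing squares. *)
Lemma quartic_coercive (kappa : R) : 0 < c3 ->
  exists2 C, 0 <= C & forall t, kappa * t ^+ 2 <= quartic t + C.
Proof.
move=> c3p; set p := c3 / 4; set q := c2 / 3.
have pp : 0 < p by rewrite divr_gt0.
(* The coefficient of t ^+ 2 that remains when the cubic term is completed to a
   square and one t ^+ 2 is set aside for the linear term. *)
set rho := c1 / 2 - kappa - q ^+ 2 / p - 1.
exists (rho ^+ 2 / (3 * p) + c0 ^+ 2 / 4).
  by rewrite addr_ge0// divr_ge0 ?sqr_ge0// mulr_ge0// ltW.
move=> t; rewrite -subr_ge0.
have -> : quartic t + (rho ^+ 2 / (3 * p) + c0 ^+ 2 / 4) - kappa * t ^+ 2 =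
  t ^+ 2 * (p * t + 2 * q) ^+ 2 / (4 * p) + 3 / 4 * p * (t ^+ 2 + 2 * rho / (3 * p)) ^+ 2 +
  (t + c0 / 2) ^+ 2.
  by rewrite /quartic -/p -/q /rho; field; rewrite gt_eqF.
apply: addr_ge0; last exact: sqr_ge0.
apply: addr_ge0.
  by apply: divr_ge0; [apply: mulr_ge0; exact: sqr_ge0|apply: mulr_ge0 => //; exact: ltW].
by apply: mulr_ge0; [apply: mulr_ge0; [exact: divr_ge0|exact: ltW]|exact: sqr_ge0].
Qed.

(** The sixth power is a crude majorant, but its integral is bounded uniformly in
    N for the projected initial position. *)
Lemma quartic_growth (t : R) :
  quartic t <= (`|c3| + `|c2| + `|c1| + `|c0|) * (1 + t ^+ 6).
Proof.
have H k : (k <= 6)%N -> `|t| ^+ k <= 1 + t ^+ 6.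
  move=> k6; have -> : t ^+ 6 = `|t| ^+ 6.
    by rewrite -[6%N]/(2 * 3)%N !exprM real_normK ?num_real.
  have [t1|t1] := leP `|t| 1.
    by apply: (@le_trans _ _ 1); [exact: exprn_ile1|rewrite lerDl exprn_ge0].
  by apply: (@le_trans _ _ (`|t| ^+ 6)); [rewrite ler_eXn2l|rewrite lerDr].
have P (c q : R) k : (k <= 6)%N -> 1 <= q -> c / q * t ^+ k <= `|c| * (1 + t ^+ 6).
  move=> k6 q1; have q0 : 0 < q by exact: lt_le_trans q1.
  apply: le_trans (ler_norm _) _; rewrite normrM normrX.
  apply: ler_pM => //; last exact: H.
  rewrite normrM normfV (gtr0_norm q0) ler_pdivrMr//.
  by rewrite ler_peMr.
rewrite /quartic !mulrDl.
have n1 n : (0 < n)%N -> 1 <= n%:R :> R by rewrite ler1n.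
have := P c3 4 4%N isT (n1 4%N isT); have := P c2 3 3%N isT (n1 3%N isT).
have := P c1 2 2%N isT (n1 2%N isT).
have := P c0 1 1%N isT; rewrite divr1 expr1 => /(_ (lexx _)) h0.
by move=> h1 h2 h3; rewrite !lerD.
Qed.

End cubic.

(** * The implicit step and its energy in coordinates *)

Section scheme_coordinates.
Context {R : realType} {d : nat}.
Local Notation X := 'rV[R]_d.
Local Notation mu := (@cube_measure R d).
Variables (lam : nat -> R) (e : nat -> X -> R).
Hypothesis he : dirichlet_eigenbasis lam e.
Hypothesis hd : d = 1%N \/ d = 2%N.
Variables c3 c2 c1 c0 : R.
Variable N : nat.
Implicit Types a b : 'I_N -> R.
Local Notation comb := (@eigen_comb R d e N).
Local Notation avg := (cubic_avg c3 c2 c1 c0).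
Local Notation F := (quartic c3 c2 c1 c0).

Lemma eigen_comb_measurable a : measurable_fun setT (comb a).
Proof. exact: Lfun2_measurable (eigen_comb_Lfun2 he a). Qed.

Lemma eigen_comb_L6 a : (\int[mu]_x (comb a x ^+ 6)%:E < +oo)%E.
Proof. by apply: le_lt_trans (sobolev_eigen_comb he hd a) _; rewrite ltry. Qed.

Lemma cubic_avg_Lfun2 (u w : X -> R) :
  measurable_fun setT u -> measurable_fun setT w ->
  (\int[mu]_x (u x ^+ 6)%:E < +oo)%E -> (\int[mu]_x (w x ^+ 6)%:E < +oo)%E ->
  (fun x => avg (u x) (w x)) \in Lfun mu 2%:E.
Proof.
move=> mu_ mw fu fw.
have fo : (\int[mu]_x ((fun _ : X => 1 : R) x ^+ 6)%:E < +oo)%E.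
  under eq_integral do rewrite expr1n.
  by rewrite integral_cst// mul1e (le_lt_trans (probability_le1 _ _))// ltry.
have mo : measurable_fun setT (fun _ : X => 1 : R) by exact: measurable_cst.
have P3 (f g k : X -> R) := @L6_mul_Lfun2 R d f g k.
have l1 (f : X -> R) : measurable_fun setT f -> (\int[mu]_x (f x ^+ 6)%:E < +oo)%E -> f \in Lfun mu 2%:E.
  move=> mf ff; have := P3 _ _ _ mf mo mo ff fo fo.
  by rewrite (_ : (fun x => _) = f)//; apply/funext => x; rewrite !mulr1.
have l2 (f g : X -> R) : measurable_fun setT f -> measurable_fun setT g ->
    (\int[mu]_x (f x ^+ 6)%:E < +oo)%E -> (\int[mu]_x (g x ^+ 6)%:E < +oo)%E ->
    (fun x => f x * g x) \in Lfun mu 2%:E.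
  move=> mf mg ff fg; have := P3 _ _ _ mf mg mo ff fg fo.
  by rewrite (_ : (fun x => _) = fun x => f x * g x)//; apply/funext => x; rewrite mulr1.
apply: Lfun2D; last exact: Lfun2_cst.
apply: Lfun2D; [apply: Lfun2D|]; apply: Lfun2Z.
- by apply: Lfun2D; [apply: Lfun2D; [apply: Lfun2D|]|]; exact: P3.
- by apply: Lfun2D; [apply: Lfun2D|]; exact: l2.
- by apply: Lfun2D; exact: l1.
Qed.

Lemma cubic_avg_comb_Lfun2 a b : (fun x => avg (comb a x) (comb b x)) \in Lfun mu 2%:E.
Proof.
by apply: cubic_avg_Lfun2; (exact: eigen_comb_measurable || exact: eigen_comb_L6).
Qed.

Lemma quartic_comb_integrable a : mu.-integrable setT (EFin \o (fun x => F (comb a x))).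
Proof.
have l : (fun x => avg 0 (comb a x)) \in Lfun mu 2%:E.
  apply: cubic_avg_Lfun2; [exact: measurable_cst|exact: eigen_comb_measurable| |exact: eigen_comb_L6].
  under eq_integral do rewrite expr0n/=.
  by rewrite integral0 ltry.
have := inner_integrable l (eigen_comb_Lfun2 he a).
rewrite (_ : EFin \o (fun x => _) = EFin \o (fun x => F (comb a x)))//.
by apply/funext => x /=; rewrite quartic_factor.
Qed.

Definition nonlinearity a a' (i : 'I_N) : R :=
  inner (fun x => avg (comb a x) (comb a' x)) (e i).

(** The first equation of the step solved for the intermediate velocity, which
    leaves the new position a' as the only unknown. *)
Definition velocity (h : R) a b a' (i : 'I_N) : R := 2 * (a' i - a i) / h - b i.

(** The second equation of the step, after elimination of the intermediate
    velocity. *)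
Definition residual (h : R) a b a' (i : 'I_N) : R :=
  velocity h a b a' i - b i + h * (lam i * ((a i + a' i) / 2)) + h * nonlinearity a a' i.

Lemma eigen_comb_lin (al : R) a b x :
  comb (fun i => al * a i + b i) x = al * comb a x + comb b x.
Proof.
rewrite /eigen_comb mulr_sumr -big_split/=.
by apply: eq_bigr => i _; ring.
Qed.

Lemma eigen_comb_half a b x :
  comb (fun i => (a i + b i) / 2) x = (comb a x + comb b x) / 2.
Proof.
rewrite /eigen_comb -big_split/= mulr_suml.
by apply: eq_bigr => i _; ring.
Qed.

Lemma eigen_comb_ae_inj a b : comb a = comb b %[ae mu] -> a = b.
Proof.
move=> ab; apply/funext => i.
rewrite -(inner_eigen_comb he a i) -(inner_eigen_comb he b i).
apply: ae_eq_inner => //; try exact: eigen_comb_measurable.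
by apply: Lfun2_measurable; exact: eigen_Lfun2 he _.
Qed.

Lemma laplacianN_coords (z : X -> R) :
  laplacianN e N z = comb (fun i : 'I_N => - (lam i * inner z (e i))) %[ae mu].
Proof. exact: (laplacian_eigen_comb he (fun i : 'I_N => inner z (e i))).2. Qed.

Lemma proj_coords (z : X -> R) : Defs.proj e N z = comb (fun i : 'I_N => inner z (e i)).
Proof. by []. Qed.

Lemma inner_ae_combE (z : X -> R) a (i : 'I_N) : z \in Lfun mu 2%:E -> z = comb a %[ae mu] ->
  inner z (e i) = a i.
Proof.
move=> lz za; rewrite (ae_eq_inner za) ?(inner_eigen_comb he)//.
- exact: Lfun2_measurable.
- exact: eigen_comb_measurable.
- by apply: Lfun2_measurable; exact: eigen_Lfun2 he _.
Qed.

Lemma average_field_coords (u u' : X -> R) a a' (i : 'I_N) :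
  u \in Lfun mu 2%:E -> u' \in Lfun mu 2%:E ->
  u = comb a %[ae mu] -> u' = comb a' %[ae mu] ->
  inner (average_field (cubic c3 c2 c1 c0) u u') (e i) = nonlinearity a a' i.
Proof.
move=> lu lu' ua ua'.
have -> : average_field (cubic c3 c2 c1 c0) u u' = fun x => avg (u x) (u' x).
  by apply/funext => x; exact: cubic_avgE.
have mu_ := Lfun2_measurable lu; have mu'_ := Lfun2_measurable lu'.
apply: ae_eq_inner.
- by apply: filterS2 ua ua' => x /= h1 h2 xT; rewrite h1// h2.
- have m1 : measurable_fun setT (fun x => c3 / 4 * (u x * u x * u x + u x * u x * u' x + u x * u' x * u' x + u' x * u' x * u' x)).
    apply: measurable_funM => //.
    by apply: measurable_funD; [apply: measurable_funD; [apply: measurable_funD|]|];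
      (apply: measurable_funM => //; apply: measurable_funM).
  have m2 : measurable_fun setT (fun x => c2 / 3 * (u x * u x + u x * u' x + u' x * u' x)).
    apply: measurable_funM => //.
    by apply: measurable_funD; [apply: measurable_funD|]; apply: measurable_funM.
  have m3 : measurable_fun setT (fun x => c1 / 2 * (u x + u' x)).
    by apply: measurable_funM => //; apply: measurable_funD.
  by apply: measurable_funD => //; apply: measurable_funD => //; apply: measurable_funD.
- exact: Lfun2_measurable (cubic_avg_comb_Lfun2 _ _).
- by apply: Lfun2_measurable; exact: eigen_Lfun2 he _.
Qed.

(** The right-hand sides of both equations lie in the span of the eigenfunctions
    as soon as u and v do, so every solution has coordinates. *)
Lemma avf_step_coords (h : R) (u v u' vb : X -> R) a b : 0 < h ->
  u \in Lfun mu 2%:E -> v \in Lfun mu 2%:E ->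
  u = comb a %[ae mu] -> v = comb b %[ae mu] ->
  avf_step e (cubic c3 c2 c1 c0) N h u v u' vb ->
  exists a', [/\ forall i, residual h a b a' i = 0, u' = comb a' %[ae mu] &
    vb = comb (velocity h a b a') %[ae mu]].
Proof.
move=> h0 lu lv ua vb_ [lu' lvb Eu' Evb].
set z := (fun y => (u y + u' y) / 2) in Evb.
pose n_ := average_field (cubic c3 c2 c1 c0) u u'.
pose bb (i : 'I_N) := h * - (lam i * inner z (e i)) + (- h * inner n_ (e i) + b i).
have vbE : vb = comb bb %[ae mu].
  apply: filterS3 Evb (laplacianN_coords z) vb_ => x /= H1 H2 H3 xT.
  rewrite H1// H2// H3// proj_coords -/n_.
  rewrite (eigen_comb_lin h) (eigen_comb_lin (- h)); ring.
pose a' (i : 'I_N) := h / 2 * b i + (h / 2 * bb i + a i).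
have u'E : u' = comb a' %[ae mu].
  apply: filterS2 Eu' (filterI ua (filterI vb_ vbE)) => x /= H1 [H2 [H3 H4]] xT.
  by rewrite H1// H2// H3// H4// (eigen_comb_lin (h / 2) b) (eigen_comb_lin (h / 2) bb); field.
have zE (i : 'I_N) : inner z (e i) = (a i + a' i) / 2.
  have lz : z \in Lfun mu 2%:E.
    rewrite (_ : z = fun x => 2^-1 * (u x + u' x)); first by apply: Lfun2Z; exact: Lfun2D.
    by apply/funext => x; rewrite /z mulrC.
  apply: (@inner_ae_combE z (fun i => (a i + a' i) / 2)) => //.
  by apply: filterS2 ua u'E => x /= H1 H2 xT; rewrite eigen_comb_half /z H1// H2.
have nE (i : 'I_N) : inner n_ (e i) = nonlinearity a a' i by exact: average_field_coords.
have velE (i : 'I_N) : velocity h a b a' i = bb i.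
  by rewrite /velocity /a'; field; rewrite gt_eqF.
exists a'; split => //.
  by move=> i; rewrite /residual velE /bb zE nE; ring.
by rewrite (_ : velocity h a b a' = bb)//; apply/funext.
Qed.

Lemma coords_avf_step (h : R) a b a' : 0 < h ->
  (forall i, residual h a b a' i = 0) ->
  avf_step e (cubic c3 c2 c1 c0) N h (comb a) (comb b) (comb a') (comb (velocity h a b a')).
Proof.
move=> h0 Hres; split; try exact: (eigen_comb_Lfun2 he).
- apply: aeW => x _; rewrite -[h * _]/(h * ((comb b x + comb (velocity h a b a') x) / 2)).
  rewrite (_ : comb a' x = comb (fun i => h / 2 * b i + (h / 2 * velocity h a b a' i + a i)) x).
    by rewrite eigen_comb_lin eigen_comb_lin; field.
  congr (comb _ x); apply/funext => i.
  by rewrite /velocity; field; rewrite gt_eqF.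
have H := laplacianN_coords (fun y => (comb a y + comb a' y) / 2).
apply: filterS H => x /= H xT.
rewrite H// proj_coords.
set z := fun y => (_ + _) / 2.
have zE (i : 'I_N) : inner z (e i) = (a i + a' i) / 2.
  rewrite -[RHS](inner_eigen_comb he (fun i => (a i + a' i) / 2)); congr inner.
  by apply/funext => y; rewrite eigen_comb_half.
have nE (i : 'I_N) : inner (average_field (cubic c3 c2 c1 c0) (comb a) (comb a')) (e i) = nonlinearity a a' i.
  by apply: average_field_coords; try exact: (eigen_comb_Lfun2 he); exact: aeW.
transitivity (comb (fun i : 'I_N => h * - (lam i * inner z (e i)) +
  (- h * inner (average_field (cubic c3 c2 c1 c0) (comb a) (comb a')) (e i) + b i)) x).
  congr (comb _ x); apply/funext => i; rewrite zE nE.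
  by apply/eqP; rewrite -subr_eq0; apply/eqP; rewrite -[RHS](Hres i) /residual; ring.
by rewrite !eigen_comb_lin; ring.
Qed.

(** Kinetic, elastic and potential energy; the shift C makes the potential
    coercive. *)
Definition energy (C : R) a b : R :=
  2^-1 * (\sum_i b i ^+ 2) + 2^-1 * (\sum_(i < N) lam i * a i ^+ 2) +
  \int[mu]_x (F (comb a x) + C).

Lemma energyDr (C : R) a b (z : 'I_N -> R) :
  energy C a (fun i => b i + z i) =
  energy C a b + ((\sum_i b i * z i) + 2^-1 * \sum_i z i ^+ 2).
Proof.
rewrite /energy.
have -> : \sum_i (b i + z i) ^+ 2 = \sum_i b i ^+ 2 + 2 * (\sum_i b i * z i) + \sum_i z i ^+ 2.
  by rewrite mulr_sumr -!big_split/=; apply: eq_bigr => i _; ring.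
by field.
Qed.

(** The displacement a' - a is h times the mean of the old and of the intermediate
    velocity.  Multiplied by it, the second equation turns its quadratic terms
    into differences of squares, and its nonlinear term into the increment of the
    potential by [cubic_avg_quartic]. *)
Lemma energy_conservation (C h : R) a b a' : 0 < h ->
  (forall i, residual h a b a' i = 0) ->
  energy C a' (velocity h a b a') = energy C a b.
Proof.
move=> h0 Hres; set bb := velocity h a b a'.
have icst : mu.-integrable setT (EFin \o (fun _ : X => C)).
  exact: finite_measure_integrable_cst.
have iF x := quartic_comb_integrable x.
have ED x : \int[mu]_y (F (comb x y) + C) = \int[mu]_y F (comb x y) + \int[mu]_y C.
  exact: (RintegralD measurableT (iF x) icst).
rewrite /energy !ED.
have DF : \int[mu]_x F (comb a' x) - \int[mu]_x F (comb a x) =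
    \sum_i (a' i - a i) * nonlinearity a a' i.
  rewrite -RintegralB//.
  transitivity (inner (fun x => avg (comb a x) (comb a' x)) (comb (fun i => a' i - a i))).
    apply: eq_Rintegral => x _.
    rewrite (_ : (fun i => _) = (fun i => -1 * a i + a' i)); last by apply/funext => i; ring.
    by rewrite eigen_comb_lin -cubic_avg_quartic; ring.
  rewrite innerC (inner_eigen_combl he _ (cubic_avg_comb_Lfun2 a a')).
  by apply: eq_bigr => i _; rewrite innerC.
have S : 2^-1 * (\sum_i bb i ^+ 2) + 2^-1 * (\sum_(i < N) lam i * a' i ^+ 2) +
   \sum_i (a' i - a i) * nonlinearity a a' i =
   2^-1 * (\sum_i b i ^+ 2) + 2^-1 * (\sum_(i < N) lam i * a i ^+ 2).
  rewrite !mulr_sumr -!big_split/=; apply: eq_bigr => i _.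
  have r := Hres i; rewrite /residual -/bb in r.
  have da : a' i - a i = h * ((bb i + b i) / 2).
    by rewrite /bb /velocity; field; rewrite gt_eqF.
  have : nonlinearity a a' i = - ((bb i - b i) / h + lam i * ((a i + a' i) / 2)).
    apply: (mulfI (lt0r_neq0 h0)); apply/eqP; rewrite -subr_eq0 -r; apply/eqP.
    by field; rewrite gt_eqF.
  move=> ->.
  rewrite (_ : a' i = a i + h * ((bb i + b i) / 2)); last by rewrite -da; ring.
  by field; rewrite gt_eqF.
have -> : \int[mu]_x F (comb a' x) = \int[mu]_x F (comb a x) + \sum_i (a' i - a i) * nonlinearity a a' i.
  by rewrite -DF; ring.
by rewrite -S; ring.
Qed.

Lemma energy_ge (kappa C : R) a b :
  (forall t, kappa * t ^+ 2 <= F t + C) ->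
  2^-1 * (\sum_i b i ^+ 2) + 2^-1 * (\sum_(i < N) lam i * a i ^+ 2) +
  kappa * (\sum_i a i ^+ 2) <= energy C a b.
Proof.
move=> H; rewrite /energy lerD2l.
have -> : kappa * (\sum_i a i ^+ 2) = \int[mu]_x (kappa * comb a x ^+ 2).
  have -> : \sum_i a i ^+ 2 = inner (comb a) (comb a).
    by rewrite (inner_eigen_comb2 he); apply: eq_bigr => i _; rewrite expr2.
  have la := eigen_comb_Lfun2 he a.
  rewrite /inner -RintegralZl//; last exact: inner_integrable.
have icst : mu.-integrable setT (EFin \o (fun _ : X => C)).
  exact: finite_measure_integrable_cst.
apply: le_Rintegral => //.
- have la := eigen_comb_Lfun2 he a.
  have := inner_integrable (Lfun2Z kappa la) la.
  rewrite (_ : EFin \o (fun x => _) = EFin \o (fun x => kappa * comb a x ^+ 2))//.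
  by apply/funext => x /=; rewrite expr2 mulrA.
exact: (integrableD measurableT (quartic_comb_integrable a) icst).
Qed.

(** The Sobolev inequality makes the potential energy bounded in terms of B and of
    the coefficients, whatever the number of coordinates. *)
Lemma energy_initial_le (C B : R) a b :
  \sum_i b i ^+ 2 <= B -> \sum_i a i ^+ 2 <= B -> \sum_(i < N) lam i * a i ^+ 2 <= B ->
  energy C a b <= B + (`|c3| + `|c2| + `|c1| + `|c0|) * (1 + 81 * B * B ^+ 2) + C.
Proof.
move=> Hb Ha Hla.
have B0 : 0 <= B by apply: le_trans Ha; apply: sumr_ge0 => i _; exact: sqr_ge0.
have la0 : 0 <= \sum_(i < N) lam i * a i ^+ 2.
  by apply: sumr_ge0 => i _; rewrite mulr_ge0 ?sqr_ge0// ltW// (eigen_gt0 he).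
have icst r : mu.-integrable setT (EFin \o (fun _ : X => r)).
  exact: finite_measure_integrable_cst.
have iF := quartic_comb_integrable a.
have m6 : measurable_fun setT (fun x => comb a x ^+ 6).
  by apply: measurable_funX; exact: eigen_comb_measurable.
have i6 : mu.-integrable setT (EFin \o (fun x => comb a x ^+ 6)).
  apply/integrableP; split; first exact/measurable_EFinP.
  under eq_integral do rewrite /= ger0_norm ?exprn_even_ge0//.
  exact: eigen_comb_L6.
set K := `|c3| + `|c2| + `|c1| + `|c0|.
have K0 : 0 <= K by rewrite !addr_ge0.
have cstE (r : R) : \int[mu]_x r = r.
  rewrite Rintegral_cst//; have -> : fine (mu setT) = 1 by rewrite probability_setT.
  by rewrite mulr1.
rewrite /energy (RintegralD measurableT iF (icst C)) cstE addrA lerD2r.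
apply: lerD; first by have := Hb; have := Hla; lra.
have i61 : mu.-integrable setT (EFin \o (fun x => 1 + comb a x ^+ 6)).
  exact: (integrableD measurableT (icst 1) i6).
apply: (@le_trans _ _ (\int[mu]_x (K * (1 + comb a x ^+ 6)))).
  apply: le_Rintegral => //.
  - exact: (integrableZl measurableT K i61).
  - by move=> x _; exact: quartic_growth.
rewrite RintegralZl// RintegralD// cstE ler_wpM2l// lerD2l.
have H6 := sobolev_eigen_comb he hd a.
rewrite -lee_fin /Rintegral fineK; last exact: integrable_fin_num.
apply: le_trans H6 _; rewrite lee_fin.
apply: ler_pM => //.
- by rewrite mulr_ge0// sumr_ge0// => i _; exact: sqr_ge0.
- exact: sqr_ge0.
- by rewrite ler_pM2l.
- by rewrite lerXn2r ?nnegrE.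
Qed.

(** Uniqueness of functions up to null sets becomes uniqueness of coordinates,
    because [avf_step_coords] and [coords_avf_step] identify the solutions. *)
Lemma residual_unique (T hbar0 h : R) (M : nat) : (0 < N)%N -> (0 < M)%N -> 0 < h ->
  avf_well_posed e (cubic c3 c2 c1 c0) T hbar0 -> M%:R * h = T -> h <= hbar0 ->
  forall a b, exists! a', forall i, residual h a b a' i = 0.
Proof.
move=> N0 M0 h0 wp Mh hh a b.
have inr x : in_range_proj e N (comb x).
  split; first exact: (eigen_comb_Lfun2 he x).
  apply: aeW => y _; rewrite proj_coords; congr (comb _ y).
  by apply/funext => i; rewrite (inner_eigen_comb he).
have [u' [vb [st un]]] := wp N M N0 M0 h Mh hh _ _ (inr a) (inr b).
have [a' [res u'E vbE]] := avf_step_coords h0 (eigen_comb_Lfun2 he a) (eigen_comb_Lfun2 he b)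
  (aeW _ (fun _ _ => erefl)) (aeW _ (fun _ _ => erefl)) st.
exists a'; split => // a'' res''.
have [eq1 _] := un _ _ (coords_avf_step h0 res'').
apply: eigen_comb_ae_inj.
by apply: filterS2 eq1 u'E => x /= H1 H2 xT; rewrite H1// H2.
Qed.

End scheme_coordinates.

(** * Measurability of implicitly defined functions *)

Section measurable_implicit.
Context {R : realType} {dO : measure_display} {Omega : measurableType dO}.

(** Since S w is the only zero of the nonnegative continuous function E w, the
    event t <= S w i occurs if and only if E w takes arbitrarily small values at
    rational points of some compact box inside the half-space t <= z i: the
    minimum of E w over the box is then 0, and is attained at S w.  Rational
    points make this a countable combination of events. *)
Lemma measurable_implicit_function n (E : Omega -> 'rV[R]_n -> R) (S : Omega -> 'rV[R]_n) :
  (forall z, measurable_fun setT (fun w => E w z)) ->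
  (forall w, continuous (E w)) -> (forall w z, 0 <= E w z) ->
  (forall w z, E w z = 0 <-> z = S w) ->
  forall i, measurable_fun setT (fun w => S w ord0 i).
Proof.
move=> mE cE E0 ES i.
pose rv (q : 'rV[rat]_n) : 'rV[R]_n := \row_j ratr (q ord0 j).
pose K (t : R) (k : nat) : set 'rV[R]_n :=
  [set v | forall j, `[if j == i then Num.max t (- k%:R) else - k%:R, (k%:R : R)]%classic (v ord0 j)].
have cK t k : compact (K t k).
  apply: (@rV_compact _ _ (fun j => `[if j == i then Num.max t (- k%:R) else - k%:R, (k%:R : R)]%classic)).
  by move=> j; exact: segment_compact.
have KE (t : R) : [set w | t <= S w ord0 i] =
    \bigcup_k \bigcap_m \bigcup_(q in [set q | K t k (rv q)]) [set w | E w (rv q) < m.+1%:R^-1].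
  apply/seteqP; split=> w /=.
    move=> tS; set z := S w in tS.
    have Ez : E w z = 0 by apply/ES.
    have [k Hk] : exists k : nat, `|z| + 1 <= k%:R.
      exists (Num.bound (`|z| + 1)); apply/ltW/archi_boundP.
      by rewrite addr_ge0.
    exists k => // m _.
    have : \forall y \near z, E w y < m.+1%:R^-1.
      have := cE w z; move/cvgrPdist_lt => /(_ m.+1%:R^-1).
      rewrite invr_gt0 ltr0n => /(_ isT); apply: filterS => y.
      by rewrite Ez sub0r normrN ger0_norm.
    move=> /nbhs_ballP[del /= del0 Hdel].
    (* Approaching z from above keeps the i-th coordinate at least t. *)
    have /choice[q Hq] : forall j : 'I_n, exists q : rat,
        z ord0 j < ratr q < z ord0 j + Num.min del 1.
      move=> j; have /rat_in_itvoo[q qP] : z ord0 j < z ord0 j + Num.min del 1.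
        by rewrite ltrDl lt_min del0 ltr01.
      by exists q; move: qP; rewrite in_itv.
    have zj j : `|z ord0 j| <= `|z|.
      rewrite [leRHS]/Num.norm/= mx_normrE.
      by apply/bigmax_geP; right; exists (ord0, j).
    exists (\row_j q j) => /=.
      move=> j; rewrite !mxE /= in_itv/=.
      have /andP[q1 q2] := Hq j.
      have q3 : ratr (q j) < z ord0 j + 1.
        by apply: lt_le_trans q2 _; rewrite lerD2l ge_min lexx orbT.
      have := zj j; rewrite ler_norml => /andP[z1 z2].
      have kl : - k%:R <= ratr (q j) :> R by lra.
      have ku : ratr (q j) <= k%:R :> R by lra.
      rewrite ku andbT; case: ifPn => // /eqP ji; rewrite ge_max kl andbT.
      by rewrite ji; apply: le_trans tS _; rewrite ji in q1; exact: ltW.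
    apply: Hdel; rewrite -ball_normE /= [ltLHS]/Num.norm/= mx_normrE.
    apply/bigmax_ltP; split => // -[a j] _ /=; rewrite (ord1 a) !mxE.
    have /andP[q1 q2] := Hq j.
    have q3 : ratr (q j) < z ord0 j + del.
      by apply: lt_le_trans q2 _; rewrite lerD2l ge_min lexx.
    by rewrite distrC gtr0_norm ?subr_gt0// ltrBlDl.
  move=> [k _ H].
  have [q0 Kq0 _] := H 0%N I.
  have cw : {within K t k, continuous (E w)} by apply: continuous_subspaceT; exact: cE.
  have K0 : K t k !=set0 by exists (rv q0).
  (* The minimum of E w over the box is below every 1 / (m + 1). *)
  have [c cKk cmin] := EVT_min_rV K0 (cK t k) cw.
  have Ec : E w c = 0.
    apply/eqP; rewrite eq_le E0 andbT; apply/ler_addgt0Pr => eps eps0; rewrite add0r.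
    have [m _ Hm] := near_infty_natSinv_lt (PosNum eps0).
    have [q Kq Eq] := H m I.
    apply: ltW; apply: (@le_lt_trans _ _ (E w (rv q))).
      by apply: cmin; rewrite inE.
    by apply: lt_trans Eq _; exact: (Hm m (leqnn m)).
  have <- : c = S w by apply/ES.
  move: cKk; rewrite inE => /(_ i) /=; rewrite eqxx in_itv/= => /andP[+ _].
  by rewrite ge_max => /andP[].
apply: (@measurability _ _ _ _ _ _ (@RGenCInfty.G R)).
  exact: RGenCInfty.measurableE.
move=> _ [_ [t ->] <-]; rewrite setTI.
have -> : (fun w => S w ord0 i) @^-1` `[t, +oo[ = [set w | t <= S w ord0 i].
  by apply/seteqP; split=> w /=; rewrite in_itv/= andbT.
rewrite KE; apply: bigcupT_measurable => k; apply: bigcapT_measurable => m.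
rewrite bigcup_mkcond; apply: countable_bigcupT_measurable; first exact: countableP.
move=> q; case: ifPn => // _.
rewrite (_ : [set w | _] = setT `&` (fun w => E w (rv q)) @^-1` `]-oo, m.+1%:R^-1[).
  by apply: mE => //; exact: measurable_itv.
by rewrite setTI; apply/seteqP; split => w /=; rewrite in_itv.
Qed.

End measurable_implicit.

(** * Measurability of the implicit step *)

Section solver.
Context {R : realType} {d : nat}.
Local Notation X := 'rV[R]_d.
Local Notation mu := (@cube_measure R d).
Variables (lam : nat -> R) (e : nat -> X -> R).
Hypothesis he : dirichlet_eigenbasis lam e.
Hypothesis hd : d = 1%N \/ d = 2%N.
Variables c3 c2 c1 c0 : R.
Variable N : nat.
Local Notation comb := (@eigen_comb R d e N).
Local Notation avg := (cubic_avg c3 c2 c1 c0).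
Local Notation F := (quartic c3 c2 c1 c0).
Local Notation nonlinearity := (nonlinearity e c3 c2 c1 c0).
Local Notation residual := (residual lam e c3 c2 c1 c0).
Local Notation energy := (energy lam e c3 c2 c1 c0).

Lemma eigen_measurable i : measurable_fun setT (e i).
Proof. exact: Lfun2_measurable (eigen_Lfun2 he i). Qed.

Lemma eigen_L6 i : (\int[mu]_x (e i x ^+ 6)%:E < +oo)%E.
Proof.
have [G HG] := eigen_gradients he.
by apply: le_lt_trans (sobolev_H10 hd (HG i).1) _; rewrite ltry.
Qed.

Let L6 (f : X -> R) := measurable_fun setT f /\ (\int[mu]_x (f x ^+ 6)%:E < +oo)%E.

Let L6_eigen i : L6 (e i). Proof. by split; [exact: eigen_measurable|exact: eigen_L6]. Qed.

Let L6_comb a : L6 (comb a).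
Proof. by split; [exact: (eigen_comb_measurable he a)|exact: (eigen_comb_L6 he hd a)]. Qed.

Let L6_one : L6 (fun _ => 1).
Proof.
split; first exact: measurable_cst.
under eq_integral do rewrite expr1n.
by rewrite integral_cst// mul1e (le_lt_trans (probability_le1 _ _))// ltry.
Qed.

Let mulL6 (f g h : X -> R) : L6 f -> L6 g -> L6 h -> (fun x => f x * g x * h x) \in Lfun mu 2%:E.
Proof. by move=> [? ?] [? ?] [? ?]; exact: L6_mul_Lfun2. Qed.

Let inner_comb3 (a : 'I_N -> R) (f g : X -> R) i : L6 f -> L6 g ->
  inner (fun x => comb a x * f x * g x) (e i) =
  \sum_(j < N) a j * inner (fun x => e j x * f x * g x) (e i).
Proof.
move=> lf lg; rewrite -inner_lincombl; last 2 first.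
- by move=> j; exact: mulL6.
- exact: eigen_Lfun2 he i.
congr inner; apply/funext => x.
by rewrite /eigen_comb !mulr_suml; apply: eq_bigr => j _; ring.
Qed.

(** A class of real functions closed under the ring operations: it stands for
    the measurable functions of the sample point and for the continuous functions
    of the unknown, the two uses of the polynomial dependence of the residual on
    the coordinates. *)
Section polynomial_dependence.
Variables (Y : Type) (good : (Y -> R) -> Prop).
Hypothesis goodC : forall r : R, good (fun _ => r).
Hypothesis goodD : forall f g : Y -> R, good f -> good g -> good (fun y => f y + g y).
Hypothesis goodM : forall f g : Y -> R, good f -> good g -> good (fun y => f y * g y).

Let goodS n (f : 'I_n -> Y -> R) : (forall j, good (f j)) -> good (fun y => \sum_j f j y).
Proof.
move=> gf; elim: (index_enum _) => [|j r IH].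
  by rewrite (_ : (fun y => _) = fun=> 0)//; apply/funext => y; rewrite big_nil.
rewrite (_ : (fun y => _) = fun y => f j y + \sum_(j <- r) f j y); first exact: goodD.
by apply/funext => y; rewrite big_cons.
Qed.

Let good_inner3 (a b c : Y -> 'I_N -> R) i :
  (forall j, good (fun y => a y j)) -> (forall j, good (fun y => b y j)) ->
  (forall j, good (fun y => c y j)) ->
  good (fun y => inner (fun x => comb (a y) x * comb (b y) x * comb (c y) x) (e i)).
Proof.
move=> ga gb gc.
have L y : inner (fun x => comb (a y) x * comb (b y) x * comb (c y) x) (e i) =
   \sum_(j < N) a y j * \sum_(k < N) b y k * \sum_(l < N) c y l *
     inner (fun x => e l x * e k x * e j x) (e i).
  rewrite inner_comb3//; apply: eq_bigr => j _; congr (_ * _).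
  rewrite (_ : (fun x => _) = (fun x => comb (b y) x * comb (c y) x * e j x)); last first.
    by apply/funext => x; ring.
  rewrite inner_comb3//; apply: eq_bigr => k _; congr (_ * _).
  rewrite (_ : (fun x => _) = (fun x => comb (c y) x * e k x * e j x)); last first.
    by apply/funext => x; ring.
  by rewrite inner_comb3.
rewrite (_ : (fun y => _) = fun y => \sum_(j < N) a y j * \sum_(k < N) b y k * \sum_(l < N) c y l *
     inner (fun x => e l x * e k x * e j x) (e i)); last by apply/funext => y; exact: L.
apply: goodS => j; apply: (goodM (ga j)); apply: goodS => k; apply: (goodM (gb k)).
by apply: goodS => l; exact: (goodM (gc l) (goodC _)).
Qed.

Let good_inner2 (a b : Y -> 'I_N -> R) i :
  (forall j, good (fun y => a y j)) -> (forall j, good (fun y => b y j)) ->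
  good (fun y => inner (fun x => comb (a y) x * comb (b y) x * 1) (e i)).
Proof.
move=> ga gb.
have L y : inner (fun x => comb (a y) x * comb (b y) x * 1) (e i) =
   \sum_(j < N) a y j * \sum_(k < N) b y k *
     inner (fun x => e k x * 1 * e j x) (e i).
  rewrite inner_comb3//; apply: eq_bigr => j _; congr (_ * _).
  rewrite (_ : (fun x => _) = (fun x => comb (b y) x * 1 * e j x)); last first.
    by apply/funext => x; ring.
  by rewrite inner_comb3.
rewrite (_ : (fun y => _) = fun y => \sum_(j < N) a y j * \sum_(k < N) b y k *
     inner (fun x => e k x * 1 * e j x) (e i)); last by apply/funext => y; exact: L.
apply: goodS => j; apply: (goodM (ga j)); apply: goodS => k.
exact: (goodM (gb k) (goodC _)).
Qed.

Lemma nonlinearity_closed (a a' : Y -> 'I_N -> R) i :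
  (forall j, good (fun y => a y j)) -> (forall j, good (fun y => a' y j)) ->
  good (fun y => nonlinearity (a y) (a' y) i).
Proof.
move=> ga ga'.
have li := eigen_Lfun2 he i.
have l2 b b' : (fun x => comb b x * comb b' x * 1) \in Lfun mu 2%:E by exact: mulL6.
have l3 b b' b'' : (fun x => comb b x * comb b' x * comb b'' x) \in Lfun mu 2%:E by exact: mulL6.
have l1 b := eigen_comb_Lfun2 he (b : 'I_N -> R).
pose I3 b b' b'' := inner (fun x => comb b x * comb b' x * comb b'' x) (e i).
pose I2 b b' := inner (fun x => comb b x * comb b' x * 1) (e i).
have L y : nonlinearity (a y) (a' y) i =
   c3 / 4 * (I3 (a y) (a y) (a y) + I3 (a y) (a y) (a' y) + I3 (a y) (a' y) (a' y) + I3 (a' y) (a' y) (a' y)) +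
   c2 / 3 * (I2 (a y) (a y) + I2 (a y) (a' y) + I2 (a' y) (a' y)) +
   c1 / 2 * (a y i + a' y i) + inner (fun=> c0) (e i).
  rewrite /nonlinearity /cubic_avg -(inner_eigen_comb he (a y)) -(inner_eigen_comb he (a' y)).
  move: (a y) (a' y) => {a a' ga ga'} b b'.
  have E : (fun x : X => c3 / 4 * (comb b x * comb b x * comb b x + comb b x * comb b x * comb b' x +
      comb b x * comb b' x * comb b' x + comb b' x * comb b' x * comb b' x) +
      c2 / 3 * (comb b x * comb b x + comb b x * comb b' x + comb b' x * comb b' x) +
      c1 / 2 * (comb b x + comb b' x) + c0) =
    (fun x => c3 / 4 * (comb b x * comb b x * comb b x + comb b x * comb b x * comb b' x +
      comb b x * comb b' x * comb b' x + comb b' x * comb b' x * comb b' x) +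
      c2 / 3 * (comb b x * comb b x * 1 + comb b x * comb b' x * 1 + comb b' x * comb b' x * 1) +
      c1 / 2 * (comb b x + comb b' x) + c0).
    by apply/funext => x; ring.
  rewrite E.
  have m3 := Lfun2D (Lfun2D (Lfun2D (l3 b b b) (l3 b b b')) (l3 b b' b')) (l3 b' b' b').
  have m2 := Lfun2D (Lfun2D (l2 b b) (l2 b b')) (l2 b' b').
  have m1 := Lfun2D (l1 b) (l1 b').
  rewrite (innerDl (Lfun2D (Lfun2D (Lfun2Z (c3 / 4) m3) (Lfun2Z (c2 / 3) m2)) (Lfun2Z (c1 / 2) m1)) (Lfun2_cst c0) li).
  rewrite (innerDl (Lfun2D (Lfun2Z (c3 / 4) m3) (Lfun2Z (c2 / 3) m2)) (Lfun2Z (c1 / 2) m1) li).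
  rewrite (innerDl (Lfun2Z (c3 / 4) m3) (Lfun2Z (c2 / 3) m2) li).
  rewrite (innerZl _ m3 li) (innerZl _ m2 li) (innerZl _ m1 li).
  rewrite (innerDl (Lfun2D (Lfun2D (l3 b b b) (l3 b b b')) (l3 b b' b')) (l3 b' b' b') li).
  rewrite (innerDl (Lfun2D (l3 b b b) (l3 b b b')) (l3 b b' b') li) (innerDl (l3 b b b) (l3 b b b') li).
  rewrite (innerDl (Lfun2D (l2 b b) (l2 b b')) (l2 b' b') li) (innerDl (l2 b b) (l2 b b') li).
  by rewrite (innerDl (l1 b) (l1 b') li).
rewrite (funext L).
apply: goodD; last exact: goodC.
apply: goodD; last first.
  by apply: (goodM (goodC _)); apply: goodD; [exact: ga|exact: ga'].
apply: goodD; apply: (goodM (goodC _)).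
  by apply: goodD; [apply: goodD; [apply: goodD|]|]; exact: good_inner3.
by apply: goodD; [apply: goodD|]; exact: good_inner2.
Qed.

Lemma residual_closed h (a b a' : Y -> 'I_N -> R) i :
  (forall j, good (fun y => a y j)) -> (forall j, good (fun y => b y j)) ->
  (forall j, good (fun y => a' y j)) ->
  good (fun y => residual h (a y) (b y) (a' y) i).
Proof.
move=> ga gb ga'.
rewrite (_ : (fun y => _) = (fun y => (2 / h * (a' y i + -1 * a y i) + -2 * b y i +
  h * lam i / 2 * (a y i + a' y i)) + h * nonlinearity (a y) (a' y) i)); last first.
  by apply/funext => y; rewrite /residual /velocity; ring.
apply: goodD; last by apply: (goodM (goodC _)); exact: nonlinearity_closed.
apply: goodD; last by apply: (goodM (goodC _)); apply: goodD.
apply: goodD; last by exact: (goodM (goodC _)).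
by apply: (goodM (goodC _)); apply: goodD => //; exact: (goodM (goodC _)).
Qed.

Lemma velocity_closed h (a b a' : Y -> 'I_N -> R) i :
  (forall j, good (fun y => a y j)) -> (forall j, good (fun y => b y j)) ->
  (forall j, good (fun y => a' y j)) ->
  good (fun y => velocity h (a y) (b y) (a' y) i).
Proof.
move=> ga gb ga'.
rewrite (_ : (fun y => _) = (fun y => 2 / h * (a' y i + -1 * a y i) + -1 * b y i)); last first.
  by apply/funext => y; rewrite /velocity; ring.
apply: goodD; last by exact: (goodM (goodC _)).
by apply: (goodM (goodC _)); apply: goodD => //; exact: (goodM (goodC _)).
Qed.

Lemma energy_closed C (a b : Y -> 'I_N -> R) :
  (forall j, good (fun y => a y j)) -> (forall j, good (fun y => b y j)) ->
  good (fun y => energy C (a y) (b y)).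
Proof.
move=> ga gb.
(* As F s = cubic_avg 0 s * s, the potential energy is the pairing of the
   nonlinearity between 0 and al with al. *)
have L (al : 'I_N -> R) : \int[mu]_x (F (comb al x) + C) =
    \sum_i al i * nonlinearity (fun=> 0) al i + C.
  have icst : mu.-integrable setT (EFin \o (fun _ : X => C)).
    exact: finite_measure_integrable_cst.
  rewrite (RintegralD measurableT (quartic_comb_integrable he hd c3 c2 c1 c0 al) icst).
  rewrite Rintegral_cst//; have -> : fine (mu setT) = 1 by rewrite probability_setT.
  rewrite mulr1; congr (_ + _).
  transitivity (inner (comb al) (fun x => avg (comb (fun=> 0) x) (comb al x))).
    apply: eq_Rintegral => x _; rewrite quartic_factor mulrC.
    by rewrite (_ : comb (fun=> 0) x = 0)// /eigen_comb big1// => j _; rewrite mul0r.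
  rewrite (inner_eigen_combl he _ (cubic_avg_comb_Lfun2 he hd c3 c2 c1 c0 _ _)).
  by apply: eq_bigr => i _; rewrite innerC.
rewrite (_ : (fun y => _) = (fun y => 2^-1 * (\sum_i b y i * b y i) +
   2^-1 * (\sum_(i < N) lam i * (a y i * a y i)) + (\sum_i a y i * nonlinearity (fun=> 0) (a y) i + C))).
  apply: goodD; last first.
    apply: goodD => //; apply: goodS => i; apply: goodM => //.
    by apply: (nonlinearity_closed (a := fun _ _ => 0)).
  apply: goodD; apply: (goodM (goodC _)); apply: goodS => i; first exact: goodM.
  by apply: (goodM (goodC _)); exact: goodM.
by apply/funext => y; rewrite -L.
Qed.

End polynomial_dependence.

Variable h : R.
Hypothesis uniq_res : forall a b : 'I_N -> R, exists! a', forall i, residual h a b a' i = 0.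

Definition solver (a b : 'I_N -> R) : 'I_N -> R :=
  xget (fun=> 0) [set a' | forall i, residual h a b a' i = 0].

Lemma solverP a b : forall i, residual h a b (solver a b) i = 0.
Proof.
have [a' [ra' _]] := uniq_res a b.
by apply: (@xgetPex _ (fun=> 0) [set a' | forall i, residual h a b a' i = 0]); exists a'.
Qed.

Lemma solver_unique a b a' : (forall i, residual h a b a' i = 0) -> a' = solver a b.
Proof.
move=> ra'; have [a0 [r0 u0]] := uniq_res a b.
by rewrite -(u0 _ ra') -(u0 _ (solverP a b)).
Qed.

(** The sum of the squares of the residuals is measurable in the sample point,
    continuous in the unknown, and vanishes at the solution only. *)
Lemma measurable_solver (dO : measure_display) (Omega : measurableType dO)
    (a b : Omega -> 'I_N -> R) :
  (forall j, measurable_fun setT (fun w => a w j)) ->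
  (forall j, measurable_fun setT (fun w => b w j)) ->
  forall i, measurable_fun setT (fun w => solver (a w) (b w) i).
Proof.
move=> ma mb i.
pose E w (z : 'rV[R]_N) := \sum_i residual h (a w) (b w) (fun j => z ord0 j) i ^+ 2.
pose S w : 'rV[R]_N := \row_j solver (a w) (b w) j.
have -> : (fun w => solver (a w) (b w) i) = (fun w => S w ord0 i).
  by apply/funext => w; rewrite /S mxE.
apply: (@measurable_implicit_function _ _ _ _ E).
- move=> z; apply: measurable_sum => j; apply: measurable_funX.
  apply: (@residual_closed Omega (fun f => measurable_fun setT f)) => //.
  + by move=> f g mf mg; exact: measurable_funD.
  + by move=> f g mf mg; exact: measurable_funM.
- move=> w.
  have cc (j : 'I_N) : continuous (fun z : 'rV[R]_N => z ord0 j) by move=> z; exact: coord_continuous.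
  have cr j : continuous (fun z : 'rV[R]_N => residual h (a w) (b w) (fun j => z ord0 j) j).
    apply: (@residual_closed 'rV[R]_N (fun f => continuous f) _ _ _ h (fun=> a w) (fun=> b w) (fun z j => z ord0 j)).
    + by move=> r; exact: cst_continuous.
    + move=> f g cf cg z.
      have h1 : f y @[y --> z] --> f z by apply: cf.
      have h2 : g y @[y --> z] --> g z by apply: cg.
      exact: (cvgD h1 h2).
    + move=> f g cf cg z.
      have h1 : f y @[y --> z] --> f z by apply: cf.
      have h2 : g y @[y --> z] --> g z by apply: cg.
      exact: (cvgM h1 h2).
    + by move=> k; exact: cst_continuous.
    + by move=> k; exact: cst_continuous.
    + exact: cc.
  rewrite /E; elim: (index_enum _) => [|k r IH].
    rewrite (_ : (fun z => _) = fun=> 0); first exact: cst_continuous.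
    by apply/funext => z; rewrite big_nil.
  pose rk (z : 'rV[R]_N) := residual h (a w) (b w) (fun j => z ord0 j) k.
  rewrite (_ : (fun z => _) = (fun z : 'rV[R]_N => rk z * rk z +
    \sum_(i <- r) residual h (a w) (b w) (fun j => z ord0 j) i ^+ 2)); last first.
    by apply/funext => z; rewrite big_cons expr2.
  move=> z; have h1 : rk y @[y --> z] --> rk z by apply: cr.
  have h2 := IH z.
  exact: (cvgD (cvgM h1 h1) h2).
- by move=> w z; apply: sumr_ge0 => k _; exact: sqr_ge0.
move=> w z; split=> [|->].
  move=> /psumr_eq0P H; apply/rowP => j; rewrite mxE.
  rewrite -(@solver_unique (a w) (b w) (fun j => z ord0 j))// => k.
  by apply/eqP; rewrite -sqrf_eq0; apply/eqP; apply: H => // l _; exact: sqr_ge0.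
rewrite /E big1// => k _.
rewrite (_ : (fun j => S w ord0 j) = solver (a w) (b w)); last by apply/funext => j; rewrite mxE.
by rewrite solverP expr0n.
Qed.

End solver.

(** * Exponential moments of Gaussian variables *)

Section gaussian_moments.
Context {R : realType}.

(** The density of the normal law is almost everywhere its Radon-Nikodym
    derivative, which allows the change of measure. *)
Lemma ge0_integral_normal (s : R) (f : R -> \bar R) :
  measurable_fun setT f -> (forall x, (0 <= f x)%E) ->
  (\int[normal_prob 0 s]_x f x = \int[lebesgue_measure]_x (f x * (normal_pdf 0 s x)%:E))%E.
Proof.
move=> mf f0.
have dom := @normal_prob_dominates R 0 s.
rewrite -(Radon_Nikodym_SigmaFinite.change_of_variables dom f0 measurableT mf).
have iRN := Radon_Nikodym_SigmaFinite.f_integrable dom.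
have mpdf : measurable_fun setT (fun x => (normal_pdf 0 s x)%:E).
  by apply/measurable_EFinP; exact: measurable_normal_pdf.
have mRN := measurable_int _ iRN.
apply: ae_eq_integral => //; try exact: emeasurable_funM.
have H := integral_ae_eq measurableT iRN mpdf.
apply: filterS (H _) => [x /= Hx xT|E _ mE]; first by rewrite Hx.
by rewrite -Radon_Nikodym_SigmaFinite.f_integral.
Qed.

(** Completing the square turns the weighted density into the normal density of
    mean th s^2, whose integral is 1. *)
Lemma normal_exp_linear (s th : R) : s != 0 ->
  (\int[normal_prob 0 s]_x (expR (th * x))%:E = (expR (th ^+ 2 * s ^+ 2 / 2))%:E)%E.
Proof.
move=> s0; rewrite ge0_integral_normal; last 2 first.
- by apply/measurable_EFinP; apply: measurableT_comp => //; exact: measurable_funM.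
- by move=> x; rewrite lee_fin expR_ge0.
transitivity (\int[lebesgue_measure]_x ((expR (th ^+ 2 * s ^+ 2 / 2))%:E *
   (normal_pdf (th * s ^+ 2) s x)%:E))%E.
  apply: eq_integral => x _; rewrite -!EFinM; congr EFin.
  rewrite !normal_pdfE// /normal_fun.
  rewrite mulrCA [RHS]mulrCA; congr (_ * _).
  rewrite -!expRD; congr expR.
  by field.
rewrite ge0_integralZl//.
- by rewrite integral_normal_pdf mule1.
- by apply/measurable_EFinP; exact: measurable_normal_pdf.
- by move=> x _; rewrite lee_fin normal_pdf_ge0.
Qed.

(** After squaring, this is 1 <= q exp(2 (1 - q)); for q >= 1/2 it follows from
    exp x >= 1 + x. *)
Lemma inv_sqrt_le_exp (q : R) : 2^-1 <= q -> q <= 1 -> (Num.sqrt q)^-1 <= expR (1 - q).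
Proof.
move=> q2 q1; have q0 : 0 < q by apply: lt_le_trans q2.
have e2 : 1 <= q * expR (1 - q) ^+ 2.
  rewrite -expRM_natl -[expR _]/(expR (2%:R * (1 - q))).
  have := expR_ge1Dx (2 * (1 - q)) => H.
  apply: (@le_trans _ _ (q * (1 + 2 * (1 - q)))); last by rewrite ler_pM2l.
  rewrite -subr_ge0.
  have -> : q * (1 + 2 * (1 - q)) - 1 = (1 - q) * (2 * (q - 2^-1)) by field.
  by rewrite mulr_ge0 ?subr_ge0// mulr_ge0// subr_ge0.
rewrite -[X in X <= _]mul1r ler_pdivrMr ?sqrtr_gt0//.
rewrite -(@ler_pXn2r _ 2)// ?nnegrE ?mulr_ge0 ?expR_ge0 ?sqrtr_ge0//.
by rewrite expr1n exprMn sqr_sqrtr ?(ltW q0)// mulrC.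
Qed.

(** With q = 1 - 2 gam s^2, the weighted density is q^(-1/2) times the normal
    density of variance s^2 / q. *)
Lemma normal_exp_square (s gam : R) : s != 0 -> 0 <= gam -> 4 * gam * s ^+ 2 <= 1 ->
  (\int[normal_prob 0 s]_x (expR (gam * x ^+ 2))%:E <= (expR (2 * gam * s ^+ 2))%:E)%E.
Proof.
move=> s0 g0 gs; rewrite ge0_integral_normal; last 2 first.
- apply/measurable_EFinP; apply: measurableT_comp => //; apply: measurable_funM => //.
- by move=> x; rewrite lee_fin expR_ge0.
pose q := 1 - 2 * gam * s ^+ 2.
have s2 : 0 < s ^+ 2 by rewrite exprn_even_gt0.
have gs0 : 0 <= gam * s ^+ 2 by rewrite mulr_ge0// ltW.
have q2 : 2^-1 <= q by rewrite /q; lra.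
have q1 : q <= 1 by rewrite /q; lra.
have q0 : 0 < q by apply: lt_le_trans q2.
have sq0 : 0 < Num.sqrt q by rewrite sqrtr_gt0.
pose s' := s / Num.sqrt q.
have s'0 : s' != 0 by rewrite mulf_neq0// invr_neq0// gt_eqF.
have s'2 : s' ^+ 2 = s ^+ 2 / q by rewrite /s' expr_div_n sqr_sqrtr// ltW.
have peakE : normal_peak s = (Num.sqrt q)^-1 * normal_peak s'.
  rewrite /normal_peak s'2 -invfM; congr (_^-1).
  rewrite -sqrtrM ?(ltW q0)//; congr Num.sqrt.
  by field; rewrite gt_eqF.
have -> : (\int[lebesgue_measure]_x ((expR (gam * x ^+ 2))%:E * (normal_pdf 0 s x)%:E) =
   \int[lebesgue_measure]_x (((Num.sqrt q)^-1)%:E * (normal_pdf 0 s' x)%:E))%E.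
  apply: eq_integral => x _; rewrite -!EFinM; congr EFin.
  rewrite !normal_pdfE// /normal_fun s'2 peakE.
  rewrite -[X in _ = _ * (_ * X)](_ : expR (gam * x ^+ 2) * expR (- (x - 0) ^+ 2 / (s ^+ 2 *+ 2)) = _).
    by ring.
  rewrite -expRD; congr expR.
  by move: (gt_eqF q0); rewrite /q => qn; field; rewrite s0 qn.
rewrite ge0_integralZl//.
- rewrite integral_normal_pdf mule1 lee_fin.
  apply: le_trans (inv_sqrt_le_exp q2 q1) _.
  by rewrite ler_expR /q; lra.
- by apply/measurable_EFinP; exact: measurable_normal_pdf.
- by move=> x _; rewrite lee_fin normal_pdf_ge0.
Qed.

Context {dO : measure_display} {Omega : measurableType dO} (P : probability Omega R).
Variables (Y : Omega -> R) (s2 : R).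
Hypothesis mY : measurable_fun setT Y.
Hypothesis s20 : 0 <= s2.
Hypothesis lawY : forall B : set R, measurable B -> P (Y @^-1` B) = centered_gaussian s2 B.

Lemma integral_gaussian (f : R -> \bar R) :
  measurable_fun setT f -> (forall x, (0 <= f x)%E) ->
  (\int[P]_w f (Y w) = if (s2 == 0)%R then f 0%R else \int[normal_prob 0 (Num.sqrt s2)]_x f x)%E.
Proof.
move=> mf f0.
have -> : (\int[P]_w f (Y w) = \int[pushforward P (Y : Omega -> measurableTypeR R)]_x f x)%E.
  by rewrite ge0_integral_pushforward.
case: ifPn => [/eqP|] s2E.
  transitivity (\int[\d_(0%R : measurableTypeR R)]_x f x)%E.
    apply: eq_measure_integral => A mA _.
    by have := lawY mA; rewrite /centered_gaussian s2E eqxx.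
  by rewrite integral_dirac// diracT mul1e.
apply: (@eq_measure_integral _ _ _ _ (normal_prob 0 (Num.sqrt s2))) => A mA _.
by have := lawY mA; rewrite /centered_gaussian (negbTE s2E).
Qed.

Lemma gaussian_exp_linear (th : R) :
  (\int[P]_w (expR (th * Y w))%:E <= (expR (th ^+ 2 * s2 / 2))%:E)%E.
Proof.
rewrite (integral_gaussian (f := fun x => (expR (th * x))%:E)); last 2 first.
- by apply/measurable_EFinP; apply: measurableT_comp => //; exact: measurable_funM.
- by move=> x; rewrite lee_fin expR_ge0.
case: ifPn => [/eqP ->|s2n]; first by rewrite !mulr0 mul0r.
by rewrite normal_exp_linear ?sqr_sqrtr// sqrtr_eq0 -ltNge lt_neqAle eq_sym s2n.
Qed.

Lemma gaussian_exp_square (gam : R) : 0 <= gam -> 4 * gam * s2 <= 1 ->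
  (\int[P]_w (expR (gam * Y w ^+ 2))%:E <= (expR (2 * gam * s2))%:E)%E.
Proof.
move=> g0 gs.
rewrite (integral_gaussian (f := fun x => (expR (gam * x ^+ 2))%:E)); last 2 first.
- by apply/measurable_EFinP; apply: measurableT_comp => //; exact: measurable_funM.
- by move=> x; rewrite lee_fin expR_ge0.
case: ifPn => [/eqP ->|s2n]; first by rewrite expr0n !mulr0.
have := @normal_exp_square (Num.sqrt s2) gam; rewrite sqr_sqrtr//; apply => //.
by rewrite sqrtr_eq0 -ltNge lt_neqAle eq_sym s2n.
Qed.

End gaussian_moments.

(** * Gaussian vectors and independence *)

Section gaussian_vectors.
Context {R : realType}.

(** The graph of the exponential lies above its tangent at the mean m. *)
Lemma expR_jensen n (p x : 'I_n -> R) : (forall i, 0 <= p i) -> \sum_i p i = 1 ->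
  expR (\sum_i p i * x i) <= \sum_i p i * expR (x i).
Proof.
move=> p0 p1; set m := \sum_i p i * x i.
have -> : expR m = \sum_i p i * (expR m * (1 + (x i - m))).
  transitivity (expR m * \sum_i (p i + (p i * x i - m * p i))).
    rewrite big_split/= sumrB -mulr_sumr p1 -/m; ring.
  by rewrite mulr_sumr; apply: eq_bigr => i _; ring.
apply: ler_sum => i _; rewrite ler_wpM2l//.
have -> : expR (x i) = expR m * expR (x i - m) by rewrite -expRD; congr expR; ring.
by rewrite ler_pM2l ?expR_gt0// expR_ge1Dx.
Qed.

(** Young's inequality with a weight l: for the l that balances the integrals of
    the two terms, it gives the same bound as Cauchy-Schwarz. *)
Lemma expR_young (l x y : R) :
  expR (x + y) <= 2^-1 * (expR (l + 2 * x) + expR (2 * y - l)).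
Proof.
have -> : expR (x + y) = expR (l / 2 + x) * expR (y - l / 2).
  by rewrite -expRD; congr expR; ring.
have -> : expR (l + 2 * x) = expR (l / 2 + x) ^+ 2.
  by rewrite expr2 -expRD; congr expR; field.
have -> : expR (2 * y - l) = expR (y - l / 2) ^+ 2.
  by rewrite expr2 -expRD; congr expR; field.
move: (expR _) (expR (y - _)) => a b.
by have := sqr_ge0 (a - b); rewrite sqrrB; lra.
Qed.

Context {dO : measure_display} {Omega : measurableType dO} (P : probability Omega R).
Variables (n : nat) (xi : 'I_n -> Omega -> R) (q : 'I_n -> R) (h : R).
Hypothesis n0 : (0 < n)%N.
Hypothesis h0 : 0 < h.
Hypothesis q0 : forall i, 0 < q i.
Hypothesis mxi : forall i, measurable_fun setT (xi i).
Hypothesis law_xi : forall i (B : set R), measurable B ->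
  P (xi i @^-1` B) = centered_gaussian (h * q i) B.

Let mexp (f : Omega -> R) : measurable_fun setT f -> measurable_fun setT (fun w => (expR (f w))%:E).
Proof. by move=> mf; apply/measurable_EFinP; apply: measurableT_comp. Qed.

Let exp0 (x : R) : (0 <= (expR x)%:E)%E. Proof. by rewrite lee_fin expR_ge0. Qed.

(** The coordinates need not be independent: Jensen's inequality with the weights
    q i / Q reduces the claim to single coordinates, which then all satisfy the
    same bound.  The dimension n enters through the bound tau on the trace
    only. *)
Lemma gaussian_vector_exp_square (b tau : R) : 0 <= b -> \sum_i q i <= tau ->
  4 * b * h * tau <= 1 ->
  (\int[P]_w (expR (b * \sum_i xi i w ^+ 2))%:E <= (expR (2 * b * h * tau))%:E)%E.
Proof.
move=> b0 qtau bh; set Q := \sum_i q i in qtau.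
have Q0 : 0 < Q.
  rewrite /Q (bigD1 (Ordinal n0))//= ltr_pwDl// sumr_ge0// => i _; exact: ltW.
pose p i := q i / Q.
have p0 i : 0 < p i by rewrite divr_gt0.
have p1 : \sum_i p i = 1 by rewrite -mulr_suml divff// gt_eqF.
have msq i : measurable_fun setT (fun w => b / p i * xi i w ^+ 2).
  by apply: measurable_funM => //; apply: measurable_funX.
apply: (@le_trans _ _ (\int[P]_w (\sum_i (p i)%:E * (expR (b / p i * xi i w ^+ 2))%:E))%E).
  apply: ge0_le_integral => //.
  - apply: mexp; apply: measurable_funM => //; apply: measurable_sum => i.
    exact: measurable_funX.
  - apply: emeasurable_sum => i _; apply: emeasurable_funM => //.
    exact: mexp.
  - move=> w _; rewrite (eq_bigr (fun i => (p i * expR (b / p i * xi i w ^+ 2))%:E))//.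
    rewrite sumEFin lee_fin.
    apply: (le_trans _ (@expR_jensen _ p (fun i => b / p i * xi i w ^+ 2) (fun i => ltW (p0 i)) p1)).
    rewrite ler_expR mulr_sumr le_eqVlt; apply/orP; left; apply/eqP.
    by apply: eq_bigr => i _; field; rewrite gt_eqF.
rewrite ge0_integral_sum//; last 2 first.
- by move=> i; apply: emeasurable_funM => //; exact: mexp.
- by move=> i w _; rewrite mule_ge0// lee_fin ltW.
have H i : (\int[P]_w ((p i)%:E * (expR (b / p i * xi i w ^+ 2))%:E) <=
   (p i * expR (2 * b * h * Q))%:E)%E.
  rewrite ge0_integralZl//; [|exact: mexp|by rewrite lee_fin ltW].
  rewrite [X in (_ <= X)%E]EFinM; apply: lee_wpmul2l; first by rewrite lee_fin ltW.
  have E k : k * (b / p i) * (h * q i) = k * b * h * Q.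
    by rewrite /p; field; rewrite !gt_eqF.
  rewrite -(E 2); apply: gaussian_exp_square => //.
  - by rewrite ltW// mulr_gt0.
  - exact: law_xi.
  - by rewrite divr_ge0// ltW.
  rewrite E; apply: le_trans bh; rewrite ler_wpM2l// !mulr_ge0//.
  exact: ltW.
apply: (@le_trans _ _ (\sum_i (p i * expR (2 * b * h * Q))%:E)%E).
  exact: lee_sum.
rewrite sumEFin -mulr_suml p1 mul1r lee_fin ler_expR.
by rewrite ler_wpM2l// !mulr_ge0// ltW.
Qed.

(** The linear form has variance at most h K |v|^2 and the quadratic one is
    controlled by tau; neither constant depends on the dimension. *)
Lemma gaussian_vector_exp (b tau K kap : R) (v : 'I_n -> R) : 0 <= b -> \sum_i q i <= tau ->
  4 * b * h * tau <= 1 -> 0 <= kap -> kap <= K * \sum_i v i ^+ 2 ->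
  (forall B : set R, measurable B ->
     P ((fun w => \sum_i v i * xi i w) @^-1` B) = centered_gaussian (h * kap) B) ->
  (\int[P]_w (expR (b * (\sum_i v i * xi i w) + b / 2 * \sum_i xi i w ^+ 2))%:E <=
   (expR (b ^+ 2 * h * K * (\sum_i v i ^+ 2) + b * h * tau))%:E)%E.
Proof.
move=> b0 qtau bh kap0 kapK lawv.
have mlin : measurable_fun setT (fun w => \sum_i v i * xi i w).
  by apply: measurable_sum => i; apply: measurable_funM.
have msq : measurable_fun setT (fun w => \sum_i xi i w ^+ 2).
  by apply: measurable_sum => i; exact: measurable_funX.
set V := b ^+ 2 * h * K * _; set Z := b * h * tau.
(* This weight bounds the integral of either term by the same exp (V + Z). *)
pose l := Z - V.
have mf1 : measurable_fun setT (fun w => (expR (2 * b * \sum_i v i * xi i w))%:E).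
  by apply: mexp; apply: measurable_funM.
have mf2 : measurable_fun setT (fun w => (expR (b * \sum_i xi i w ^+ 2))%:E).
  by apply: mexp; apply: measurable_funM.
have c1 : (0 <= (2^-1 * expR l)%:E)%E by rewrite lee_fin mulr_ge0 ?expR_ge0.
have c2 : (0 <= (2^-1 * expR (- l))%:E)%E by rewrite lee_fin mulr_ge0 ?expR_ge0.
apply: (@le_trans _ _ (\int[P]_w ((2^-1 * expR l)%:E * (expR (2 * b * \sum_i v i * xi i w))%:E +
   (2^-1 * expR (- l))%:E * (expR (b * \sum_i xi i w ^+ 2))%:E))%E).
  apply: ge0_le_integral => //.
  - apply: mexp; apply: measurable_funD; apply: measurable_funM => //.
  - by apply: emeasurable_funD; apply: emeasurable_funM.
  - move=> w _; rewrite -!EFinM -EFinD lee_fin.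
    apply: (le_trans (expR_young l _ _)).
    set s1 := \sum_i _; set s2 := \sum_i _.
    have -> : 2 * b * s1 = (l + 2 * (b * s1)) - l by ring.
    have -> : b * s2 = (2 * (b / 2 * s2) - l) - - l by field.
    have -> : 2^-1 * expR l * expR (l + 2 * (b * s1) - l) = 2^-1 * expR (l + 2 * (b * s1)).
      by rewrite -mulrA -expRD; congr (_ * expR _); ring.
    have -> : 2^-1 * expR (- l) * expR (2 * (b / 2 * s2) - l - - l) =
        2^-1 * expR (2 * (b / 2 * s2) - l).
      by rewrite -mulrA -expRD; congr (_ * expR _); ring.
    by rewrite mulrDr.
have p1 w : (0 <= (2^-1 * expR l)%:E * (expR (2 * b * \sum_i v i * xi i w))%:E)%E by rewrite mule_ge0.
have p2 w : (0 <= (2^-1 * expR (- l))%:E * (expR (b * \sum_i xi i w ^+ 2))%:E)%E by rewrite mule_ge0.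
rewrite (ge0_integralD P measurableT (fun w _ => p1 w) _ (fun w _ => p2 w)); last 2 first.
- exact: emeasurable_funM.
- exact: emeasurable_funM.
rewrite (ge0_integralZl P measurableT mf1)// (ge0_integralZl P measurableT mf2)//.
have E1 : (\int[P]_w (expR (2 * b * \sum_i v i * xi i w))%:E <= (expR (2 * V))%:E)%E.
  have hk0 : 0 <= h * kap by rewrite mulr_ge0// ltW.
  apply: (le_trans (gaussian_exp_linear mlin hk0 lawv (2 * b))).
  rewrite lee_fin ler_expR.
  have -> : (2 * b) ^+ 2 * (h * kap) / 2 = 2 * (b ^+ 2 * h) * kap by field.
  have -> : 2 * V = 2 * (b ^+ 2 * h) * (K * \sum_i v i ^+ 2) by rewrite /V; ring.
  by rewrite ler_wpM2l// mulr_ge0// mulr_ge0 ?sqr_ge0// ltW.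
have E2 : (\int[P]_w (expR (b * \sum_i xi i w ^+ 2))%:E <= (expR (2 * Z))%:E)%E.
  apply: (le_trans (gaussian_vector_exp_square b0 qtau bh)).
  by rewrite lee_fin ler_expR /Z le_eqVlt; apply/orP; left; apply/eqP; ring.
apply: (le_trans (leeD (lee_wpmul2l c1 E1) (lee_wpmul2l c2 E2))).
rewrite -!EFinM -EFinD lee_fin -!mulrA -mulrDr -!expRD.
have -> : l + 2 * V = V + Z by rewrite /l; ring.
have -> : - l + 2 * Z = V + Z by rewrite /l; ring.
by rewrite le_eqVlt; apply/orP; left; apply/eqP; field.
Qed.

End gaussian_vectors.

Section freezing.
Context {R : realType} {dO : measure_display} {Omega : measurableType dO}.
Variables (P : probability Omega R) (G1 G2 : set_system Omega).
Hypothesis G1m : G1 `<=` measurable.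
Hypothesis G2m : G2 `<=` measurable.
Hypothesis sG1 : sigma_algebra setT G1.
Hypothesis sG2 : sigma_algebra setT G2.
Hypothesis indep : independent_systems P G1 G2.

Let O1 := g_sigma_algebraType G1.
Let O2 := g_sigma_algebraType G2.

Let measurable_O1 (A : set Omega) : measurable (A : set O1) -> G1 A.
Proof. by move=> mA; have := sigma_algebra_id sG1 => <-. Qed.

Let measurable_O2 (A : set Omega) : measurable (A : set O2) -> G2 A.
Proof. by move=> mA; have := sigma_algebra_id sG2 => <-. Qed.

Let id1 (w : Omega) : O1 := w.
Let id2 (w : Omega) : O2 := w.
Let diag (w : Omega) : (O1 * O2)%type := (id1 w, id2 w).

Let mid1 : measurable_fun setT id1.
Proof. by move=> _ A mA; rewrite setTI; apply: G1m; exact: measurable_O1. Qed.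

Let mid2 : measurable_fun setT id2.
Proof. by move=> _ A mA; rewrite setTI; apply: G2m; exact: measurable_O2. Qed.

Let mdiag : measurable_fun setT diag.
Proof. exact: measurable_fun_pair. Qed.

HB.instance Definition _ := isMeasurableFun.Build _ _ _ _ id1 mid1.
HB.instance Definition _ := isMeasurableFun.Build _ _ _ _ id2 mid2.
HB.instance Definition _ := isMeasurableFun.Build _ _ _ _ diag mdiag.

(** The diagonal map into the product of the two sub-sigma-algebras has the product
    law, by independence and uniqueness of the product measure; Tonelli's theorem
    then freezes the first argument. *)
Lemma independent_integral (f : (O1 * O2)%type -> \bar R) :
  measurable_fun setT f -> (forall x, (0 <= f x)%E) ->
  (\int[P]_w f (w, w) = \int[P]_w \int[P]_w' f (w, w'))%E.
Proof.
move=> mf f0.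
pose P1 := distribution P id1; pose P2 := distribution P id2.
pose Pd := distribution P diag.
have PE A : measurable A -> (P1 \x P2)%E A = Pd A.
  apply: product_measure_unique => A1 A2 mA1 mA2.
  exact: indep (measurable_O1 mA1) (measurable_O2 mA2).
have -> : (\int[P]_w f (w, w) = \int[Pd]_z f z)%E.
  by rewrite ge0_integral_distribution.
have -> : (\int[Pd]_z f z = \int[(P1 \x P2)%E]_z f z)%E.
  by apply: eq_measure_integral => A mA _; exact/esym/PE.
rewrite fubini_tonelli1//.
have mF := measurable_fun_fubini_tonelli_F (m2 := P2) f mf f0.
rewrite ge0_integral_distribution//; last by move=> x; apply: integral_ge0.
apply: eq_integral => w _; rewrite /= /fubini_F.
rewrite ge0_integral_distribution//.
exact: (measurableT_comp mf (pair1_measurable _)).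
Qed.

End freezing.

(** * Comparison of integrals, Bessel's inequality and covariance bounds *)

Section bounds.
Context {R : realType}.

(** The integral of a nonnegative function is the supremum of the integrals of
    the simple functions below it, hence is monotone without measurability of the
    smaller function; the solutions of the scheme are only given almost surely,
    so that the integrand of the theorem need not be measurable. *)
Lemma ae_ge0_le_integral_lower {dO : measure_display} {T : measurableType dO}
    (P : {measure set T -> \bar R}) (f g : T -> \bar R) :
  (forall x, (0 <= f x)%E) -> (forall x, (0 <= g x)%E) -> measurable_fun setT g ->
  {ae P, forall x, (f x <= g x)%E} -> (\int[P]_x f x <= \int[P]_x g x)%E.
Proof.
move=> f0 g0 mg [A [mA PA fA]].
pose g' x := (if x \in A then +oo else g x)%E.
have mg' : measurable_fun setT g'.
  apply: measurable_fun_ifT => //; apply: (@measurable_fun_bool _ _ _ _ true).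
  by rewrite setTI (_ : _ @^-1` _ = A)//; apply/seteqP; split=> x /= => [/set_mem|/mem_set].
have -> : (\int[P]_x g x = \int[P]_x g' x)%E.
  apply: ae_eq_integral => //; exists A; split => // x /= H; apply: contrapT => xA.
  by apply: H => _; rewrite /g' memNset.
have fg' x : (f x <= g' x)%E.
  rewrite /g'; case: ifPn => [_|/negP xA]; first by rewrite leey.
  apply: contrapT => fx; apply: xA; rewrite inE; exact: fA.
have g'0 x : (0 <= g' x)%E by apply: le_trans (fg' x).
rewrite !ge0_integralTE//; apply: ereal_sup_le => _ /= [s sf <-].
by exists s => // x; apply: le_trans (fg' x).
Qed.

Context {d : nat}.
Local Notation X := 'rV[R]_d.
Local Notation mu := (@cube_measure R d).

Lemma norm6_ae (f g : X -> R) : measurable_fun setT f -> measurable_fun setT g ->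
  f = g %[ae mu] -> norm6 f = norm6 g.
Proof.
move=> mf mg fg; rewrite /norm6 unlock; congr (_ `^ _)%E.
have m6 (k : X -> R) : measurable_fun setT k ->
    measurable_fun setT (fun x => `|(EFin \o k) x| `^ 6)%E.
  move=> mk; rewrite (_ : (fun x => _) = EFin \o (fun x => (`|k x| `^ 6)%R))//.
  apply/measurable_EFinP; apply: (measurableT_comp (measurable_powR _)).
  exact: measurableT_comp.
apply: ae_eq_integral => //; [exact: m6|exact: m6|].
by apply: filterS fg => x /= H xT; rewrite H.
Qed.

Variables (lam : nat -> R) (e : nat -> X -> R).
Hypothesis he : dirichlet_eigenbasis lam e.

(** The square norm of u minus its projection is nonnegative. *)
Lemma eigen_bessel n (u : X -> R) : u \in Lfun mu 2%:E ->
  \sum_(i < n) inner u (e i) ^+ 2 <= inner u u.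
Proof.
move=> lu; pose a (i : 'I_n) := inner u (e i).
have la := eigen_comb_Lfun2 he a.
have lau : inner (eigen_comb e a) u = \sum_i a i ^+ 2.
  rewrite (inner_eigen_combl he _ lu); apply: eq_bigr => i _.
  by rewrite /a (innerC (e i)) expr2.
have := inner_ge0 (fun x => -1 * eigen_comb e a x + u x).
rewrite inner_lin_sqr// lau (inner_eigen_comb2 he).
under eq_bigr do rewrite -expr2.
by rewrite sqrrN expr1n mul1r => H; rewrite -subr_ge0; apply: le_trans H _; lra.
Qed.

Lemma operator_form_le (Q : (X -> R) -> X -> R) : bounded_operator Q ->
  exists2 K, 0 <= K & forall z, z \in Lfun mu 2%:E -> inner (Q z) z <= K * inner z z.
Proof.
move=> [QL2 _ [K0 HK]]; exists (Num.max K0 0); first by rewrite le_max lexx orbT.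
move=> z lz; have lQz := QL2 _ lz.
have := HK _ lz; rewrite !norm2E// -EFinM lee_fin => H.
apply: le_trans (ler_norm _) _; apply: le_trans (inner_CS_sqrt lQz lz) _.
apply: (@le_trans _ _ (K0 * Num.sqrt (inner z z) * Num.sqrt (inner z z))).
  by rewrite ler_wpM2r// sqrtr_ge0.
rewrite -mulrA -expr2 sqr_sqrtr ?inner_ge0// ler_wpM2r ?inner_ge0//.
by rewrite le_max lexx.
Qed.

Lemma posdef_form_ge0 (Q : (X -> R) -> X -> R) : bounded_operator Q ->
  posdef_operator Q -> forall z, z \in Lfun mu 2%:E -> 0 <= inner (Q z) z.
Proof.
move=> bQ pQ z lz; have [z0|z0] := pselect (z = cst 0 %[ae mu]); last exact: ltW (pQ _ lz z0).
have lQz := op_L2 bQ lz.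
rewrite innerC (ae_eq_inner z0) ?inner0l//; exact: Lfun2_measurable.
Qed.

Lemma posdef_eigen_gt0 (Q : (X -> R) -> X -> R) i : posdef_operator Q ->
  0 < inner (Q (e i)) (e i).
Proof.
move=> pQ; apply: pQ; first exact: eigen_Lfun2 he i.
move=> e0; have := eigen_orthonormal he i i; rewrite eqxx.
have me := Lfun2_measurable (eigen_Lfun2 he i).
rewrite (ae_eq_inner e0)// inner0l => /eqP.
by rewrite eq_sym oner_eq0.
Qed.

Lemma nneseries_partial_le (t : nat -> R) : (forall i, 0 <= t i) ->
  (\sum_(0 <= i <oo) (t i)%:E < +oo)%E ->
  exists2 B, 0 <= B & forall n, \sum_(i < n) t i <= B.
Proof.
move=> t0 H.
have t0' i : (0 <= (t i)%:E)%E by rewrite lee_fin.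
have S0 : (0 <= \sum_(0 <= i <oo) (t i)%:E)%E by apply: nneseries_ge0.
exists (fine (\sum_(0 <= i <oo) (t i)%:E)%E); first exact: fine_ge0.
move=> n; rewrite -lee_fin fineK ?ge0_fin_numE// -sumEFin.
rewrite -(big_mkord xpredT (fun i => (t i)%:E)).
by apply: nneseries_lim_ge.
Qed.

End bounds.

(** * Exponential moments of the energy along the scheme *)

Section sub_sigma_algebras.
Context {R : realType} {dO : measure_display} {Omega : measurableType dO}.
Implicit Types (G : set_system Omega) (f : Omega -> R).

Definition measurable_wrt G f :=
  measurable_fun setT (f : g_sigma_algebraType G -> R).

Lemma measurable_wrt_sub G G' f : G `<=` <<s G' >> -> measurable_wrt G f -> measurable_wrt G' f.
Proof.
move=> GG' mf _ B mB; have := mf measurableT B mB.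
rewrite !setTI; apply: smallest_sub => //; exact: smallest_sigma_algebra.
Qed.

Lemma measurable_wrt_ambient G f : G `<=` measurable -> measurable_wrt G f ->
  measurable_fun setT f.
Proof.
move=> GG' mf _ B mB; have := mf measurableT B mB.
rewrite !setTI; apply: smallest_sub => //; exact: sigma_algebra_measurable.
Qed.

End sub_sigma_algebras.

Section splitting_process.
Context {R : realType} {d : nat}.
Local Notation X := 'rV[R]_d.
Local Notation mu := (@cube_measure R d).
Variables (lam : nat -> R) (e : nat -> X -> R).
Hypothesis he : dirichlet_eigenbasis lam e.
Hypothesis hd : d = 1%N \/ d = 2%N.
Variables c3 c2 c1 c0 : R.
Variables N M : nat.
Hypothesis N0 : (0 < N)%N.
Variables T h : R.
Hypothesis h0 : 0 < h.
Hypothesis Mh : M%:R * h = T.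
Local Notation comb := (@eigen_comb R d e N).
Local Notation residual := (residual lam e c3 c2 c1 c0).
Local Notation solver := (solver lam e c3 c2 c1 c0 h).
Local Notation energy := (energy lam e c3 c2 c1 c0).
Hypothesis uniq_res : forall a b : 'I_N -> R, exists! a', forall i, residual h a b a' i = 0.
Context {dO : measure_display} {Omega : measurableType dO}.
Variables (P : probability Omega R) (F : R -> set_system Omega).
Variables (Q : (X -> R) -> X -> R) (W : R -> Omega -> X -> R).
Hypothesis hF : filtration T F.
Hypothesis hW : wiener_process T P F Q W.
Variables a0 b0 : 'I_N -> R.

Let tm (m : nat) : R := m%:R * h.

Let tm0 m : 0 <= tm m. Proof. by rewrite mulr_ge0// ltW. Qed.

Let tmT m : (m <= M)%N -> tm m <= T.
Proof. by move=> mM; rewrite -Mh ler_pM2r// ler_nat. Qed.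

Let tmS m : tm m < tm m.+1. Proof. by rewrite ltr_pM2r// ltr_nat. Qed.

Let tm_itv m : (m <= M)%N -> 0 <= tm m <= T.
Proof. by move=> mM; rewrite tm0 tmT. Qed.

Definition noise m w (i : 'I_N) : R := inner (W (tm m.+1) w \- W (tm m) w) (e i).

(** Coordinates of the position and of the velocity; taking the solver at every
    sample point makes them adapted functions of the noise, with which the given
    solution of the scheme agrees almost surely. *)
Fixpoint coords m w : ('I_N -> R) * ('I_N -> R) :=
  if m is m'.+1 then
    let: (a, b) := coords m' w in
    let a' := solver a b in
    (a', fun i => velocity h a b a' i + noise m' w i)
  else (a0, b0).

Lemma coordsS m w : coords m.+1 w =
  (solver (coords m w).1 (coords m w).2,
   fun i => velocity h (coords m w).1 (coords m w).2 (solver (coords m w).1 (coords m w).2) i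
     + noise m w i).
Proof. by rewrite /=; case: (coords m w). Qed.

Let sF m : (m <= M)%N -> sigma_algebra setT (F (tm m)).
Proof. by move=> mM; have [H _ _] := hF; apply: H; exact: tm_itv. Qed.

Let F_measurable m : (m <= M)%N -> F (tm m) `<=` measurable.
Proof. by move=> mM; have [_ H _] := hF; apply: H; exact: tm_itv. Qed.

Let F_mono m : (m < M)%N -> F (tm m) `<=` F (tm m.+1).
Proof. by move=> mM; have [_ _ H] := hF; apply: H => //; [exact: ltW|exact: tmT]. Qed.

Let W_L2 m w : (m <= M)%N -> W (tm m) w \in Lfun mu 2%:E.
Proof. by move=> mM; apply: (wiener_L2 hW); exact: tm_itv. Qed.

Let dW m w : X -> R := W (tm m.+1) w \- W (tm m) w.

Let dW_L2 m w : (m < M)%N -> dW m w \in Lfun mu 2%:E.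
Proof. by move=> mM; apply: Lfun2B; apply: W_L2 => //; exact: ltnW. Qed.

Let sigma_L2_inner (Y : Omega -> X -> R) phi : phi \in Lfun mu 2%:E ->
  measurable_wrt (sigma_L2 Y) (fun w => inner (Y w) phi).
Proof.
move=> lphi _ B mB; rewrite setTI; apply: sub_sigma_algebra; apply: sub_sigma_algebra.
exists phi => //=; exists B => //; by rewrite setTI.
Qed.

Let W_inner_wrt m m' phi : (m <= m')%N -> (m' <= M)%N -> phi \in Lfun mu 2%:E ->
  measurable_wrt (F (tm m')) (fun w => inner (W (tm m) w) phi).
Proof.
move=> mm' m'M lphi; have mM := leq_trans mm' m'M.
apply: measurable_wrt_sub (sigma_L2_inner lphi).
apply: subset_trans (wiener_adapted hW (tm_itv mM)) _.
have [_ _ H] := hF; apply: subset_trans (H _ (tm m') (tm0 m) _ (tmT m'M)) _.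
  by rewrite ler_pM2r// ler_nat.
exact: sub_sigma_algebra.
Qed.

Let dW_inner_wrt m phi : (m < M)%N -> phi \in Lfun mu 2%:E ->
  measurable_wrt (F (tm m.+1)) (fun w => inner (dW m w) phi).
Proof.
move=> mM lphi.
have -> : (fun w => inner (dW m w) phi) =
    (fun w => inner (W (tm m.+1) w) phi - inner (W (tm m) w) phi).
  by apply/funext => w; rewrite innerBl//; apply: W_L2 => //; exact: ltnW.
by apply: measurable_funB; apply: W_inner_wrt.
Qed.

(** The coordinates at time m are functions of the increments up to this time,
    through the measurable solver. *)
Lemma coords_measurable m : (m <= M)%N ->
  (forall j, measurable_wrt (F (tm m)) (fun w => (coords m w).1 j)) /\
  (forall j, measurable_wrt (F (tm m)) (fun w => (coords m w).2 j)).
Proof.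
elim: m => [|m IH] mM; first by split => j; exact: measurable_cst.
have [ma mb] := IH (ltnW mM).
have up (f : Omega -> R) : measurable_wrt (F (tm m)) f -> measurable_wrt (F (tm m.+1)) f.
  apply: measurable_wrt_sub; apply: subset_trans (F_mono mM) _.
  exact: sub_sigma_algebra.
have ms j : measurable_wrt (F (tm m)) (fun w => solver (coords m w).1 (coords m w).2 j).
  exact: (measurable_solver he hd uniq_res ma mb j).
split => j.
  rewrite (_ : (fun w => _) = (fun w => solver (coords m w).1 (coords m w).2 j)); last first.
    by apply/funext => w; rewrite coordsS.
  exact: up.
rewrite (_ : (fun w => _) = (fun w => velocity h (coords m w).1 (coords m w).2
    (solver (coords m w).1 (coords m w).2) j + noise m w j)); last first.
  by apply/funext => w; rewrite coordsS.
apply: measurable_funD; last exact: (dW_inner_wrt mM (eigen_Lfun2 he j)).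
apply: up.
apply: (@velocity_closed R N (g_sigma_algebraType (F (tm m))) (fun f => measurable_fun setT f)) => //.
- by move=> f g mf mg; exact: measurable_funD.
- by move=> f g mf mg; exact: measurable_funM.
Qed.

Lemma energy_coordsS C m w (a := (coords m w).1) (b := (coords m w).2)
    (v := velocity h a b (solver a b)) :
  energy C (coords m.+1 w).1 (coords m.+1 w).2 =
  energy C a b + ((\sum_i v i * noise m w i) + 2^-1 * \sum_i noise m w i ^+ 2).
Proof.
rewrite coordsS /= -/a -/b -/v energyDr; congr (_ + _).
exact: (energy_conservation he hd C h0 (solverP uniq_res a b)).
Qed.

Let noise_law m phi (B : set R) : (m < M)%N -> phi \in Lfun mu 2%:E -> measurable B ->
  P ((fun w => inner (dW m w) phi) @^-1` B) = centered_gaussian (h * inner (Q phi) phi) B.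
Proof.
move=> mM lphi mB.
have := wiener_gaussian hW (tm0 m) (tmS m) (tmT mM) lphi mB.
by rewrite (_ : tm m.+1 - tm m = h) // /tm -natr1; ring.
Qed.

Variables (tau K C : R).
Hypothesis hQ : bounded_operator Q.
Hypothesis hQpos : posdef_operator Q.
Hypothesis htau : \sum_(i < N) inner (Q (e i)) (e i) <= tau.
Hypothesis K0 : 0 <= K.
Hypothesis hK : forall z, z \in Lfun mu 2%:E -> inner (Q z) z <= K * inner z z.
Hypothesis hC : forall a b : 'I_N -> R, \sum_i b i ^+ 2 <= 2 * energy C a b.

Let en m w := energy C (coords m w).1 (coords m w).2.

Lemma energy_coords_wrt m : (m <= M)%N -> measurable_wrt (F (tm m)) (en m).
Proof.
move=> mM; have [ma mb] := coords_measurable mM.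
apply: (@energy_closed R d lam e he hd c3 c2 c1 c0 N (g_sigma_algebraType (F (tm m)))
  (fun f => measurable_fun setT f)) => //.
- by move=> f g mf mg; exact: measurable_funD.
- by move=> f g mf mg; exact: measurable_funM.
Qed.

Lemma energy_coords_measurable m : (m <= M)%N -> measurable_fun setT (en m).
Proof.
by move=> mM; apply: measurable_wrt_ambient (energy_coords_wrt mM); exact: F_measurable.
Qed.

(** With the past frozen, the energy increases by a linear and a quadratic form in
    the Gaussian increment.  Integrating it out costs b^2 h K |v|^2 in the
    exponent, with v the intermediate velocity; |v|^2 is at most twice the energy
    after the implicit step, that is, before it. *)
Lemma exp_energy_step (b : R) m : (m < M)%N -> 0 <= b -> 4 * b * h * tau <= 1 ->
  (\int[P]_w (expR (b * en m.+1 w))%:E <=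
   (expR (b * h * tau))%:E * \int[P]_w (expR ((b + 2 * b ^+ 2 * h * K) * en m w))%:E)%E.
Proof.
move=> mM b_ge0 bh.
have mM' := ltnW mM.
have mS2 : sigma_L2 (dW m) `<=` measurable.
  apply: smallest_sub; first exact: sigma_algebra_measurable.
  move=> _ [phi lphi [B mB <-]].
  have mf := measurable_wrt_ambient (F_measurable mM) (dW_inner_wrt mM lphi).
  exact: mf.
have sS2 : sigma_algebra setT (sigma_L2 (dW m)) by exact: smallest_sigma_algebra.
have ind : independent_systems P (F (tm m)) (sigma_L2 (dW m)).
  exact: (wiener_independent hW (tm0 m) (tmS m) (tmT mM)).
pose a w := (coords m w).1; pose bb w := (coords m w).2.
pose v w := velocity h (a w) (bb w) (solver (a w) (bb w)).
have [ma mb] := coords_measurable mM'.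
have ms j : measurable_wrt (F (tm m)) (fun w => solver (a w) (bb w) j).
  exact: (measurable_solver he hd uniq_res ma mb j).
have mv j : measurable_wrt (F (tm m)) (fun w => v w j).
  apply: (@velocity_closed R N (g_sigma_algebraType (F (tm m))) (fun f => measurable_fun setT f)) => //.
  - by move=> f g mf mg; exact: measurable_funD.
  - by move=> f g mf mg; exact: measurable_funM.
have mn j : measurable_wrt (sigma_L2 (dW m)) (fun w => noise m w j).
  exact: (sigma_L2_inner (eigen_Lfun2 he j)).
have mna j : measurable_fun setT (fun w => noise m w j).
  exact: measurable_wrt_ambient mS2 (mn j).
pose O1 := g_sigma_algebraType (F (tm m)).
pose O2 := g_sigma_algebraType (sigma_L2 (dW m)).
pose g (z : O1 * O2) : R := b * (\sum_i v z.1 i * noise m z.2 i) + b / 2 * \sum_i noise m z.2 i ^+ 2.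
pose f (z : O1 * O2) : \bar R := (expR (b * en m z.1) * expR (g z))%:E.
have mexpR (dd : measure_display) (U : measurableType dd) (k : U -> R) :
    measurable_fun setT k -> measurable_fun setT (fun x => expR (k x)).
  by move=> mk; exact: measurableT_comp.
have mn2 j : measurable_fun setT (fun z : O1 * O2 => noise m z.2 j).
  exact: (measurableT_comp (mn j) measurable_snd).
have mv1 j : measurable_fun setT (fun z : O1 * O2 => v z.1 j).
  exact: (measurableT_comp (mv j) measurable_fst).
have mf : measurable_fun setT f.
  apply/measurable_EFinP; apply: measurable_funM; apply: mexpR.
    apply: measurable_funM => //.
    exact: (measurableT_comp (energy_coords_wrt mM') measurable_fst).
  apply: measurable_funD; apply: measurable_funM => //; apply: measurable_sum => j.
    exact: measurable_funM.
  exact: measurable_funX.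
have f0 z : (0 <= f z)%E by rewrite lee_fin mulr_ge0// expR_ge0.
have -> : (\int[P]_w (expR (b * en m.+1 w))%:E = \int[P]_w f (w, w))%E.
  apply: eq_integral => w _; rewrite /f /g /= -expRD; congr (expR _)%:E.
  by rewrite /en energy_coordsS -/(a w) -/(bb w) -/(v w); field.
rewrite (independent_integral (F_measurable mM') mS2 (sF mM') sS2 ind mf f0).
have men : measurable_fun setT (fun w => (expR ((b + 2 * b ^+ 2 * h * K) * en m w))%:E).
  apply/measurable_EFinP; apply: mexpR; apply: measurable_funM => //.
  exact: energy_coords_measurable.
rewrite -ge0_integralZl//.
apply: ae_ge0_le_integral_lower.
- by move=> w; apply: integral_ge0.
- by move=> w; rewrite mule_ge0// lee_fin expR_ge0.
- exact: emeasurable_funM.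
apply: aeW => w.
have mg : measurable_fun setT (fun w' : Omega => (expR (g (w, w')))%:E).
  apply/measurable_EFinP; apply: mexpR.
  apply: measurable_funD; apply: measurable_funM => //; apply: measurable_sum => j.
    by apply: measurable_funM => //; exact: (measurable_cst (v w j)).
  by apply: measurable_funX => //; exact: mna.
have -> : (\int[P]_w' f (w, w') = (expR (b * en m w))%:E * \int[P]_w' (expR (g (w, w')))%:E)%E.
  by rewrite -ge0_integralZl.
have lcv := eigen_comb_Lfun2 he (v w).
have bound : (\int[P]_w' (expR (g (w, w')))%:E <=
    (expR (b ^+ 2 * h * K * (\sum_i v w i ^+ 2) + b * h * tau))%:E)%E.
  have law i (B : set R) : measurable B -> P (noise m ^~ i @^-1` B) =
      centered_gaussian (h * inner (Q (e i)) (e i)) B.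
    by move=> mB; apply: noise_law => //; exact: (eigen_Lfun2 he i).
  have kap0 := posdef_form_ge0 hQ hQpos lcv.
  have kapK : inner (Q (comb (v w))) (comb (v w)) <= K * \sum_i v w i ^+ 2.
    apply: le_trans (hK lcv) _; rewrite (inner_eigen_comb2 he) le_eqVlt; apply/orP; left.
    by apply/eqP; congr (_ * _); apply: eq_bigr => i _; rewrite expr2.
  have lawv (B : set R) : measurable B -> P ((fun w' => \sum_i v w i * noise m w' i) @^-1` B) =
      centered_gaussian (h * inner (Q (comb (v w))) (comb (v w))) B.
    move=> mB; rewrite -(noise_law mM lcv mB); congr (P (_ @^-1` B)).
    apply/funext => w'; rewrite innerC (inner_eigen_combl he _ (dW_L2 w' mM)).
    by apply: eq_bigr => i _; rewrite /noise innerC.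
  exact: (@gaussian_vector_exp R _ _ P N (fun i w => noise m w i)
    (fun i => inner (Q (e i)) (e i)) h N0 h0
    (fun i => posdef_eigen_gt0 he i hQpos) mna law b tau K _
    (v w) b_ge0 htau bh kap0 kapK lawv).
apply: (le_trans (lee_wpmul2l _ bound)); first by rewrite lee_fin expR_ge0.
rewrite -!EFinM lee_fin -!expRD ler_expR.
have vE : \sum_i v w i ^+ 2 <= 2 * en m w.
  apply: le_trans (hC (solver (a w) (bb w)) (v w)) _.
  by rewrite (energy_conservation he hd C h0 (solverP uniq_res (a w) (bb w))).
have c_ge0 : 0 <= b ^+ 2 * h * K by rewrite !mulr_ge0 ?sqr_ge0// ltW.
have := ler_wpM2l c_ge0 vE.
have -> : (b + 2 * b ^+ 2 * h * K) * en m w = b * en m w + b ^+ 2 * h * K * (2 * en m w) by ring.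
by move: (b ^+ 2 * h * K * _) (b ^+ 2 * h * K * _) => x y; lra.
Qed.

Let en_ge0 m w : 0 <= en m w.
Proof.
have := hC (coords m w).1 (coords m w).2.
have : 0 <= \sum_i (coords m w).2 i ^+ 2 by apply: sumr_ge0 => i _; exact: sqr_ge0.
by rewrite -/(en m w); lra.
Qed.

(** The exponent decreases from one step to the next so as to pay for the loss in
    [exp_energy_step]: with rho = 1 + 2 beta h K and b = beta / rho^(m+1), one has
    b + 2 b^2 h K <= b rho = beta / rho^m. *)
Lemma exp_energy_bound (beta : R) m : (m <= M)%N -> 0 < beta -> 0 <= tau ->
  4 * beta * T * tau <= 1 ->
  (\int[P]_w (expR (beta / (1 + 2 * beta * h * K) ^+ m * en m w))%:E <=
   (expR (beta * tau * (m%:R * h) + beta * energy C a0 b0))%:E)%E.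
Proof.
move=> mM bp tau0 bT; set rho := 1 + 2 * beta * h * K.
have rho1 : 1 <= rho by rewrite lerDl !mulr_ge0// ltW.
have rho0 : 0 < rho by exact: lt_le_trans rho1.
elim: m mM => [|m IH] mM.
  rewrite expr0 divr1 mul0r mulr0 add0r.
  rewrite (_ : (fun w => _) = cst (expR (beta * energy C a0 b0))%:E)//.
  rewrite integral_cst// -[leRHS]mule1; apply: lee_wpmul2l; first by rewrite lee_fin expR_ge0.
  exact: probability_le1.
set b := beta / rho ^+ m.+1.
have b0' : 0 <= b by rewrite divr_ge0 ?exprn_ge0// ltW.
have bb : b <= beta by rewrite ler_pdivrMr ?exprn_gt0// ler_peMr ?exprn_ege1// ltW.
have hT : h <= T.
  by rewrite -Mh ler_peMl ?(ltW h0)// ler1n; exact: leq_ltn_trans mM.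
have bh : 4 * b * h * tau <= 1.
  apply: le_trans bT; rewrite ler_wpM2r//; apply: ler_pM => //; first by rewrite mulr_ge0.
    exact: ltW.
  by rewrite ler_wpM2l.
apply: (le_trans (exp_energy_step mM b0' bh)).
have I : (\int[P]_w (expR ((b + 2 * b ^+ 2 * h * K) * en m w))%:E <=
    \int[P]_w (expR (beta / rho ^+ m * en m w))%:E)%E.
  have me k : measurable_fun setT (fun w => (expR (k * en m w))%:E).
    apply/measurable_EFinP; apply: measurableT_comp => //; apply: measurable_funM => //.
    exact: energy_coords_measurable (ltnW mM).
  apply: ge0_le_integral => // w _.
  rewrite lee_fin ler_expR ler_wpM2r//.
  have -> : beta / rho ^+ m = b * rho by rewrite /b exprS; field; rewrite !gt_eqF ?exprn_gt0.
  have -> : b + 2 * b ^+ 2 * h * K = b * (1 + 2 * b * h * K) by ring.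
  by rewrite ler_wpM2l// lerD2l !ler_wpM2r ?ler_wpM2l// ltW.
apply: (@le_trans _ _ ((expR (b * h * tau))%:E * (expR (beta * tau * (m%:R * h) + beta * energy C a0 b0))%:E)%E).
  apply: lee_wpmul2l; first by rewrite lee_fin expR_ge0.
  exact: le_trans I (IH (ltnW mM)).
rewrite -EFinM lee_fin -expRD ler_expR -natr1.
have : b * (h * tau) <= beta * (h * tau) by rewrite ler_wpM2r// mulr_ge0// ltW.
by move=> H; rewrite -subr_ge0; move: H; rewrite -subr_ge0 => H; apply: (le_trans H);
  rewrite le_eqVlt; apply/orP; left; apply/eqP; ring.
Qed.

(** At each step, uniqueness for the implicit equations identifies the solution
    with its coordinates outside of a null set. *)
Lemma coords_solution (u0 v0 : X -> R) (u vb v : nat -> Omega -> X -> R) :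
  a0 = (fun i : 'I_N => inner u0 (e i)) -> b0 = (fun i : 'I_N => inner v0 (e i)) ->
  splitting_avf_solution e (cubic c3 c2 c1 c0) h u0 v0 N M P W u vb v ->
  forall m, (m <= M)%N -> {ae P, forall w,
    (u m w = comb (coords m w).1 %[ae mu]) /\ (v m w = comb (coords m w).2 %[ae mu])}.
Proof.
move=> a0E b0E [uvL2 uv0 uvS]; elim=> [|m IH] mM.
  by apply: filterS uv0 => w; rewrite /= a0E b0E.
apply: filterS2 (IH (ltnW mM)) (uvS m mM) => w [um vm] [st vE].
have [lu lv] := uvL2 m w (ltnW mM).
have [a' [res u'E vbE]] := avf_step_coords he hd h0 lu lv um vm st.
rewrite coordsS -(solver_unique uniq_res res) /=; split => //.
apply: filterS2 vE vbE => x /= H1 H2 xT; rewrite H1// H2//.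
rewrite (_ : (fun i => _) = (fun i => 1 * velocity h (coords m w).1 (coords m w).2 a' i + noise m w i)).
  by rewrite eigen_comb_lin mul1r.
by apply/funext => i; rewrite mul1r.
Qed.

End splitting_process.

(** * From the energy to the L^6 norm *)

Section exponential_integrability.
Context {R : realType} {d : nat}.
Local Notation X := 'rV[R]_d.
Variables (lam : nat -> R) (e : nat -> X -> R).
Hypothesis he : dirichlet_eigenbasis lam e.
Hypothesis hd : d = 1%N \/ d = 2%N.
Variables c3 c2 c1 c0 : R.

Lemma eigen_comb_norm6_fin N (a : 'I_N -> R) :
  exists2 s, 0 <= s & (norm6 (eigen_comb e a) ^+ 2)%E = s%:E.
Proof.
have := norm6_eigen_comb he hd a ltr01.
have : (0 <= norm6 (eigen_comb e a) ^+ 2)%E by rewrite expe_ge0// Lnorm_ge0.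
by case: (norm6 _ ^+ 2)%E => [s| |]//=; rewrite lee_fin => s0 _; exists s.
Qed.

(** The value bst / (2 k) of eps matches the gradient term of [norm6_eigen_comb]
    with the elastic energy, and kap matches its other term with the potential. *)
Lemma norm6_le_energy N (k bst kap C : R) (a b : 'I_N -> R) : 0 < k -> 0 < bst ->
  kap = k * (27 / (bst / (2 * k)) ^+ 2) / bst ->
  (forall t, kap * t ^+ 2 <= quartic c3 c2 c1 c0 t + C) ->
  (k%:E * norm6 (eigen_comb e a) ^+ 2 <= (bst * energy lam e c3 c2 c1 c0 C a b)%:E)%E.
Proof.
move=> k0 b0 kapE HC; set eps := bst / (2 * k) in kapE.
have eps0 : 0 < eps by rewrite divr_gt0// mulr_gt0.
have H1 := norm6_eigen_comb he hd a eps0.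
have H2 := energy_ge he hd a b HC.
have k0' : (0 <= k%:E)%E by rewrite lee_fin ltW.
apply: (le_trans (lee_wpmul2l k0' H1)); rewrite -EFinM lee_fin.
have sb0 : 0 <= \sum_i b i ^+ 2 by apply: sumr_ge0 => i _; exact: sqr_ge0.
apply: (@le_trans _ _ (bst * (2^-1 * (\sum_(i < N) lam i * a i ^+ 2) + kap * \sum_i a i ^+ 2))).
  rewrite le_eqVlt; apply/orP; left; apply/eqP.
  by rewrite kapE /eps; field; rewrite !gt_eqF.
by rewrite ler_pM2l//; lra.
Qed.

Lemma energy_ge_kinetic N (kap C : R) (a b : 'I_N -> R) : 0 <= kap ->
  (forall t, kap * t ^+ 2 <= quartic c3 c2 c1 c0 t + C) ->
  \sum_i b i ^+ 2 <= 2 * energy lam e c3 c2 c1 c0 C a b.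
Proof.
move=> kap0 HC; have H := energy_ge he hd a b HC.
have sa0 : 0 <= \sum_(i < N) lam i * a i ^+ 2.
  by apply: sumr_ge0 => i _; rewrite mulr_ge0 ?sqr_ge0// ltW// (eigen_gt0 he).
have ka0 : 0 <= kap * \sum_i a i ^+ 2 by rewrite mulr_ge0// sumr_ge0// => i _; exact: sqr_ge0.
by lra.
Qed.

End exponential_integrability.

(** * Exponential integrability of the scheme *)

Theorem proposition4p2 (R : realType) (d : nat) (hd : d = 1%N \/ d = 2%N)
    (lam : nat -> R) (e : nat -> 'rV[R]_d -> R)
    (he : dirichlet_eigenbasis lam e)
    (c3 c2 c1 c0 : R) (hc3 : 0 < c3)
    (u0 v0 : 'rV[R]_d -> R) (hX0 : in_H lam e 1 u0 v0)
    (T : R) (hT : 0 < T)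
    (Q : ('rV[R]_d -> R) -> 'rV[R]_d -> R)
    (hQ : bounded_operator Q) (hQsym : symmetric_operator Q)
    (hQpos : posdef_operator Q) (hQtrace : (trace e Q < +oo)%E)
    (sqrtQ : ('rV[R]_d -> R) -> 'rV[R]_d -> R)
    (hsqrtQ : is_sqrt_operator sqrtQ Q)
    (hQHS : (hilbert_schmidt_norm e sqrtQ < +oo)%E)
    (c : R) (hc : 0 < c) :
  let f := fun x : R => c3 * x ^+ 3 + c2 * x ^+ 2 + c1 * x + c0 in
  exists C : R, 0 < C /\
  forall (dO : measure_display) (Omega : measurableType dO)
    (P : probability Omega R) (F : R -> set_system Omega)
    (W : R -> Omega -> 'rV[R]_d -> R),
  filtration T F -> wiener_process T P F Q W ->
  forall hbar0 : R, 0 < hbar0 -> avf_well_posed e f T hbar0 ->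
  forall N M : nat, (0 < N)%N -> (0 < M)%N ->
  forall h : R, M%:R * h = T -> h <= hbar0 ->
  forall u vb v : nat -> Omega -> 'rV[R]_d -> R,
  splitting_avf_solution e f h u0 v0 N M P W u vb v ->
  forall m : nat, (m <= M)%N ->
  (\int[P]_w expeR ((c * h)%:E * \sum_(i < m.+1) norm6 (u i w) ^+ 2) <= C%:E)%E.
Proof.
move=> f.
have [Bu Bu0 HBu] : exists2 B, 0 <= B & forall n, \sum_(i < n) lam i * inner u0 (e i) ^+ 2 <= B.
  have [[_ Hu] _] := hX0.
  have E i : lam i `^ 1 * inner u0 (e i) ^+ 2 = lam i * inner u0 (e i) ^+ 2.
    by rewrite powRr1// ltW// (eigen_gt0 he).
  apply: (nneseries_partial_le (t := fun i => lam i * inner u0 (e i) ^+ 2)).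
    by move=> i; rewrite mulr_ge0 ?sqr_ge0// ltW// (eigen_gt0 he).
  by under eq_eseriesr => i _ do rewrite -E.
have lu0 : u0 \in Lfun (@cube_measure R d) 2%:E by case: hX0 => -[].
have lv0 : v0 \in Lfun (@cube_measure R d) 2%:E by case: hX0 => _ [].
have [tau0 tau00 Htau] : exists2 B, 0 <= B & forall n, \sum_(i < n) inner (Q (e i)) (e i) <= B.
  apply: (nneseries_partial_le (t := fun i => inner (Q (e i)) (e i))) => // i.
  by apply/ltW; exact: (posdef_eigen_gt0 he i hQpos).
(* The trace bound is made positive, since beta is its inverse. *)
pose tau := tau0 + 1.
have tau_gt0 : 0 < tau by rewrite ltr_wpDl.
have [K K0 HK] := operator_form_le hQ.
(* The largest exponent with 4 beta T tau <= 1; bst bounds from below the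
   exponents beta / (1 + 2 beta h K) ^+ i for i <= M. *)
pose beta := (4 * T * tau)^-1.
have beta0 : 0 < beta by rewrite invr_gt0 !mulr_gt0.
pose bst := beta * expR (- (2 * beta * K * T)).
have bst0 : 0 < bst by rewrite mulr_gt0// expR_gt0.
(* An upper bound for c h (m + 1), as h and m h are at most T. *)
pose k := 2 * c * T.
have k0 : 0 < k by rewrite !mulr_gt0.
pose kap := k * (27 / (bst / (2 * k)) ^+ 2) / bst.
have kap0 : 0 <= kap.
  by rewrite divr_ge0 ?(ltW bst0)// mulr_ge0 ?(ltW k0)// divr_ge0// sqr_ge0.
have [CF CF0 HCF] := quartic_coercive c2 c1 c0 kap hc3.
(* Bounds, uniform in N, for the data and for their energy. *)
pose B := Bu + inner u0 u0 + inner v0 v0.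
pose E0 := B + (`|c3| + `|c2| + `|c1| + `|c0|) * (1 + 81 * B * B ^+ 2) + CF.
pose C := expR (beta * tau * T + beta * E0).
exists C; split; first exact: expR_gt0.
move=> dO Omega P F W hF hW hbar0 _ wp N M N0 M0 h Mh hh u vb v sol m mM.
have M0' : (0 : R) < M%:R by rewrite ltr0n.
have h0 : 0 < h by rewrite -(pmulr_rgt0 _ M0') Mh.
have uniq := residual_unique he hd N0 M0 h0 wp Mh hh.
pose a0 := fun i : 'I_N => inner u0 (e i).
pose b0 := fun i : 'I_N => inner v0 (e i).
pose co := coords lam e c3 c2 c1 c0 (N := N) h W a0 b0.
pose en i w := energy lam e c3 c2 c1 c0 CF (co i w).1 (co i w).2.
have hC (a b : 'I_N -> R) := energy_ge_kinetic he hd a b kap0 HCF.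
pose rho := 1 + 2 * beta * h * K.
pose bi i := beta / rho ^+ i.
have men i : (i <= M)%N -> measurable_fun setT (en i).
  by move=> iM; exact: (energy_coords_measurable he hd h0 Mh uniq hF hW).
have Hexp i : (i <= M)%N -> (\int[P]_w (expR (bi i * en i w))%:E <= C%:E)%E.
  move=> iM.
  have bT : 4 * beta * T * tau <= 1.
    by rewrite le_eqVlt /beta; apply/orP; left; apply/eqP; field; rewrite !gt_eqF.
  have htau : \sum_(i < N) inner (Q (e i)) (e i) <= tau.
    by apply: le_trans (Htau N) _; rewrite lerDl.
  have HE := exp_energy_bound he hd N0 h0 Mh uniq hF hW a0 b0 hQ hQpos htau K0 HK hC iM beta0 (ltW tau_gt0) bT.
  apply: (le_trans HE).
  rewrite lee_fin ler_expR; apply: lerD.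
    by rewrite -Mh ler_wpM2l ?mulr_ge0 ?(ltW beta0) ?(ltW tau_gt0)// ler_pM2r// ler_nat.
  rewrite ler_pM2l//; apply: (energy_initial_le he hd c3 c2 c1 c0 CF).
  - apply: (le_trans (eigen_bessel he N lv0)).
    by rewrite /B lerDr addr_ge0// inner_ge0.
  - apply: (le_trans (eigen_bessel he N lu0)).
    by rewrite /B addrAC lerDr addr_ge0// inner_ge0.
  - apply: (le_trans (HBu N)).
    by rewrite /B -addrA lerDl addr_ge0// inner_ge0.
have bstb i : (i <= M)%N -> bst <= bi i.
  move=> iM; rewrite /bi /bst ler_pM2l//.
  have x0 : 0 <= 2 * beta * h * K by rewrite !mulr_ge0// ltW.
  rewrite expRN lef_pV2 ?posrE ?exprn_gt0 ?expR_gt0//; last by rewrite /rho ltr_wpDr.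
  apply: (@le_trans _ _ (expR (2 * beta * h * K) ^+ i)).
    by apply: lerXn2r; rewrite ?nnegrE ?expR_ge0 ?addr_ge0//; exact: expR_ge1Dx.
  rewrite -expRM_natl ler_expR.
  have -> : 2 * beta * K * T = M%:R * (2 * beta * h * K) by rewrite -Mh; ring.
  by rewrite ler_wpM2r// ler_nat.
pose p : R := m.+1%:R^-1.
have p0 : 0 <= p by rewrite invr_ge0.
have mexp i : (i <= M)%N -> measurable_fun setT (fun w => (expR (bi i * en i w))%:E).
  move=> iM; apply/measurable_EFinP; apply: measurableT_comp => //.
  by apply: measurable_funM => //; exact: men.
have iM (i : 'I_m.+1) : (i <= M)%N by apply: leq_trans mM; rewrite -ltnS.
(* Jensen's inequality with equal weights bounds the exponential of the sum by
   this mean, whose integral is at most C. *)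
pose Gd w := (\sum_(i < m.+1) p%:E * (expR (bi i * en i w))%:E)%E.
apply: (@le_trans _ _ (\int[P]_w Gd w)%E); last first.
  rewrite /Gd ge0_integral_sum//; last 2 first.
  - by move=> i; apply: emeasurable_funM => //; exact: mexp.
  - by move=> i w _; rewrite mule_ge0 ?lee_fin ?expR_ge0.
  apply: (@le_trans _ _ (\sum_(i < m.+1) (p * C)%:E)%E).
    apply: lee_sum => i _; rewrite ge0_integralZl//; [|exact: mexp].
    by rewrite EFinM; apply: lee_wpmul2l; [rewrite lee_fin|exact: Hexp].
  by rewrite sumEFin lee_fin sumr_const card_ord -[_ *+ _]mulr_natr mulrAC /p mulVf ?mul1r.
apply: ae_ge0_le_integral_lower.
- by move=> w; exact: expeR_ge0.
- by move=> w; apply: sume_ge0 => i _; rewrite mule_ge0 ?lee_fin ?expR_ge0.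
- by apply: emeasurable_sum => i; apply: emeasurable_funM => //; exact: mexp.
have usol : {ae P, forall w (i : nat), (i <= M)%N -> u i w = eigen_comb e (co i w).1 %[ae cube_measure d]}.
  apply/ae_foralln => i.
  have [iM'|Mi] := leqP i M; last by apply: aeW.
  have := coords_solution he hd h0 uniq erefl erefl sol iM'.
  by apply: filterS => w [].
apply: filterS usol => w usol.
have H6 (i : 'I_m.+1) : norm6 (u i w) = norm6 (eigen_comb e (co i w).1).
  have [luv _] := avf_L2 sol w (iM i).
  apply: norm6_ae (usol i (iM i)); first exact: Lfun2_measurable.
  exact: (eigen_comb_measurable he).
have /choice[s Hs] : forall i : 'I_m.+1, exists s, 0 <= s /\ (norm6 (u i w) ^+ 2)%E = s%:E.
  by move=> i; have [s s0 sE] := eigen_comb_norm6_fin he hd (co i w).1; exists s; rewrite H6.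
have -> : ((c * h)%:E * \sum_(i < m.+1) norm6 (u i w) ^+ 2)%E = (c * h * \sum_i s i)%:E.
  by rewrite [RHS]EFinM -sumEFin; congr (_ * _)%E; apply: eq_bigr => i _; rewrite (Hs i).2.
have -> : c * h * (\sum_i s i) = \sum_i p * (c * h * m.+1%:R * s i).
  rewrite mulr_sumr; apply: eq_bigr => i _.
  have pm : p * m.+1%:R = 1 by rewrite /p mulVf.
  have E (x y z t : R) : x * y = 1 -> z * t = x * (z * y * t).
    by move=> xy; rewrite [RHS](_ : _ = (x * y) * (z * t)); [rewrite xy mul1r|ring].
  exact: E pm.
have p1 : \sum_(i < m.+1) p = 1.
  by rewrite sumr_const card_ord -[_ *+ _]mulr_natr /p mulVf.
rewrite /Gd/=.
apply: (@le_trans _ _ (\sum_i p * expR (c * h * m.+1%:R * s i))%:E).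
  by rewrite lee_fin; apply: (expR_jensen (p := fun=> p)).
rewrite -sumEFin; apply: lee_sum => i _; rewrite -EFinM lee_fin ler_wpM2l// ler_expR.
have H := norm6_le_energy he hd (co i w).1 (co i w).2 k0 bst0 erefl HCF.
have [si0 sE] := Hs i; rewrite -H6 sE -EFinM lee_fin in H.
have e0 : 0 <= en i w.
  have := hC (co i w).1 (co i w).2; rewrite -/(en i w).
  have : 0 <= \sum_j (co i w).2 j ^+ 2 by apply: sumr_ge0 => j _; exact: sqr_ge0.
  by lra.
apply: (@le_trans _ _ (k * s i)).
  apply: ler_wpM2r => //; rewrite /k.
  have hm : h * m.+1%:R <= 2 * T.
    have hm1 : h * m%:R <= T by rewrite -Mh mulrC ler_pM2r// ler_nat.
    have h1 : h <= T by rewrite -Mh ler_peMl ?(ltW h0)// ler1n.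
    by rewrite -natr1 mulrDr mulr1; lra.
  by have := ler_wpM2l (ltW hc) hm; rewrite !mulrA (mulrC c 2).
apply: le_trans H _; apply: ler_wpM2r => //; exact: bstb.
Qed.
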